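(* Let $\mu$ be a permuton satisfying $\widetilde{\mathrm{LIS}}_r(\mu)=1$ for some $r\in\mathbb{N}^*$. Let $(x,y)\in(0,1]^2$ be such that the left-derivatives $$\alpha_k:=\partial_x^-\widetilde\lambda_k^\mu(x,y)\quad\text{and}\quad\beta_k:=\partial_y^-\widetilde\lambda_k^\mu(x,y)$$ for $1\le k\le r$ all exist. Fix $s,t\ge0$. Then for each $1\le k\le r$ we have the following directional semi-derivative: $$\lim_{\epsilon\to0^+}\frac{\widetilde\lambda_k^\mu(x,y)-\widetilde\lambda_k^\mu(x-t\epsilon,y-s\epsilon)}{\epsilon}=\phi\big((t\alpha_i)_{k\le i\le r},(s\beta_i)_{k\le i\le r}\big),$$ where $\phi$ is the continuous function defined in the context (applied here to a pair of sequences of length $r-k+1$).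
   Context: $\mathbb{N}=\{0,1,2,\dots\}$, $\mathbb{N}^*=\{1,2,\dots\}$. A permuton is a Borel probability measure on $[0,1]^2$ with both marginals uniform on $[0,1]$. A subset $A\subset[0,1]^2$ is nondecreasing if $(x_2-x_1)(y_2-y_1)\ge 0$ for all $(x_1,y_1),(x_2,y_2)\in A$, and $k$-nondecreasing if it is a union of $k$ nondecreasing subsets. For a finite Borel measure $\nu$ on $[0,1]^2$, $\widetilde{\mathrm{LIS}}_k(\nu):=\sup_A \nu(A)$ over closed $k$-nondecreasing $A\subset[0,1]^2$, $\widetilde{\mathrm{LIS}}_0(\nu):=0$. For $(x,y)\in[0,1]^2$, $\widetilde\lambda_k^\mu(x,y):=\widetilde{\mathrm{LIS}}_k(\mu|_{[0,x]\times[0,y]})-\widetilde{\mathrm{LIS}}_{k-1}(\mu|_{[0,x]\times[0,y]})$, where $\mu|_{[0,x]\times[0,y]}$ is the (unnormalized) restriction of $\mu$. The left-derivatives are $\partial_x^-f(x,y)=\lim_{h\to0^+}\frac{f(x,y)-f(x-h,y)}{h}$ and $\partial_y^-f(x,y)=\lim_{h\to0^+}\frac{f(x,y)-f(x,y-h)}{h}$. Definition of $\phi$. Words are finite words with letters in $\mathbb{N}$; $a^m$ denotes the letter $a$ repeated $m$ times. Applying a letter to a word is defined recursively: applying $0$ to a word does not change it; applying a letter $k\ge1$ to a word containing no letter $k$ does not change it; otherwise it changes the first (leftmost) $k$ of the word into $k-1$, and then applies the letter $k-1$ to the part of the word located after this position. For words $w$ and $v=v_1\cdots v_m$, $\mathcal{F}_{\mathrm{bot}}(w,v)$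 is the word obtained from $w$ by applying successively $v_1$, then $v_2$, ..., then $v_m$. Let $\#_1w$ denote the number of letters $1$ in $w$. For $r\in\mathbb{N}^*$ and $(a_k)_{1\le k\le r},(b_k)_{1\le k\le r}\in\mathbb{N}^r$, set $$\phi\big((a_k)_{1\le k\le r},(b_k)_{1\le k\le r}\big):=b_1+\#_1\mathcal{F}_{\mathrm{bot}}\big(r^{a_r}\cdots1^{a_1},\,r^{b_r}\cdots1^{b_1}\big).$$ For each $r\ge1$, $\phi$ has a unique continuous extension to $(\mathbb{R}_+^r)^2$ that is homogeneous: $\phi((ca_k),(cb_k))=c\,\phi((a_k),(b_k))$ for all $c\in\mathbb{R}_+$; this extension is still denoted $\phi$. When $\phi$ is applied to sequences indexed by $k\le i\le r$, they are regarded as sequences of length $r-k+1$, re-indexed from $1$. *)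

(* Defs.v *)
From HB Require Import structures.
From mathcomp Require Import all_boot all_order all_algebra.
From mathcomp Require Import all_classical all_reals all_analysis.

Set Implicit Arguments.
Unset Strict Implicit.
Unset Printing Implicit Defensive.

Import Order.TTheory GRing.Theory Num.Theory.
Import numFieldNormedType.Exports.

Local Open Scope classical_set_scope.
Local Open Scope ring_scope.

Definition nondecreasing_set (R : realType) (A : set (R * R)) : Prop :=
  forall p q, A p -> A q -> 0 <= (q.1 - p.1) * (q.2 - p.2).

Definition k_nondecreasing_set (R : realType) (k : nat) (A : set (R * R)) :
    Prop :=
  exists B : 'I_k -> set (R * R),
    (forall i, nondecreasing_set (B i)) /\ A = \bigcup_(i in [set: 'I_k]) B i.

Definition rectangle (R : realType) (x y : R) : set (R * R) :=
  `[0, x] `*` `[0, y].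

Lemma measurable_rectangle (R : realType) (x y : R) :
  measurable (rectangle x y).
Proof. by apply: measurableX; exact: measurable_itv. Qed.

(* Measures on the unit square are represented by measures on the plane; only
   subsets of the square are ever evaluated. *)
Definition LIS (R : realType) (k : nat)
    (nu : {finite_measure set (R * R)%type -> \bar R}) : \bar R :=
  if k is 0 then 0%E else
  ereal_sup [set nu A | A in
    [set A | [/\ closed A, A `<=` rectangle 1 1 & k_nondecreasing_set k A]]].

Definition is_permuton (R : realType) (mu : probability (R * R)%type R) :
    Prop :=
  [/\ mu (rectangle 1 1) = 1%E,
      forall A : set R, measurable A ->
        pushforward mu fst A = uniform_prob (@ltr01 R) A
    & forall A : set R, measurable A ->
        pushforward mu snd A = uniform_prob (@ltr01 R) A].

Definition lambda (R : realType) (mu : probability (R * R)%type R) (k : nat)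
    (x y : R) : R :=
  let nu := mrestr mu (measurable_rectangle x y) in
  fine (LIS k nu - LIS k.-1 nu)%E.

Definition is_left_dx (R : realType) (f : R -> R -> R) (x y l : R) : Prop :=
  (f x y - f (x - h) y) / h @[h --> 0^'+] --> l.

Definition is_left_dy (R : realType) (f : R -> R -> R) (x y l : R) : Prop :=
  (f x y - f x (y - h)) / h @[h --> 0^'+] --> l.

Fixpoint apply_letter (k : nat) (w : seq nat) : seq nat :=
  if w is x :: w' then
    if (0 < k)%N && (x == k) then k.-1 :: apply_letter k.-1 w'
    else x :: apply_letter k w'
  else [::].

Definition Fbot (w v : seq nat) : seq nat :=
  foldl (fun u k => apply_letter k u) w v.

(* The word r^{a_r} ... 1^{a_1}; entry [i] of [a] is the multiplicity of the
   letter [i.+1]. *)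
Definition decreasing_word (r : nat) (a : 'rV[nat]_r) : seq nat :=
  flatten [seq nseq (a ord0 i) i.+1 | i <- rev (enum 'I_r)].

(* For sequences of length [n.+1]. *)
Definition phi_nat (n : nat) (a b : 'rV[nat]_n.+1) : nat :=
  b ord0 ord0 + count_mem 1%N (Fbot (decreasing_word a) (decreasing_word b)).

Definition orthant (R : realType) (n : nat) : set 'rV[R]_n :=
  [set a | forall i, 0 <= a ord0 i].

Definition is_phi_extension (R : realType) (n : nat)
    (f : 'rV[R]_n.+1 * 'rV[R]_n.+1 -> R) : Prop :=
  [/\ {within @orthant R n.+1 `*` @orthant R n.+1, continuous f},
      forall c a b, 0 <= c -> orthant a -> orthant b ->
        f (c *: a, c *: b) = c * f (a, b)
    & forall a b : 'rV[nat]_n.+1,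
        f (map_mx (fun m => m%:R) a, map_mx (fun m => m%:R) b) =
        (phi_nat a b)%:R].

(* The continuous homogeneous extension exists and is unique on the product of
   orthants; its values elsewhere are irrelevant. *)
Definition phi (R : realType) (n : nat) (a b : 'rV[R]_n.+1) : R :=
  xget (fun=> 0) [set f | @is_phi_extension R n f] (a, b).

(* Main.v *)
(* Sample mu by finitely many points. The points below and to the left of a
   corner determine a word read down the right edge, whose letters 1..k count,
   by Greene's theorem, the points of the best union of k increasing sequences.
   Removing the last columns one by one applies the letters w of the top edge
   to the word v of the right edge, so the increments of lambda_k between two
   corners are numbers of letters k in w and in [Fbot v w].

   For such words, #_{>=k} w + #_{>=k} [Fbot v w] is the maximum of
   L_I(v) + L_J(w) over disjoint sets I, J of lines >= k, where L_I(v) is the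
   largest number of letters collected by non-crossing upward paths started on
   the lines of I: applying a letter to v amounts to moving a starting point.
   If the letters of v are spread evenly, as left differentiability forces
   asymptotically, it is best to move all the particles at the start of v, so
   that the maximum depends only on the frequencies of the letters. The same
   holds for decreasing words, and thus phi is the same function of the
   frequencies. *)

From HB Require Import structures.
From mathcomp Require Import all_boot all_order all_algebra.
From mathcomp Require Import all_classical all_reals all_analysis.
From mathcomp Require Import zify ring lra.
Require Import Defs.

Set Implicit Arguments.
Unset Strict Implicit.
Unset Printing Implicit Defensive.

Local Open Scope nat_scope.

(** * Letters read by disjoint increasing paths *)

(** Passing a letter obeys an exact rule. Let [f] and [g] be the values of a word before and after
    the letter [l] passes, as functions of the starting lines. If line [l] is free in [I], then
    [g I = f I]; otherwise [g I] is the larger of [f I - 1] and the best [f (mv I l j)] over free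
    [j > l]. The formula for [Fbot] follows by induction on the letters of the top edge.

    A particle waiting there is a chain that can still take points. When a passing letter turns a 1
    into 0, waiting particles can no longer collect it, and a bonus at that height restores the
    rule. Read backwards, a point added at height [p] is a bonus at [p].

    In the limit, a family on finitely many lines jumps a bounded number of times, so the errors
    stay small compared with the sample size. This requires letters above [r] to be rare, which
    [LIS r mu = 1] gives. Since [lambda k] counts letters [>= k] minus letters [>= k.+1], it is
    compared with a difference of two maxima, and [phi] is the same difference. *)

(* [J i] is the number of particles on line [i]; line 0 is a reservoir that may
   hold several of them. *)
Definition mv (J : nat -> nat) (j x : nat) : nat -> nat :=
  fun i => J i - (i == j) + (i == x).

Definition adm_state (J : nat -> nat) : Prop :=
  (forall i, 0 < i -> J i <= 1) /\ exists R, forall i, R <= i -> J i = 0.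

Ltac case_eq1 a b :=
  let H := fresh "H" in destruct (@eqP _ a b) as [H|H];
  [try subst a; try subst b | ].
Ltac case_eqs :=
  repeat match goal with
  | |- context [?a == ?b] => case_eq1 a b
  | H : context [?a == ?b] |- _ => case_eq1 a b
  end.
Ltac mv_lia := rewrite ?/mv; case_eqs; try lia.
Ltac mv_eq := apply: funext => ?; mv_lia.

Lemma mvE J j x i : mv J j x i = J i - (i == j) + (i == x).
Proof. by []. Qed.

Lemma mv_mv_tgt J j x y : j != x -> J x = 0 -> mv (mv J j x) x y = mv J j y.
Proof. by move=> jx Jx; mv_eq. Qed.

Lemma mv_mv_src J i j x : i != j -> j != x -> 0 < J j -> J i != 0 ->
  mv (mv J j x) i j = mv J i x.
Proof. by move=> ij jx Jj Ji; mv_eq. Qed.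

Lemma mv_mvC J i j x y : i != j -> i != x -> j != y -> x != y ->
  0 < J j -> 0 < J i -> mv (mv J j x) i y = mv (mv J i y) j x.
Proof. by move=> ij ix jy xy Jj Ji; mv_eq. Qed.

Lemma adm_mv J j x : adm_state J -> 0 < x -> J x = 0 -> adm_state (mv J j x).
Proof.
move=> [J1 [R JR]] x0 Jx; split.
  by move=> i i0; have := J1 i i0; mv_lia.
by exists (R + x.+1) => i iR; have := JR i; mv_lia.
Qed.

Lemma adm_free J l : adm_state J -> exists2 j, l < j & J j = 0.
Proof. by move=> [_ [R JR]]; exists (R + l.+1); [lia | apply: JR; lia]. Qed.

Lemma adm_min_free J l : adm_state J ->
  exists j, [/\ l < j, J j = 0 & forall i, l < i -> i < j -> 0 < J i].
Proof.
move=> /(adm_free l) [j0 lj0 Jj0].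
have ex : exists j, (l < j) && (J j == 0) by exists j0; rewrite lj0 Jj0.
case: (ex_minnP ex) => j /andP[lj /eqP Jj] jmin; exists j; split=> // i li ij.
by rewrite lt0n; apply/negP => Ji; have := jmin i; rewrite li Ji /=; lia.
Qed.

(* One letter [x] read by a family of disjoint up-moving paths occupying [J]. *)
Definition lstep (b : bool) (x : nat) (phi : (nat -> nat) -> nat)
    (J : nat -> nat) : nat :=
  if x == 0 then (b && (0 < J 0)) + phi J
  else if 0 < J x then (phi J).+1
  else maxn (phi J) (\max_(j < x | 0 < J j) (phi (mv J j x)).+1).

Lemma lstep0 b phi J : lstep b 0 phi J = (b && (0 < J 0)) + phi J.
Proof. by []. Qed.

Lemma lstep_in b x phi J : 0 < x -> 0 < J x -> lstep b x phi J = (phi J).+1.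
Proof. by rewrite /lstep; case: x => // x _ ->. Qed.

Lemma lstep_stay b x phi J : phi J <= lstep b x phi J.
Proof. by rewrite /lstep; case: ifP => _; [lia|case: ifP => _; [lia|exact: leq_maxl]]. Qed.

Lemma lstep_move b x phi J j : J x = 0 -> j < x -> 0 < J j ->
  phi (mv J j x) < lstep b x phi J.
Proof.
move=> Jx jx Jj; rewrite /lstep; case: x jx Jx => // x jx ->.
rewrite /= leq_max; apply/orP; right.
by apply: (@leq_bigmax_cond _ (fun j : 'I_x.+1 => 0 < J j)
  (fun j : 'I_x.+1 => (phi (mv J j x.+1)).+1) (Ordinal jx)).
Qed.

Lemma lstep_case b x phi J : 0 < x -> J x = 0 ->
  lstep b x phi J = phi J \/
  exists j, [/\ j < x, 0 < J j & lstep b x phi J = (phi (mv J j x)).+1].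
Proof.
rewrite /lstep; case: x => // x _ -> /=.
set M := \max_(_ < _ | _) _.
case: (leqP M (phi J)) => h; first by left.
right; have [|j Jj Mj] := @eq_bigmax_cond _ (fun j : 'I_x.+1 => 0 < J j)
    (fun j : 'I_x.+1 => (phi (mv J j x.+1)).+1).
  rewrite lt0n; apply/negP => /eqP /card0_eq e.
  by move: h; rewrite /M big1 // => i Ji; have := e i; rewrite unfold_in /= Ji.
by exists j; split; [ | exact: Jj | exact: Mj].
Qed.

Definition mono (phi : (nat -> nat) -> nat) : Prop := forall J j x,
  adm_state J -> 0 < J j -> j < x -> J x = 0 -> phi (mv J j x) <= phi J.

(* [psi] is obtained from [phi] by letting the letter [l] pass. *)
Definition passes (l : nat) (phi psi : (nat -> nat) -> nat) : Prop :=
  [/\ forall I, adm_state I -> I l = 0 -> psi I = phi I,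
      forall I, adm_state I -> 0 < I l -> phi I <= (psi I).+1,
      forall I j, adm_state I -> 0 < I l -> l < j -> I j = 0 ->
        phi (mv I l j) <= psi I
    & forall I, adm_state I -> 0 < I l -> psi I < phi I \/
        exists j, [/\ l < j, I j = 0 & psi I <= phi (mv I l j)]].

(** The particle on the lower line [j] imitates the one on [y]: it jumps straight to [y], or to the
    next line visited by the other one, when that letter is read. If some [i] enters the line [j]
    left free, then [i] takes over the role of [j] in the comparison. *)
Lemma mono_lstep b x phi : mono phi -> mono (lstep b x phi).
Proof.
move=> mphi J j y aJ Jj jy Jy.
have y0 : 0 < y by lia.
case: (posnP x) => [->|x0].
  rewrite !lstep0; apply: leq_add; last exact: mphi.
  have h : 0 < mv J j y 0 -> 0 < J 0 by mv_lia.
  by case: b => //=; move: h; case: (0 < mv J j y 0) => //= ->.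
have am := adm_mv j aJ y0 Jy.
case: (posnP (mv J j y x)) => [Mx|Mx]; last first.
  rewrite lstep_in //.
  case: (posnP (J x)) => [Jx|Jx]; last by rewrite lstep_in // ltnS; exact: mphi.
  have -> : y = x by move: Mx; rewrite mvE Jx; case_eqs.
  apply: lstep_move => //.
  have xy : x = y by move: Mx; rewrite mvE Jx; case_eqs.
  by rewrite xy.
have xy : x != y by apply/negP => /eqP xy; move: Mx; rewrite mvE xy eqxx; lia.
case: (posnP (J x)) => [Jx|Jx].
  case: (lstep_case b phi x0 Mx) => [->|[i [ix Mi ->]]].
    by apply: leq_trans (lstep_stay _ _ _ _); exact: mphi.
  have [iy|iy] := eqVneq i y.
    subst i; rewrite mv_mv_tgt //; last by lia.
    by apply: lstep_move => //; lia.
  have Ji : 0 < J i by move: Mi; rewrite mvE (negPf iy); lia.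
  have [ij|ij] := eqVneq i j.
    (* only line 0 can be occupied twice *)
    subst i; have j0 : j = 0.
      case: (posnP j) => // j0; have := proj1 aJ j j0.
      by move: Mi; rewrite mvE (negPf iy) eqxx; lia.
    subst j.
    have -> : mv (mv J 0 y) 0 x = mv (mv J 0 x) 0 y by mv_eq.
    apply: leq_ltn_trans (lstep_move b phi Jx ix Ji).
    apply: mphi => //; [exact: adm_mv | | ].
    - by move: Mi; rewrite !mvE /=; case_eqs; lia.
    - by rewrite mvE Jy; case_eqs; lia.
  have jx' : j != x by apply/negP => /eqP jx; move: Jj; rewrite jx Jx.
  rewrite mv_mvC //; last by rewrite eq_sym.
  apply: leq_ltn_trans (lstep_move b phi Jx ix Ji).
  apply: mphi => //; first exact: adm_mv.
  - by move: Jj; rewrite mvE; case_eqs; lia.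
  - by move: Jy; rewrite mvE; case_eqs; lia.
have xj : x = j.
  by move: Mx; rewrite mvE; case_eqs; lia.
subst j; rewrite [leqRHS]lstep_in //.
case: (lstep_case b phi x0 Mx) => [->|[i [ix Mi ->]]].
  by apply: leq_trans (mphi _ _ _ aJ Jx jy Jy) _.
have iy : i != y by lia.
have Ji : 0 < J i by move: Mi; rewrite mvE (negPf iy); lia.
rewrite ltnS.
have -> : mv (mv J x y) i x = mv J i y by rewrite mv_mv_src //; lia.
by apply: mphi => //; lia.
Qed.

(** The letter [x] is unchanged, so the same move can be made at [x] on both sides and the clauses
    applied to the resulting state. Care is needed only when the move starts or ends on one of the
    exchanged lines [l] and [j]; then [x] itself may serve as the free line. *)
Lemma passes_lstep b l x phi psi : 0 < l -> x != l -> mono phi ->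
  passes l phi psi -> passes l (lstep b x phi) (lstep b x psi).
Proof.
move=> l0 xl mphi [pA pB0 pB1 pB2].
case: (posnP x) => [x0|x0].
  subst x; split=> [I aI Il|I aI Il|I j aI Il lj Ij|I aI Il]; rewrite !lstep0.
  - by rewrite pA.
  - by have := pB0 I aI Il; lia.
  - have -> : (0 < mv I l j 0) = (0 < I 0) by mv_lia.
    by have := pB1 I j aI Il lj Ij; lia.
  - case: (pB2 I aI Il) => [h|[j [lj Ij h]]]; first by left; lia.
    right; exists j; split=> //; rewrite lstep0.
    have -> : (0 < mv I l j 0) = (0 < I 0) by mv_lia.
    by lia.
split=> [I aI Il|I aI Il|I j aI Il lj Ij|I aI Il].
- case: (posnP (I x)) => [Ix|Ix]; last by rewrite !lstep_in // pA.
  apply/eqP; rewrite eqn_leq; apply/andP; split.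
  + case: (lstep_case b psi x0 Ix) => [->|[j [jx Ij ->]]].
      by rewrite pA //; exact: lstep_stay.
    rewrite pA; [exact: lstep_move | exact: adm_mv | mv_lia].
  + case: (lstep_case b phi x0 Ix) => [->|[j [jx Ij ->]]].
      by rewrite -pA //; exact: lstep_stay.
    rewrite -pA; [exact: lstep_move | exact: adm_mv | mv_lia].
- case: (posnP (I x)) => [Ix|Ix]; last by rewrite !lstep_in // ltnS pB0.
  case: (lstep_case b phi x0 Ix) => [->|[j [jx Ij ->]]].
    by have := pB0 I aI Il; have := lstep_stay b x psi I; lia.
  have [jl|jl] := eqVneq j l.
    subst j; have := pB1 I x aI Il jx Ix; have := lstep_stay b x psi I; lia.
  have h : 0 < mv I j x l by mv_lia.
  have := pB0 _ (adm_mv j aI x0 Ix) h; have := lstep_move b psi Ix jx Ij; lia.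
- have j0 : 0 < j by lia.
  have aM := adm_mv l aI j0 Ij.
  case: (posnP (mv I l j x)) => [Mx|Mx]; last first.
    rewrite lstep_in //; case: (posnP (I x)) => [Ix|Ix]; last first.
      by rewrite lstep_in // ltnS; exact: pB1.
    have xj : x = j by move: Mx; mv_lia.
    subst j; rewrite -pA //; last by have := proj1 aI l l0; mv_lia.
    exact: lstep_move.
  have Ix : I x = 0 by move: Mx; mv_lia.
  have xj : x != j by move: Mx; mv_lia.
  case: (lstep_case b phi x0 Mx) => [->|[i [ix Mi ->]]].
    by apply: leq_trans (lstep_stay _ _ _ _); exact: pB1.
  have il : i != l by move: Mi; have := proj1 aI l l0; mv_lia.
  have [ij|ij] := eqVneq i j.
    subst i; rewrite mv_mv_tgt //; last by lia.
    rewrite -pA //; [|exact: adm_mv|by have := proj1 aI l l0; mv_lia].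
    by apply: lstep_move => //; lia.
  have Ii : 0 < I i by move: Mi; mv_lia.
  have -> : mv (mv I l j) i x = mv (mv I i x) l j by mv_eq.
  apply: leq_ltn_trans (lstep_move b psi Ix ix Ii).
  by apply: pB1 => //; [exact: adm_mv | mv_lia | mv_lia].
- case: (posnP (I x)) => [Ix|Ix].
    case: (lstep_case b psi x0 Ix) => [->|[i [ix Ii ->]]].
      case: (pB2 I aI Il) => [h|[j [lj Ij h]]].
        by left; have := lstep_stay b x phi I; lia.
      right; exists j; split=> //; apply: leq_trans h _; exact: lstep_stay.
    have aM := adm_mv i aI x0 Ix.
    have [il|il] := eqVneq i l.
      subst i; right; exists x; split=> //.
      rewrite lstep_in // ?pA //; [by have := proj1 aI l l0; mv_lia | mv_lia].
    have Ml : 0 < mv I i x l by mv_lia.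
    case: (pB2 _ aM Ml) => [h|[j [lj Mj h]]].
      by left; have := lstep_move b phi Ix ix Ii; lia.
    have jx : j != x by move: Mj; mv_lia.
    have [ji|ji] := eqVneq j i.
      subst j; right; exists x; split=> //; first by lia.
      rewrite lstep_in //; last by mv_lia.
      move: h; have -> : mv (mv I i x) l i = mv I l x by mv_eq.
      by [].
    right; exists j; split=> //; first by move: Mj; mv_lia.
    apply: leq_ltn_trans h _.
    have -> : mv (mv I i x) l j = mv (mv I l j) i x by mv_eq.
    by apply: lstep_move => //; mv_lia.
  rewrite !lstep_in //.
  case: (pB2 I aI Il) => [h|[j [lj Ij h]]]; first by left.
  right; exists j; split=> //; rewrite lstep_in //; mv_lia.
Qed.

(** The first letter [h.+1] becomes [h], and [h] travels on through the rest of the word. What makes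
    the two sides match is that [h] and [h.+1] are adjacent: a particle jumping to [h.+1] comes
    either from [h] itself or from a line that could also have jumped to [h]. *)
Lemma passes_lstep_eq b h phi psi : 0 < h -> mono phi ->
  passes h phi psi -> passes h.+1 (lstep b h.+1 phi) (lstep b h psi).
Proof.
move=> h0 mphi [pA pB0 pB1 pB2]; set l := h.+1.
have l0 : 0 < l by [].
have stay_in I : adm_state I -> 0 < I l -> phi I <= lstep b h psi I.
  move=> aI Il; case: (posnP (I h)) => [Ih|Ih].
    by rewrite -pA //; exact: lstep_stay.
  by rewrite lstep_in //; exact: pB0.
split=> [I aI Il|I aI Il|I j aI Il lj Ij|I aI Il].
- case: (posnP (I h)) => [Ih|Ih].
    apply/eqP; rewrite eqn_leq; apply/andP; split.
      case: (lstep_case b psi h0 Ih) => [->|[j [jh Ij ->]]].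
        by rewrite pA //; exact: lstep_stay.
      have aK := adm_mv j aI h0 Ih.
      have Kh : 0 < mv I j h h by mv_lia.
      case: (pB2 _ aK Kh) => [c|[i [hi Ki c]]].
        apply: leq_trans c _; apply: leq_trans (lstep_stay _ _ _ _).
        exact: mphi.
      have Ii : I i = 0 by move: Ki; mv_lia.
      have eq1 : mv (mv I j h) h i = mv I j i by apply: mv_mv_tgt => //; lia.
      have jl : j < l by lia.
      apply: leq_ltn_trans (lstep_move b phi Il jl Ij).
      apply: leq_trans c _; rewrite eq1; have [il|il] := eqVneq i l.
        by rewrite il.
      rewrite -(@mv_mv_tgt I j l i) //; last by lia.
      by apply: mphi => //; [exact: adm_mv | mv_lia | lia | mv_lia].
    case: (lstep_case b phi l0 Il) => [->|[j [jl Ij ->]]].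
      by rewrite -pA //; exact: lstep_stay.
    have jh : j < h by case: (ltngtP j h) => // e; [lia | subst j; lia].
    apply: leq_ltn_trans (lstep_move b psi Ih jh Ij).
    rewrite -(@mv_mv_tgt I j h l) //; last by lia.
    by apply: pB1 => //; [exact: adm_mv | mv_lia | mv_lia].
  rewrite [LHS]lstep_in //; apply/eqP; rewrite eqn_leq; apply/andP; split.
    case: (pB2 I aI Ih) => [c|[j [hj Ij c]]].
      exact: leq_trans c (lstep_stay _ _ _ _).
    apply: leq_ltn_trans (lstep_move b phi Il (ltnSn h) Ih).
    apply: leq_trans c _; have [jl|jl] := eqVneq j l; first by rewrite jl.
    rewrite -(@mv_mv_tgt I h l j) //; last by lia.
    by apply: mphi => //; [exact: adm_mv | mv_lia | lia | mv_lia].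
  case: (lstep_case b phi l0 Il) => [->|[j [jl Ij ->]]]; first exact: pB0.
  rewrite ltnS; have [jh|jh] := eqVneq j h.
    by subst j; apply: pB1.
  apply: (@leq_trans (phi (mv I h l))); last exact: pB1.
  have -> : mv I j l = mv (mv I h l) j h by mv_eq.
  have I1 := proj1 aI h h0.
  by apply: mphi => //; [exact: adm_mv | mv_lia | lia | mv_lia].
- by rewrite lstep_in // ltnS; exact: stay_in.
- have j0 : 0 < j by lia.
  have I1 := proj1 aI l l0.
  have Ml : mv I l j l = 0 by mv_lia.
  have aM := adm_mv l aI j0 Ij.
  case: (lstep_case b phi l0 Ml) => [->|[i [il Mi ->]]].
    by apply: leq_trans (stay_in _ aI Il); exact: mphi.
  have Ii : 0 < I i by move: Mi; mv_lia.
  have -> : mv (mv I l j) i l = mv I i j by mv_eq.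
  case: (posnP (I h)) => [Ih|Ih].
    have ih : i < h by case: (ltngtP i h) => // e; [lia | subst i; lia].
    apply: leq_ltn_trans (lstep_move b psi Ih ih Ii).
    rewrite -(@mv_mv_tgt I i h j) //; last by lia.
    by apply: pB1; [exact: adm_mv | mv_lia | lia | mv_lia].
  rewrite lstep_in // ltnS; have [ih|ih] := eqVneq i h.
    by subst i; apply: pB1 => //; lia.
  apply: (@leq_trans (phi (mv I h j))); last by apply: pB1 => //; lia.
  have -> : mv I i j = mv (mv I h j) i h by mv_eq.
  have I1' := proj1 aI h h0.
  by apply: mphi => //; [exact: adm_mv | mv_lia | lia | mv_lia].
- have I1 := proj1 aI l l0.
  rewrite [lstep b l phi I]lstep_in //; case: (posnP (I h)) => [Ih|Ih].
    case: (lstep_case b psi h0 Ih) => [->|[i [ih Ii ->]]].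
      by rewrite pA //; left.
    have aK := adm_mv i aI h0 Ih.
    have Kh : 0 < mv I i h h by mv_lia.
    case: (pB2 _ aK Kh) => [c|[j [hj Kj c]]].
      by left; rewrite ltnS; apply: leq_trans c _; exact: mphi.
    have jl : j != l by apply/negP => /eqP e; subst j; move: Kj; mv_lia.
    have Ij : I j = 0 by move: Kj; mv_lia.
    right; exists j; split=> //; first by lia.
    have Ml : mv I l j l = 0 by mv_lia.
    have il : i < l by lia.
    have Mi : 0 < mv I l j i by mv_lia.
    apply: leq_ltn_trans (lstep_move b phi Ml il Mi).
    have -> : mv (mv I l j) i l = mv I i j by mv_eq.
    by rewrite -(@mv_mv_tgt I i h j) //; lia.
  rewrite lstep_in //; case: (pB2 I aI Ih) => [c|[j [hj Ij c]]]; first by left.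
  have jl : j != l by apply/negP => /eqP e; subst j; lia.
  right; exists j; split=> //; first by lia.
  have Ml : mv I l j l = 0 by mv_lia.
  have Mh : 0 < mv I l j h by mv_lia.
  apply: leq_ltn_trans (lstep_move b phi Ml (ltnSn h) Mh).
  by have -> : mv (mv I l j) h l = mv I h j by mv_eq.
Qed.

(* No letter ever lies on line 0, so its particles may leave at once. *)
Definition flat (phi : (nat -> nat) -> nat) : Prop := forall J x,
  adm_state J -> 0 < J 0 -> 0 < x -> J x = 0 ->
  (forall i, 0 < i -> i < x -> 0 < J i) -> phi J <= phi (mv J 0 x).

Lemma flat_lstep b x phi : (x = 0 -> b = false) -> mono phi -> flat phi ->
  flat (lstep b x phi).
Proof.
move=> hb mphi fphi J y aJ J0 y0 Jy Jmin.
case: (posnP x) => [x0|x0].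
  by subst x; rewrite !lstep0 hb //= !add0n; exact: fphi.
have aM := adm_mv 0 aJ y0 Jy.
case: (posnP (J x)) => [Jx|Jx]; last first.
  rewrite !lstep_in //; [by rewrite ltnS; exact: fphi | mv_lia].
have yx : y <= x.
  by rewrite leqNgt; apply/negP => xy; have := Jmin x x0 xy; rewrite Jx.
have [xy|xy] := eqVneq x y.
  subst y; rewrite [leqRHS]lstep_in //; last by mv_lia.
  case: (lstep_case b phi x0 Jx) => [->|[j [jx Jj ->]]].
    by apply: leq_trans (fphi _ _ aJ J0 x0 Jx Jmin) _.
  rewrite ltnS; case: (posnP j) => [-> //|j0].
  have -> : mv J 0 x = mv (mv J j x) 0 j by mv_eq.
  have Jj1 := proj1 aJ j j0.
  apply: fphi => //; [exact: adm_mv | mv_lia | mv_lia |].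
  by move=> i i0 ij; have := Jmin i i0; mv_lia.
have Mx : mv J 0 y x = 0 by mv_lia.
have yx' : y < x by lia.
have My : 0 < mv J 0 y y by mv_lia.
case: (lstep_case b phi x0 Jx) => [->|[j [jx Jj ->]]].
  by apply: leq_trans (lstep_stay _ _ _ _); exact: fphi.
have key : phi (mv J j x) <= phi (mv J 0 x) ->
    phi (mv J j x) < lstep b x phi (mv J 0 y).
  move=> c; apply: leq_ltn_trans (lstep_move b phi Mx yx' My).
  by rewrite mv_mv_tgt //; lia.
case: (posnP j) => [j0|j0]; first by subst j; apply: key.
have aK := adm_mv j aJ x0 Jx.
have Jj1 := proj1 aJ j j0.
case: (ltnP j y) => jy.
  apply: key; have -> : mv J 0 x = mv (mv J j x) 0 j by mv_eq.
  apply: fphi => //; [mv_lia | mv_lia |].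
  by move=> i i0 ij; have := Jmin i i0; mv_lia.
have Mj : 0 < mv J 0 y j by mv_lia.
apply: leq_ltn_trans (lstep_move b phi Mx jx Mj).
have -> : mv (mv J 0 y) j x = mv (mv J j x) 0 y by mv_eq.
apply: fphi => //; [mv_lia | mv_lia |].
by move=> i i0 ij; have := Jmin i i0; mv_lia.
Qed.

Lemma passes_lstep1 b phi : mono phi -> flat phi ->
  passes 1 (lstep b 1 phi) (lstep true 0 phi).
Proof.
move=> mphi fphi.
split=> [I aI Il|I aI Il|I j aI Il lj Ij|I aI Il]; rewrite ?lstep0 /=.
- case: (posnP (I 0)) => [I0|I0]; rewrite /= ?add0n ?add1n.
    case: (lstep_case b phi (ltn0Sn 0) Il) => [-> //|[j [jx Ij _]]].
    have e : j = 0 by lia.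
    by subst j; lia.
  apply/eqP; rewrite eqn_leq; apply/andP; split.
    apply: leq_ltn_trans (lstep_move b phi Il (ltnSn 0) I0).
    by apply: fphi => //; lia.
  case: (lstep_case b phi (ltn0Sn 0) Il) => [->|[j [jx Ij ->]]]; first by lia.
  have e : j = 0 by lia.
  by subst j; rewrite ltnS; exact: mphi.
- by rewrite lstep_in //; lia.
- have I1 := proj1 aI 1 (ltn0Sn 0).
  have Ml : mv I 1 j 1 = 0 by mv_lia.
  case: (lstep_case b phi (ltn0Sn 0) Ml) => [->|[i [ix Mi ->]]].
    by apply: leq_trans (leq_addl _ _); exact: mphi.
  have e : i = 0 by lia.
  subst i; have I0 : 0 < I 0 by move: Mi; mv_lia.
  rewrite I0 add1n ltnS.
  have -> : mv (mv I 1 j) 0 1 = mv I 0 j by mv_eq.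
  by apply: mphi => //; lia.
- rewrite [lstep b 1 phi I]lstep_in //; case: (posnP (I 0)) => [I0|I0] /=.
    by left; rewrite add0n.
  have [j [lj Ij Imin]] := adm_min_free 1 aI.
  have I1 := proj1 aI 1 (ltn0Sn 0).
  right; exists j; split=> //.
  have Ml : mv I 1 j 1 = 0 by mv_lia.
  have M0 : 0 < mv I 1 j 0 by mv_lia.
  rewrite add1n; apply: leq_ltn_trans (lstep_move b phi Ml (ltnSn 0) M0).
  have -> : mv (mv I 1 j) 0 1 = mv I 0 j by mv_eq.
  apply: fphi => //; first by lia.
  move=> i i0 ij; have [->//|i1] := eqVneq i 1.
  by apply: Imin => //; lia.
Qed.

Definition add_at (d x : nat) (J : nat -> nat) : nat -> nat :=
  fun i => J i + (if i == x then d else 0).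

Lemma adm_mark d J : adm_state J -> adm_state (add_at d 0 J).
Proof.
move=> [J1 [R JR]]; split; first by move=> i i0; have := J1 i i0; rewrite /add_at; mv_lia.
by exists R.+1 => i iR; have := JR i; rewrite /add_at; mv_lia.
Qed.

Lemma adm_add J x : adm_state J -> 0 < x -> J x = 0 -> adm_state (add_at 1 x J).
Proof.
move=> [J1 [R JR]] x0 Jx; split; first by move=> i i0; have := J1 i i0; rewrite /add_at; mv_lia.
by exists (R + x.+1) => i iR; have := JR i; rewrite /add_at; mv_lia.
Qed.

Lemma mono_mark d phi : mono phi -> mono (fun J => phi (add_at d 0 J)).
Proof.
move=> mphi J j x aJ Jj jx Jx.
have -> : add_at d 0 (mv J j x) = mv (add_at d 0 J) j x by apply: funext => i; rewrite /add_at; mv_lia.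
by apply: mphi => //; [exact: adm_mark | rewrite /add_at; lia | rewrite /add_at; mv_lia].
Qed.

Lemma flat_mark d phi : flat phi -> flat (fun J => phi (add_at d 0 J)).
Proof.
move=> fphi J x aJ J0 x0 Jx Jmin.
have -> : add_at d 0 (mv J 0 x) = mv (add_at d 0 J) 0 x by apply: funext => i; rewrite /add_at; mv_lia.
apply: fphi => //; [exact: adm_mark | rewrite /add_at; lia | rewrite /add_at; mv_lia |].
by move=> i i0 ix; have := Jmin i i0 ix; rewrite /add_at; lia.
Qed.

Lemma passes_mark d l phi psi : 0 < l -> passes l phi psi ->
  passes l (fun J => phi (add_at d 0 J)) (fun J => psi (add_at d 0 J)).
Proof.
move=> l0 [pA pB0 pB1 pB2].
have ml I : add_at d 0 I l = I l by rewrite /add_at; mv_lia.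
have mvm I j : l < j -> 0 < I l -> add_at d 0 (mv I l j) = mv (add_at d 0 I) l j.
  by move=> lj Il; apply: funext => i; rewrite /add_at; mv_lia.
split=> [I aI Il|I aI Il|I j aI Il lj Ij|I aI Il].
- by apply: pA; rewrite ?ml //; exact: adm_mark.
- by apply: pB0; rewrite ?ml //; exact: adm_mark.
- rewrite mvm //; apply: pB1; rewrite ?ml //; first exact: adm_mark.
  by rewrite /add_at; mv_lia.
- case: (pB2 _ (adm_mark d aI)); rewrite ?ml //; first by left.
  move=> [j [lj Ij c]]; have Ij' : I j = 0 by move: Ij; rewrite /add_at; lia.
  by right; exists j; split=> //; rewrite mvm.
Qed.

(* [D h] particles enter line 0 at height [h], i.e. before the [h] lowest
   letters are read; a letter 0 at a height in [B] rewards the presence of a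
   particle on line 0. *)
Fixpoint lppm (D : nat -> nat) (B : nat -> bool) (J : nat -> nat) (u : seq nat)
    : nat :=
  if u is x :: u' then
    lstep (B (size u')) x (fun K => lppm D B (add_at (D (size u')) 0 K) u') J
  else 0.

(** Heights count from the end of the word. The bonus is off at the zeros already present in [u], as
    [flat] requires, and on elsewhere, where a zero can only be created by a passing letter. *)
Fixpoint nonzero_heights (B : nat -> bool) (u : seq nat) : Prop :=
  if u is x :: u' then B (size u') = (x != 0) /\ nonzero_heights B u' else True.

Lemma mono_lppm D B u : mono (fun J => lppm D B J u).
Proof.
elim: u => [|x u IH] /=; first by [].
apply: (@mono_lstep (B (size u)) x (fun K => lppm D B (add_at (D (size u)) 0 K) u)).
exact: (mono_mark _ IH).
Qed.

Lemma flat_lppm D B u : nonzero_heights B u -> flat (fun J => lppm D B J u).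
Proof.
elim: u => [|x u IH] /=; first by [].
move=> [Bx Bu].
apply: (@flat_lstep (B (size u)) x (fun K => lppm D B (add_at (D (size u)) 0 K) u)).
- by rewrite Bx => ->.
- exact: (mono_mark _ (@mono_lppm _ _ _)).
- exact: (flat_mark _ (IH Bu)).
Qed.

Lemma apply_letter0 u : apply_letter 0 u = u.
Proof. by elim: u => //= x u ->. Qed.

Lemma size_apply_letter l u : size (apply_letter l u) = size u.
Proof. by elim: u l => //= x u IH l; case: ifP => _ /=; rewrite IH. Qed.

(** The three ways in which [apply_letter] treats the first letter are those of [passes_lstep],
    [passes_lstep_eq] and [passes_lstep1]; the last one asks for a bonus where the 1 is erased. *)
Lemma lppm_passes D B l u : 0 < l -> nonzero_heights B u ->
  passes l (fun J => lppm D B J u) (fun J => lppm D B J (apply_letter l u)).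
Proof.
elim: u l => [|x u IH] l l0 /=.
  move=> _; split=> // I aI Il; right.
  by have [j lj Ij] := adm_free l aI; exists j.
move=> [Bx Bu]; rewrite l0 /=.
have mu d : mono (fun K => lppm D B (add_at d 0 K) u).
  exact: (mono_mark _ (@mono_lppm _ _ _)).
have [xl|xl] := eqVneq x l; last first.
  rewrite /= size_apply_letter; apply: (passes_lstep _ l0 xl (mu _)).
  exact: (passes_mark _ l0 (IH _ l0 Bu)).
subst x; rewrite /= size_apply_letter; case: l l0 Bx => // l _ Bl /=.
case: l Bl => [|l] Bl.
  rewrite apply_letter0 Bl /=.
  apply: (passes_lstep1 true (mu _)).
  exact: (flat_mark _ (flat_lppm D Bu)).
apply: (@passes_lstep_eq (B (size u)) l.+1 _ _ (ltn0Sn l) (mu _)).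
exact: (passes_mark _ (ltn0Sn l) (IH _ (ltn0Sn l) Bu)).
Qed.

Definition lpp (J : nat -> nat) (u : seq nat) : nat :=
  lppm (fun=> 0) (fun=> false) J u.

Lemma add_at0 x J : add_at 0 x J = J.
Proof. by apply: funext => i; rewrite /add_at; case: ifP; rewrite addn0. Qed.

Lemma lpp_cons J x u : lpp J (x :: u) = lstep false x (lpp ^~ u) J.
Proof.
rewrite /lpp /=; congr (lstep _ _ _ _); apply: funext => K.
by rewrite add_at0.
Qed.

Lemma lppm_lpp B J u : J 0 = 0 -> lppm (fun=> 0) B J u = lpp J u.
Proof.
elim: u J => // x u IH J J0; rewrite lpp_cons /=.
rewrite /lstep J0 ltnn andbF /= !add_at0 IH //.
case: (posnP x) => [//|x0].
case: ifP => // _; congr maxn; apply: eq_bigr => j Jj.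
by rewrite !add_at0 IH //; mv_lia.
Qed.

Lemma mono_lpp u : mono (lpp ^~ u).
Proof. exact: mono_lppm. Qed.

Lemma lpp_stay J x u : lpp J u <= lpp J (x :: u).
Proof. by rewrite lpp_cons; exact: lstep_stay. Qed.

Lemma nonzero_heights_nth u :
  nonzero_heights (fun h => nth 0 (rev u) h != 0) u.
Proof.
have : forall v w, rev u = v ++ w ->
    nonzero_heights (fun h => nth 0 (rev u) h != 0) (rev v).
  elim/last_ind => [|v x IH] w //= uv; rewrite rev_rcons /=; split.
    by rewrite size_rev uv -cats1 -catA /= nth_cat ltnn subnn.
  by apply: (IH (x :: w)); rewrite uv -cats1 -catA.
by move=> /(_ (rev u) [::]); rewrite cats0 revK; apply.
Qed.

Lemma lpp_passes l u I : 0 < l -> adm_state I -> I 0 = 0 ->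
  [/\ I l = 0 -> lpp I (apply_letter l u) = lpp I u,
      0 < I l -> lpp I u <= (lpp I (apply_letter l u)).+1
    & 0 < I l -> lpp I (apply_letter l u) < lpp I u \/
        exists j, [/\ l < j, I j = 0 & lpp I (apply_letter l u) <= lpp (mv I l j) u]].
Proof.
move=> l0 aI I0.
pose B h := nth 0 (rev u) h != 0.
have okB : nonzero_heights B u by exact: nonzero_heights_nth.
have [pA pB0 _ pB2] := @lppm_passes (fun=> 0) B l u l0 okB.
split=> Il.
- by have := pA I aI Il; rewrite !lppm_lpp.
- by have := pB0 I aI Il; rewrite !lppm_lpp.
- case: (pB2 I aI Il) => [|[j [lj Ij]]]; rewrite !lppm_lpp //; first by left.
    by right; exists j.
  by rewrite /= in I0 *; mv_lia.
Qed.

(** If another particle [j] would jump to the line [x] held by the extra one, it stays behind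
    instead and becomes the extra particle, now on line [j]. *)
Lemma lpp_add J x u : adm_state J -> J 0 = 0 -> 0 < x -> J x = 0 ->
  lpp J u <= lpp (add_at 1 x J) u.
Proof.
elim: u J x => // y u IH J x aJ J0 x0 Jx; rewrite !lpp_cons.
have aA := adm_add aJ x0 Jx.
case: (posnP y) => [->|y0]; first by rewrite !lstep0 /= !add0n; exact: IH.
case: (posnP (J y)) => [Jy|Jy]; last first.
  by rewrite !lstep_in // ?ltnS; [exact: IH | rewrite /add_at; lia].
case: (lstep_case false (lpp ^~ u) y0 Jy) => [->|[j [jy Jj ->]]].
  by apply: leq_trans (lstep_stay _ _ _ _); exact: IH.
have [xy|xy] := eqVneq x y.
  subst y; rewrite lstep_in //; last by rewrite /add_at eqxx addn1.
  have -> : add_at 1 x J = add_at 1 j (mv J j x).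
    by apply: funext => i; rewrite /add_at; mv_lia.
  have j0 : 0 < j by case: (posnP j) Jj => [->|]; rewrite ?J0.
  by rewrite ltnS; apply: IH; [exact: adm_mv | mv_lia | by [] | have := proj1 aJ j j0; mv_lia].
have Ay : add_at 1 x J y = 0 by rewrite /add_at; mv_lia.
have Aj : 0 < add_at 1 x J j by rewrite /add_at; lia.
apply: leq_trans (lstep_move false (lpp ^~ u) Ay jy Aj).
have -> : mv (add_at 1 x J) j y = add_at 1 x (mv J j y).
  by apply: funext => i; rewrite /add_at; mv_lia.
by rewrite ltnS; apply: IH; [exact: adm_mv | mv_lia | by [] | mv_lia].
Qed.

(** * The letters [>= k] of [Fbot v w] and pairs of path families *)

Definition count_ge (k : nat) (u : seq nat) : nat := count (leq k) u.

(* Disjoint starting positions for the two families of paths. *)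
Definition split_state (k : nat) (I J : nat -> nat) : Prop :=
  [/\ adm_state I, adm_state J, forall i, I i + J i <= 1
    & forall i, i < k -> I i + J i = 0].

Lemma lpp_le_count k I u : (forall i, i < k -> I i = 0) ->
  lpp I u <= count_ge k u.
Proof.
elim: u I => // x u IH I Ik; rewrite lpp_cons /count_ge /=.
case: (posnP x) => [->|x0]; first by rewrite lstep0 /=; have := IH I Ik; rewrite /count_ge; lia.
case: (posnP (I x)) => [Ix|Ix]; last first.
  have kx : k <= x by rewrite leqNgt; apply/negP => /Ik; lia.
  by rewrite lstep_in // kx add1n ltnS; exact: IH.
case: (lstep_case false (lpp ^~ u) x0 Ix) => [->|[j [jx Ij ->]]].
  by have := IH I Ik; rewrite /count_ge; lia.
have kj : k <= j by rewrite leqNgt; apply/negP => /Ik; lia.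
have kx : k <= x by lia.
rewrite kx add1n ltnS; apply: IH => i ik.
by have := Ik i ik; mv_lia.
Qed.

Lemma apply_letter_lt k l I v : adm_state I -> (forall i, i < k -> I i = 0) ->
  0 < k -> l < k -> lpp I (apply_letter l v) = lpp I v.
Proof.
move=> aI Ik k0 lk; case: (posnP l) => [->|l0]; first by rewrite apply_letter0.
by have [pA _ _] := lpp_passes v l0 aI (Ik 0 k0); apply: pA; exact: Ik.
Qed.

Lemma lpp_lt_letter k l J w : (forall i, i < k -> J i = 0) -> l < k ->
  lpp J (l :: w) = lpp J w.
Proof.
move=> Jk lk; rewrite lpp_cons; case: (posnP l) => [->|l0]; first by rewrite lstep0.
case: (lstep_case false (lpp ^~ w) l0 (Jk l lk)) => // [[j [jl Jj]]].
by have := Jk j; lia.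
Qed.

(* The letter [l] is first read by the paths of [J]; the paths of [I], which read
   [apply_letter l v], read [v] instead from modified starting lines. *)
Lemma count_Fbot_ge k v w I J : 0 < k -> split_state k I J ->
  lpp I v + lpp J w <= count_ge k w + count_ge k (Fbot v w).
Proof.
move=> k0; elim: w v I J => [|l w IH] v I J [aI aJ IJ1 IJk].
  rewrite addn0 /=; apply: lpp_le_count => i ik; have := IJk i ik; lia.
have Ik i : i < k -> I i = 0 by move=> ik; have := IJk i ik; lia.
have Jk i : i < k -> J i = 0 by move=> ik; have := IJk i ik; lia.
have -> : count_ge k (l :: w) + count_ge k (Fbot v (l :: w)) =
    (k <= l) + (count_ge k w + count_ge k (Fbot (apply_letter l v) w)).
  by rewrite /count_ge /= addnA.
case: (ltnP l k) => lk.
  rewrite (lpp_lt_letter _ Jk lk) -(apply_letter_lt v aI Ik k0 lk) add0n.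
  exact: IH.
have l0 : 0 < l by lia.
have [pA pB _] := lpp_passes v l0 aI (Ik 0 k0).
case: (posnP (J l)) => [Jl|Jl]; last first.
  rewrite lpp_cons lstep_in // -pA; last by have := IJ1 l; lia.
  by have := IH (apply_letter l v) I J (And4 aI aJ IJ1 IJk); lia.
rewrite lpp_cons.
have IHIJ := IH (apply_letter l v) I J (And4 aI aJ IJ1 IJk).
case: (lstep_case false (lpp ^~ w) l0 Jl) => [->|[j [jl Jj ->]]].
  by case: (posnP (I l)) => [/pA|/pB]; lia.
have kj : k <= j by rewrite leqNgt; apply/negP => /Jk; lia.
have Ij : I j = 0 by have := IJ1 j; lia.
have aJ' := adm_mv j aJ l0 Jl.
case: (posnP (I l)) => [Il|Il].
  rewrite -pA //.
  suff : split_state k I (mv J j l) by move=> /(IH (apply_letter l v)); lia.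
  split=> // i; last by move=> ik; have := IJk i ik; mv_lia.
  by have := IJ1 i; mv_lia.
have aI' : adm_state (mv I l j) by apply: adm_mv => //; lia.
have I1 := proj1 aI l l0.
have I'l : mv I l j l = 0 by mv_lia.
have I'0 : mv I l j 0 = 0 by have := Ik 0 k0; mv_lia.
have le1 : lpp I v <= lpp (mv I l j) v.
  have {1}-> : I = mv (mv I l j) j l by mv_eq.
  by apply: mono_lpp => //; mv_lia.
have [pA' _ _] := lpp_passes v l0 aI' I'0.
suff : split_state k (mv I l j) (mv J j l).
  by move=> /(IH (apply_letter l v)); rewrite pA' //; lia.
split=> // i; last by move=> ik; have := IJk i ik; mv_lia.
by have := IJ1 i; mv_lia.
Qed.

(** Starting lines that are good for [apply_letter l v] and [w] are corrected into ones for [v] and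
    [l :: w]. The new letter is gained by having a particle of [J] on line [l]. If [I] holds that
    line, the rule for passing letters says that [I] either already gains one letter on [v], or may
    give up [l] for a higher line [j]. *)
Lemma count_Fbot_le k v w : 0 < k -> exists I J, split_state k I J /\
  count_ge k w + count_ge k (Fbot v w) <= lpp I v + lpp J w.
Proof.
move=> k0; elim: w v => [|l w IH] v.
  have [R vR] : exists R, forall x, x \in v -> x < R.
    exists (\max_(x <- v) x).+1 => x xv; rewrite ltnS.
    exact: leq_bigmax_seq.
  (* Every line from [k] to the largest letter is occupied, so all letters [>= k] are collected
     without a move. *)
  exists (fun i => ((k <= i) && (i < R) : nat)), (fun=> 0); split.
    split=> // [||i|i ik]; rewrite ?addn0; try by lia.
      by split=> [i _|]; [lia | exists R => i Ri; lia].
    by split=> [i _|]; [lia | exists 0].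
  rewrite addn0 /= /count_ge; elim: v vR => // x v IHv vR.
  have xR : x < R by apply: vR; rewrite mem_head.
  have {}IHv : count (leq k) v <= lpp (fun i => (k <= i) && (i < R)) v.
    by apply: IHv => y yv; apply: vR; rewrite in_cons yv orbT.
  rewrite /=; case: (leqP k x) => kx /=; last first.
    by apply: leq_trans IHv _; exact: lpp_stay.
  by rewrite lpp_cons lstep_in //; lia.
have [I [J [[aI aJ IJ1 IJk] le]]] := IH (apply_letter l v).
have Ik i : i < k -> I i = 0 by move=> ik; have := IJk i ik; lia.
have Jk i : i < k -> J i = 0 by move=> ik; have := IJk i ik; lia.
have eqV : count_ge k (l :: w) + count_ge k (Fbot v (l :: w)) =
    (k <= l) + (count_ge k w + count_ge k (Fbot (apply_letter l v) w)).
  by rewrite /count_ge /= addnA.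
case: (ltnP l k) => lk.
  exists I, J; split=> //; rewrite eqV (lpp_lt_letter _ Jk lk).
  by move: le; rewrite (apply_letter_lt v aI Ik k0 lk); lia.
have l0 : 0 < l by lia.
have {}eqV : count_ge k (l :: w) + count_ge k (Fbot v (l :: w)) <=
    (lpp I (apply_letter l v) + lpp J w).+1 by rewrite eqV lk; lia.
have [pA pB pB2] := lpp_passes v l0 aI (Ik 0 k0).
have J0 := Jk 0 k0.
case: (posnP (J l)) => [Jl|Jl]; last first.
  exists I, J; split=> //; apply: leq_trans eqV _.
  rewrite [lpp J (l :: w)]lpp_cons lstep_in // pA; [lia | have := IJ1 l; lia].
case: (posnP (I l)) => [Il|Il].
  exists I, (add_at 1 l J); split.
    split=> //; first exact: adm_add.
      by move=> i; have := IJ1 i; rewrite /add_at; mv_lia.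
    by move=> i ik; have := IJk i ik; rewrite /add_at; mv_lia.
  apply: leq_trans eqV _; rewrite [lpp _ (l :: w)]lpp_cons lstep_in //; last first.
    by rewrite /add_at eqxx addn1.
  by rewrite pA //; have := lpp_add w aJ J0 l0 Jl; lia.
case: (pB2 Il) => [c|[j [lj Ij c]]].
  exists I, J; split=> //; apply: leq_trans eqV _.
  by have := lpp_stay J l w; lia.
have j0 : 0 < j by lia.
have I1 := proj1 aI l l0.
case: (posnP (J j)) => [Jj|Jj].
  exists (mv I l j), (add_at 1 l J); split.
    split=> //; [exact: adm_mv | exact: adm_add | |].
      by move=> i; have := IJ1 i; rewrite /add_at; mv_lia.
    by move=> i ik; have := IJk i ik; rewrite /add_at; mv_lia.
  apply: leq_trans eqV _; rewrite [lpp _ (l :: w)]lpp_cons lstep_in //; last first.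
    by rewrite /add_at eqxx addn1.
  by have := lpp_add w aJ J0 l0 Jl; lia.
have J1 := proj1 aJ j j0.
(* The two families exchange the lines [l] and [j]; lowering a particle of [J] costs nothing by
   [mono]. *)
exists (mv I l j), (mv J j l); split.
  split=> //; [exact: adm_mv | exact: adm_mv | |].
    by move=> i; have := IJ1 i; mv_lia.
  by move=> i ik; have := IJk i ik; mv_lia.
apply: leq_trans eqV _; rewrite [lpp _ (l :: w)]lpp_cons lstep_in //; last by mv_lia.
have : lpp J w <= lpp (mv J j l) w; last by lia.
have {1}-> : J = mv (mv J j l) l j by mv_eq.
by apply: mono_lpp; [exact: adm_mv | mv_lia | lia | mv_lia].
Qed.

(** * Estimates for a single family of paths *)

(** States reachable by upward moves made before any letter is read; they are the candidates for
    moving all the particles at the start. *)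
Inductive dominates : (nat -> nat) -> (nat -> nat) -> Prop :=
| dominates_refl I : dominates I I
| dominates_step I j x I' : 0 < I j -> j < x -> I x = 0 ->
    dominates (mv I j x) I' -> dominates I I'.

Lemma lpp_dominates I I' u : adm_state I -> dominates I I' -> lpp I' u <= lpp I u.
Proof.
move=> aI d; elim: d aI => // {I I'} I j x I' Ij jx Ix _ IH aI.
have aM : adm_state (mv I j x) by apply: adm_mv => //; lia.
by apply: leq_trans (IH aM) _; exact: mono_lpp.
Qed.

Lemma adm_dominates I I' : adm_state I -> dominates I I' -> adm_state I'.
Proof.
move=> aI d; elim: d aI => // {I I'} I j x I' Ij jx Ix _ IH aI.
by apply: IH; apply: adm_mv => //; lia.
Qed.

Lemma dominates_low k I I' : dominates I I' -> (forall i, i < k -> I i = 0) ->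
  forall i, i < k -> I' i = 0.
Proof.
elim=> // {I I'} I j x I' Ij jx Ix _ IH Ik; apply: IH => i ik.
have kj : k <= j by rewrite leqNgt; apply/negP => /Ik; lia.
by have := Ik i ik; mv_lia.
Qed.

Definition count_in (I : nat -> nat) (u : seq nat) : nat :=
  count (fun x => (0 < x) && (0 < I x)) u.

Lemma count_in_le_lpp I u : count_in I u <= lpp I u.
Proof.
elim: u => // x u IH; rewrite /count_in /= lpp_cons.
case: (posnP x) => [->|x0]; first by rewrite lstep0 /=.
case: (posnP (I x)) => [Ix|Ix] /=; last by rewrite lstep_in.
by apply: leq_trans IH _; exact: lstep_stay.
Qed.

Lemma lpp_split I u : I 0 = 0 -> lpp I u = count_in I u \/
  exists u1 x u2 j, [/\ u = u1 ++ x :: u2, 0 < I j, j < x, I x = 0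
    & lpp I u = (count_in I u1 + lpp (mv I j x) u2).+1].
Proof.
move=> I0; elim: u => [|x u IH]; first by left.
have shift c : lpp I (x :: u) = c + lpp I u -> c = (0 < x) && (0 < I x) ->
  lpp I (x :: u) = count_in I (x :: u) \/
  exists u1 y u2 j, [/\ x :: u = u1 ++ y :: u2, 0 < I j, j < y, I y = 0
    & lpp I (x :: u) = (count_in I u1 + lpp (mv I j y) u2).+1].
  move=> -> ->; case: IH => [->|[u1 [y [u2 [j [-> Ij jy Iy ->]]]]]]; first by left.
  by right; exists (x :: u1), y, u2, j; split=> //; rewrite /count_in /=; lia.
case: (posnP x) => [x0|x0].
  by apply: (shift 0); subst x; rewrite ?lpp_cons.
case: (posnP (I x)) => [Ix|Ix]; last first.
  by apply: (shift 1); [rewrite lpp_cons lstep_in | rewrite x0 Ix].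
case: (lstep_case false (lpp ^~ u) x0 Ix) => [e|[j [jx Ij e]]].
  by apply: (shift 0); [rewrite lpp_cons e | rewrite Ix andbF].
by right; exists [::], x, u, j; split=> //; rewrite lpp_cons e.
Qed.

(** When a jump from [j] to [x] occurs in a decreasing word, no letter [j < x] has been read yet, so
    jumping at the start loses nothing. The last clause is the induction invariant: a line at or
    above all the remaining letters is never left. *)
Lemma lpp_le_decreasing I u l : adm_state I -> I 0 = 0 ->
  sorted geq u -> all (geq l) u ->
  exists I', [/\ dominates I I', lpp I u <= count_in I' u
    & forall i, l <= i -> 0 < I i -> 0 < I' i].
Proof.
move=> aI I0; elim: u I l aI I0 => [|x u IH] I l aI I0 /=.
  by move=> _ _; exists I; split=> //; exact: dominates_refl.
move=> xu /andP[xl _].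
have ux : all (geq x) u by apply: (order_path_min _ xu) => a b c /=; lia.
have {xu} su : sorted geq u by exact: path_sorted xu.
have [I' [dI le hi]] := IH I x aI I0 su ux.
case: (posnP x) => [x0|x0].
  exists I'; split=> //; last by move=> i li; apply: hi; lia.
  by rewrite lpp_cons /count_in; subst x; rewrite lstep0 /=.
case: (posnP (I x)) => [Ix|Ix]; last first.
  exists I'; split=> //; last by move=> i li; apply: hi; lia.
  rewrite lpp_cons lstep_in //; have := hi x (leqnn x) Ix; move: le.
  by rewrite /count_in /= => le ->; lia.
rewrite lpp_cons; case: (lstep_case false (lpp ^~ u) x0 Ix) => [->|[j [jx Ij ->]]].
  exists I'; split=> //; last by move=> i li; apply: hi; lia.
  by apply: leq_trans le _; rewrite /count_in /= leq_addl.
have M0 : mv I j x 0 = 0 by mv_lia.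
have [I2 [d2 le2 hi2]] := IH (mv I j x) x (adm_mv j aI x0 Ix) M0 su ux.
exists I2; split; first exact: dominates_step d2.
  have : 0 < I2 x by apply: hi2; mv_lia.
  by move: le2; rewrite /count_in /= => le2 ->; lia.
by move=> i li Ii; apply: hi2; mv_lia.
Qed.

Lemma count_in_sum n I u : adm_state I -> I 0 = 0 -> all (geq n) u ->
  count_in I u = \sum_(i < n) I i.+1 * count_mem i.+1 u.
Proof.
move=> aI I0; elim: u => [|x u IH] /=; first by rewrite big1 // => i _; rewrite muln0.
move=> /andP[xn un]; rewrite /count_in /= -/(count_in I u) IH //.
under [RHS]eq_bigr do rewrite mulnDr.
rewrite big_split /=; congr addn.
case: x xn => [|x] xn; first by rewrite big1 // => i _; rewrite muln0.
rewrite (bigD1 (Ordinal xn)) //= eqxx muln1 big1 ?addn0.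
  by have := proj1 aI x.+1 (ltn0Sn _); case: (I x.+1) => [|[]].
move=> i ix; rewrite eqSS; case: eqP; rewrite ?muln0 // => e.
by move: ix; rewrite -val_eqE /= e eqxx.
Qed.

Definition potential (n : nat) (I : nat -> nat) : nat :=
  \sum_(i < n) I i.+1 * (n - i).

Lemma potential_mv n I j x : 0 < j -> 0 < I j -> j < x -> x <= n -> I x = 0 ->
  potential n (mv I j x) < potential n I.
Proof.
move=> j0 Ij jx xn Ix.
case: x j0 jx xn Ix => // x; case: j Ij => // j Ij _ jx xn Ix.
have jn : j < n by lia.
have xj : Ordinal xn != Ordinal jn by rewrite -val_eqE /=; lia.
rewrite /potential (bigD1 (Ordinal jn)) //= (bigD1 (Ordinal xn)) //=.
rewrite [ltnRHS](bigD1 (Ordinal jn)) //= [X in _ < _ + X](bigD1 (Ordinal xn)) //=.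
rewrite (eq_bigr (fun i : 'I_n => I i.+1 * (n - i))); last first.
  move=> i /andP[ij ix]; move: ij ix; rewrite -!val_eqE /= => ij ix; congr muln.
  by rewrite mvE; lia.
have -> : mv I j.+1 x.+1 j.+1 = I j.+1 - 1 by mv_lia.
have -> : mv I j.+1 x.+1 x.+1 = 1 by mv_lia.
rewrite Ix mul1n mul0n add0n; move: (bigop _ _ _) => S.
by nia.
Qed.

Lemma potential_le n I : adm_state I -> potential n I <= n * n.
Proof.
move=> [I1 _]; rewrite /potential.
have -> : n * n = \sum_(i < n) n by rewrite sum_nat_const card_ord.
apply: leq_sum => i _; have := I1 i.+1 (ltn0Sn i).
by case: (I i.+1) => [|[|//]] _; lia.
Qed.

(** * Words on the edges of a finite point set *)

(* Adds a point at height [p]: the inverse of letting the returned letter pass. *)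
Fixpoint ins (p : nat) (u : seq nat) : seq nat * nat :=
  if u is x :: u' then
    if size u' == p then (1 :: u', 1) else
    let: (v, l) := ins p u' in
    if (0 < l) && (x == l) then (l.+1 :: v, l.+1) else (x :: v, l)
  else ([::], 0).

(** On the edge words below, a zero at height [p] means that no point has been inserted at that
    height. *)
Fixpoint zero_at (p : nat) (u : seq nat) : Prop :=
  if u is x :: u' then (size u' = p -> x = 0) /\ zero_at p u' else True.

Lemma size_ins p u : size (ins p u).1 = size u.
Proof.
elim: u => //= x u; case: eqP => //= _; case: (ins p u) => v l /= <-.
by case: ifP.
Qed.

Lemma ins_out p u : size u <= p -> ins p u = (u, 0).
Proof.
elim: u => //= x u IH up; case: eqP => [|_]; first by lia.
by rewrite IH //; lia.
Qed.

Lemma ins_letter_gt0 p u : p < size u -> 0 < (ins p u).2.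
Proof.
elim: u => //= x u IH pu; case: eqP => // up.
have := IH; case: (ins p u) => v l /= h; case: ifP => // _ /=; apply: h; lia.
Qed.

Lemma apply_ins p u : zero_at p u -> apply_letter (ins p u).2 (ins p u).1 = u.
Proof.
elim: u => //= x u IH [xp /IH]; case: eqP => [/xp -> _|_] /=.
  by rewrite apply_letter0.
case: (ins p u) => v l /=; case: ifP => [/andP[l0 /eqP ->]|xl] /= ->.
  by rewrite eqxx.
by rewrite xl.
Qed.

Lemma drop_ins m p u : (ins p (drop m u)).1 = drop m (ins p u).1.
Proof.
elim: u m => [//|x u IH] [|m]; first by rewrite !drop0.
rewrite /= IH.
case: eqP => [up|_] /=; last by case: (ins p u) => v l; case: ifP.
by rewrite ins_out // up.
Qed.

Lemma count_ins i p u : 0 < i -> p < size u -> zero_at p u ->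
  count_mem i (ins p u).1 = count_mem i u + ((ins p u).2 == i).
Proof.
move=> i0; elim: u => //= x u IH pu [xp zp]; case: eqP => [up|up] /=.
  by rewrite (xp up) (ltn_eqF i0) add0n addnC.
have {IH} := IH _ zp; case: (ins p u) => v l /= h.
have {}h : count_mem i v = count_mem i u + (l == i) by apply: h; lia.
case: ifP => [/andP[l0 /eqP ->]|xl] /=; rewrite h ?addnA //.
by rewrite -addnA addnC [count_mem i u + _]addnC.
Qed.

(** Yamanouchi words read from the end: the content of every suffix is a partition. *)
Fixpoint lattice (u : seq nat) : Prop :=
  if u is x :: u' then
    (forall l, 0 < l -> count_mem l.+1 u <= count_mem l u) /\ lattice u'
  else True.

Lemma lattice_count u l : lattice u -> 0 < l -> count_mem l.+1 u <= count_mem l u.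
Proof. by case: u => //= x u [h _]; apply: h. Qed.

Lemma lattice_le u j l : lattice u -> 0 < j -> j <= l ->
  count_mem l u <= count_mem j u.
Proof.
move=> lu j0 /subnKC <-; elim: (l - j) => [|m IH]; first by rewrite addn0.
by apply: leq_trans IH; rewrite addnS; apply: lattice_count => //; lia.
Qed.

Lemma lattice_ins p u : zero_at p u -> lattice u -> lattice (ins p u).1.
Proof.
elim: u => //= x u IH [xp zp] [lx lu]; case: eqP => [up|up] /=.
  split=> // l l0; have := lx l l0.
  rewrite (xp up) /= eqSS (ltn_eqF l0) !add0n => h.
  exact: leq_trans h (leq_addl _ _).
have lu' := IH zp lu.
case: (ltnP p (size u)) => pu; last by rewrite ins_out.
have ci := fun i i0 => @count_ins i p u i0 pu zp.
have l0 := ins_letter_gt0 pu.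
move: ci l0 lu'; case: (ins p u) => v m /= ci m0 lv.
have xl := lattice_count lu.
case: ifP => [/andP[_ /eqP xm]|xm] /=; split=> // l l0; rewrite !ci //.
  subst x; have := lx l l0; have := xl l l0.
  by rewrite eqSS /=; do 4? [case: eqP => ? /=]; lia.
have := lx l l0; have := lattice_count lv l0; rewrite !ci //.
move: xm; rewrite m0 /=.
by do 5? [case: eqP => ? /=]; lia.
Qed.

(** No jump pays: a suffix that begins with [x] contains at least as many [j] as [x] when
    [0 < j < x], so what is left on line [j] makes up for what is gained on [x]. *)
Lemma lpp_lattice J u : adm_state J -> J 0 = 0 -> lattice u -> lpp J u = count_in J u.
Proof.
move=> aJ J0 lu; apply/eqP; rewrite eqn_leq count_in_le_lpp andbT.
elim: u J aJ J0 lu => // x u IH J aJ J0 [lx lu].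
rewrite lpp_cons; case: (posnP x) => [x0|x0].
  by subst x; rewrite lstep0 /count_in /= -/(count_in J u) !add0n; exact: IH.
case: (posnP (J x)) => [Jx|Jx]; last first.
  by rewrite lstep_in // /count_in /= x0 Jx ltnS; exact: IH.
rewrite /count_in /= x0 Jx /= add0n -/(count_in J u).
case: (lstep_case false (lpp ^~ u) x0 Jx) => [->|[j [jx Jj ->]]]; first exact: IH.
have j0 : 0 < j by case: (posnP j) Jj => [->|]; rewrite ?J0.
have aM := adm_mv j aJ x0 Jx.
have M0 : mv J j x 0 = 0 by mv_lia.
have J1 := proj1 aJ j j0.
apply: (@leq_ltn_trans (count_in (mv J j x) u)); first exact: IH.
have : count_in (mv J j x) u + count_mem j u = count_in J u + count_mem x u.
  rewrite /count_in; elim: (u) => //= y u' IHu.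
  have -> : 0 < mv J j x y = (y == x) || (0 < J y) && (y != j) by mv_lia.
  by move: IHu; do 2 case: eqP; try lia; move=> *; subst; rewrite ?Jj ?Jx ?j0 ?x0 /=; lia.
have := @lattice_le (x :: u) j x (conj lx lu) j0 (ltnW jx).
rewrite /= eqxx (gtn_eqF jx); lia.
Qed.

Notation no_bonus := (fun _ : nat => false).

Definition empty_state : nat -> nat := fun=> 0.

Lemma adm_empty : adm_state empty_state.
Proof. by split=> //; exists 0. Qed.

Lemma lstep_nonzero b b' x phi J : (x = 0 -> b = b') ->
  lstep b x phi J = lstep b' x phi J.
Proof. by rewrite /lstep; case: eqP => // x0 ->. Qed.

Lemma eq_lppm D D' B B' J u :
  (forall h, h < size u -> D h = D' h) ->
  (forall p, p < size u -> zero_at p u -> B p = B' p) ->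
  lppm D B J u = lppm D' B' J u.
Proof.
elim: u J => //= x u IH J DD BB.
have -> : (fun K => lppm D B (add_at (D (size u)) 0 K) u) =
          (fun K => lppm D' B' (add_at (D' (size u)) 0 K) u).
  apply: funext => K; rewrite DD //; apply: IH => [h hu|p pu zp].
    by apply: DD; lia.
  by apply: BB; [lia | split=> // e; lia].
apply: lstep_nonzero => x0; apply: BB => //; split=> // .
have : forall w, size w <= size u -> zero_at (size u) w.
  by elim=> //= y w IHw wu; split; [lia | apply: IHw; lia].
exact.
Qed.

Lemma zero_atE p u : zero_at p u <-> nth 0 (rev u) p = 0.
Proof.
elim: u => [|x u IH] /=; first by rewrite nth_nil.
rewrite rev_cons nth_rcons size_rev IH; case: ltnP => pu.
  by split=> [[]//|->]; split=> // e; lia.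
rewrite nth_default ?size_rev //; case: eqP => [->|pu'].
  by split=> [[/(_ erefl)]|->].
by split=> // _; split=> // e; lia.
Qed.

Lemma zero_at_ins p q u : p < size u ->
  zero_at q (ins p u).1 <-> zero_at q u /\ q <> p.
Proof.
elim: u => //= x u IH pu; case: eqP => [up|up] /=.
  split=> [[h zq]|[[h zq] qp]]; last by split=> // e; lia.
  by split; [split=> // /h | move=> qp; have := h (etrans up (esym qp))].
have pu' : p < size u by lia.
have l0 := ins_letter_gt0 pu'; have := size_ins p u.
move: l0 (IH pu'); case: (ins p u) => v l /= l0 {}IH sv.
case: ifP => [/andP[_ /eqP xl]|_] /=; rewrite sv IH.
  split=> [[h [zq qp]]|[[h zq] qp]].
    by split=> //; split=> // e; have := h e.
  by split=> // e; have := h e; lia.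
by split=> [[h [zq qp]]|[[h zq] qp]]; repeat split.
Qed.

Lemma lppm_ins D p d u : zero_at p u -> p < size u ->
  lppm D no_bonus (add_at d 0 empty_state) (ins p u).1 =
  lppm D (pred1 p) (add_at d 0 empty_state) u.
Proof.
move=> zp pu; have sz := size_ins p u.
pose B h := nth 0 (rev (ins p u).1) h != 0.
have okB : nonzero_heights B (ins p u).1 by exact: nonzero_heights_nth.
have [pA _ _ _] := lppm_passes D (ins_letter_gt0 pu) okB.
have Jl : add_at d 0 empty_state (ins p u).2 = 0.
  by rewrite /add_at gtn_eqF //; exact: ins_letter_gt0.
have := pA _ (adm_mark d adm_empty) Jl; rewrite /= apply_ins // => e.
rewrite (@eq_lppm D D no_bonus B) //; last first.
  by move=> q _ /zero_atE zq; rewrite /B zq.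
rewrite -e; apply: eq_lppm => // q qu zq; rewrite /B /=.
have [->|/eqP qp] := eqVneq q p.
  by apply/eqP => /zero_atE /(zero_at_ins _ pu)[].
by apply/negbTE/negPn/eqP/zero_atE/(zero_at_ins _ pu).
Qed.

Lemma lppm_le_bonus D B J u : lppm D no_bonus J u <= lppm D B J u.
Proof.
elim: u J => //= x u IH J; rewrite /lstep; case: eqP => [_|x0].
  by rewrite /= add0n; apply: leq_trans (IH _) (leq_addl _ _).
case: ifP => _; first by rewrite ltnS IH.
rewrite geq_max; apply/andP; split.
  by apply: leq_trans (IH _) (leq_maxl _ _).
rewrite leq_max; apply/orP; right; apply/bigmax_leqP => i Ji.
apply: leq_trans (leq_bigmax_cond _ Ji).
by rewrite ltnS IH.
Qed.

Definition rem0 (J : nat -> nat) : nat -> nat := fun i => J i - (i == 0).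

(* A particle waiting on line 0 may as well enter after the added point,
   having collected it. *)
Lemma lppm_reenter0 D p J u : p < size u -> zero_at p u -> 0 < J 0 ->
  lppm (add_at 1 p D) no_bonus (rem0 J) u < lppm D (pred1 p) J u.
Proof.
elim: u J => //= x u IH J pu [xp zp] J0.
case: (ltngtP p (size u)) => [up|up|up]; first 1 last.
- by lia.
- have x0 : x = 0 by apply: xp; rewrite up.
  subst x; rewrite !lstep0 /= add0n -up ?eqxx J0 add1n ltnS.
  have -> : add_at (add_at 1 p D p) 0 (rem0 J) = add_at (D p) 0 J.
    by apply: funext => i; rewrite /add_at /rem0; mv_lia.
  rewrite (@eq_lppm _ D _ (pred1 p)) // => [h hu|q qu _] /=.
    by rewrite /add_at ltn_eqF ?addn0 // up.
  by rewrite ltn_eqF // up.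
have ha : add_at 1 p D (size u) = D (size u).
  by rewrite /add_at gtn_eqF ?addn0.
have am K : 0 < K 0 -> add_at (D (size u)) 0 (rem0 K) = rem0 (add_at (D (size u)) 0 K).
  by move=> K0; apply: funext => i; rewrite /add_at /rem0; mv_lia.
have {}IH K : 0 < K 0 ->
    lppm (add_at 1 p D) no_bonus (add_at (add_at 1 p D (size u)) 0 (rem0 K)) u <
    lppm D (pred1 p) (add_at (D (size u)) 0 K) u.
  by move=> K0; rewrite ha am //; apply: IH => //; rewrite /add_at /=; lia.
case: (posnP x) => [x0|x0].
  by subst x; rewrite !lstep0 /= ?(gtn_eqF up) !add0n; exact: IH.
have rx : rem0 J x = J x by rewrite /rem0 gtn_eqF // subn0.
case: (posnP (J x)) => [Jx|Jx]; last by rewrite !lstep_in ?rx // ltnS; exact: IH.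
have [->|[j [jx Jj ->]]] := lstep_case false (fun K => lppm (add_at 1 p D) no_bonus
    (add_at (add_at 1 p D (size u)) 0 K) u) x0 (etrans rx Jx).
  exact: leq_trans (IH _ J0) (lstep_stay _ _ _ _).
have Jj' : 0 < J j by move: Jj; rewrite /rem0; lia.
apply: leq_trans (lstep_move _ _ Jx jx Jj').
rewrite ltnS; have -> : mv (rem0 J) j x = rem0 (mv J j x).
  by apply: funext => i; move: Jj; rewrite /rem0; mv_lia.
by apply: IH; move: Jj; rewrite /rem0; mv_lia.
Qed.

Lemma lppm_reenter D p c J u : p < c -> c < size u -> zero_at p u -> 0 < D c ->
  lppm (mv D c p) no_bonus J u < lppm D (pred1 p) J u.
Proof.
move=> pc; elim: u J => //= x u IH J cu [_ zp] Dc.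
have {}IH K : lppm (mv D c p) no_bonus (add_at (mv D c p (size u)) 0 K) u <
    lppm D (pred1 p) (add_at (D (size u)) 0 K) u.
  have [e|cu'] := eqVneq c (size u).
    have -> : add_at (mv D c p (size u)) 0 K = rem0 (add_at (D (size u)) 0 K).
      by apply: funext => i; move: Dc; rewrite e /add_at /rem0; mv_lia.
    rewrite (@eq_lppm _ (add_at 1 p D) _ no_bonus) // => [|h hu].
      apply: lppm_reenter0 => //; first by rewrite -e.
      by rewrite /add_at /= -e; lia.
    by rewrite /add_at; mv_lia.
  have -> : mv D c p (size u) = D (size u) by mv_lia.
  by apply: IH => //; lia.
case: (posnP x) => [x0|x0].
  subst x; rewrite !lstep0 /=; apply: leq_trans (IH J) (leq_addl _ _).
case: (posnP (J x)) => [Jx|Jx]; last by rewrite !lstep_in // ltnS.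
have [->|[j [jx Jj ->]]] := lstep_case false (fun K => lppm (mv D c p) no_bonus
    (add_at (mv D c p (size u)) 0 K) u) x0 Jx.
  exact: leq_trans (IH J) (lstep_stay _ _ _ _).
apply: leq_trans (lstep_move _ _ Jx jx Jj); rewrite ltnS; exact: IH.
Qed.

Lemma lppm_bonus_le D p J u : p < size u -> zero_at p u ->
  [\/ lppm D (pred1 p) J u <= lppm D no_bonus J u,
      0 < J 0 /\ lppm D (pred1 p) J u <= (lppm (add_at 1 p D) no_bonus (rem0 J) u).+1
    | exists c, [/\ p < c, c < size u, 0 < D c
      & lppm D (pred1 p) J u <= (lppm (mv D c p) no_bonus J u).+1]].
Proof.
elim: u J => //= x u IH J pu [xp zp].
case: (ltngtP p (size u)) => [up|up|up]; first 1 last.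
- by lia.
- have x0 : x = 0 by apply: xp; rewrite up.
  subst x; rewrite !lstep0 /= -up ?eqxx.
  have e K : lppm D (pred1 p) K u = lppm D no_bonus K u.
    by apply: eq_lppm => // q qu _; rewrite /= ltn_eqF // up.
  case: (posnP (J 0)) => [J0|J0]; first by apply: Or31; rewrite e.
  apply: Or32; split=> //; rewrite !add0n add1n ltnS e.
  have -> : add_at (add_at 1 p D p) 0 (rem0 J) = add_at (D p) 0 J.
    by apply: funext => i; rewrite /add_at /rem0; mv_lia.
  rewrite (@eq_lppm D (add_at 1 p D) _ no_bonus) // => h hu.
  by rewrite /add_at ltn_eqF ?addn0 // up.
have ha : add_at 1 p D (size u) = D (size u).
  by rewrite /add_at gtn_eqF ?addn0.
set psi := fun K => lppm D (pred1 p) (add_at (D (size u)) 0 K) u.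
set phi0 := fun K => lppm D no_bonus (add_at (D (size u)) 0 K) u.
set phi1 := fun K => lppm (add_at 1 p D) no_bonus (add_at (add_at 1 p D (size u)) 0 K) u.
pose phi2 c := fun K => lppm (mv D c p) no_bonus (add_at (mv D c p (size u)) 0 K) u.
have {}IH K : [\/ psi K <= phi0 K, 0 < K 0 /\ psi K <= (phi1 (rem0 K)).+1
    | exists c, [/\ p < c, c < (size u).+1, 0 < D c & psi K <= (phi2 c K).+1]].
  have cD : 0 < D (size u) -> psi K <= (lppm (add_at 1 p D) no_bonus
      (rem0 (add_at (D (size u)) 0 K)) u).+1 -> psi K <= (phi2 (size u) K).+1.
    move=> Du le; apply: leq_trans le _; rewrite ltnS /phi2.
    have -> : add_at (mv D (size u) p (size u)) 0 K = rem0 (add_at (D (size u)) 0 K).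
      by apply: funext => i; move: Du; rewrite /add_at /rem0; mv_lia.
    rewrite (@eq_lppm _ (mv D (size u) p) _ no_bonus) // => h hu.
    by rewrite /add_at; mv_lia.
  have [le|[K0 le]|[c [pc cu Dc le]]] := IH (add_at (D (size u)) 0 K) up zp.
  - exact: Or31.
  - case: (posnP (K 0)) => [K00|K00].
      have Du : 0 < D (size u) by move: K0; rewrite /add_at K00.
      by apply: Or33; exists (size u); split=> //; exact: cD.
    apply: Or32; split=> //; apply: leq_trans le _; rewrite ltnS /phi1 ha.
    have -> : add_at (D (size u)) 0 (rem0 K) = rem0 (add_at (D (size u)) 0 K).
      by apply: funext => i; rewrite /add_at /rem0; mv_lia.
    by [].
  - apply: Or33; exists c; split=> //; first by lia.
    by rewrite /phi2; have -> : mv D c p (size u) = D (size u) by mv_lia.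
have rx : 0 < x -> rem0 J x = J x by move=> x0; rewrite /rem0 gtn_eqF // subn0.
case: (posnP x) => [x0|x0].
  subst x; rewrite !lstep0 /= ?(gtn_eqF up) !add0n.
  have [le|[K0 le]|[c [pc cu Dc le]]] := IH J.
  - exact: Or31.
  - by apply: Or32.
  - by apply: Or33; exists c; rewrite lstep0.
case: (posnP (J x)) => [Jx|Jx]; last first.
  rewrite !lstep_in ?rx //.
  have [le|[K0 le]|[c [pc cu Dc le]]] := IH J.
  - exact: Or31.
  - by apply: Or32.
  - by apply: Or33; exists c; rewrite lstep_in.
have [->|[j [jx Jj ->]]] := lstep_case false psi x0 Jx.
  have [le|[K0 le]|[c [pc cu Dc le]]] := IH J.
  - by apply: Or31; apply: leq_trans le _; exact: lstep_stay.
  - by apply: Or32; split=> //; apply: leq_trans le _; rewrite ltnS; exact: lstep_stay.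
  - by apply: Or33; exists c; split=> //; apply: leq_trans le _; rewrite ltnS; exact: lstep_stay.
have [le|[K0 le]|[c [pc cu Dc le]]] := IH (mv J j x).
- apply: Or31; apply: leq_trans (lstep_move _ _ Jx jx Jj); exact: le.
- have J0 : 0 < J 0 by move: K0; mv_lia.
  apply: Or32; split=> //; rewrite ltnS.
  have rj : 0 < rem0 J j by move: K0 Jj; rewrite /rem0; mv_lia.
  apply: leq_trans (lstep_move _ _ (etrans (rx x0) Jx) jx rj).
  apply: leq_trans le _.
  have -> : rem0 (mv J j x) = mv (rem0 J) j x.
    by apply: funext => i; move: rj; rewrite /rem0; mv_lia.
  by [].
- apply: Or33; exists c; split=> //; rewrite ltnS.
  apply: leq_trans (lstep_move _ _ Jx jx Jj); exact: le.
Qed.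

(* The word read down the right edge of the region of height [Y] below the
   points [t]; [t] lists the heights of the points, last column first. *)
Definition edge (Y : nat) (t : seq nat) : seq nat :=
  foldr (fun p u => (ins p u).1) (nseq Y 0) t.

(* The letters on the top edge, last column first. *)
Fixpoint top_letters (Y : nat) (t : seq nat) : seq nat :=
  if t is p :: t' then (ins p (edge Y t')).2 :: top_letters Y t' else [::].

Lemma size_edge Y t : size (edge Y t) = Y.
Proof. by elim: t => [|p t IH] /=; rewrite ?size_nseq // size_ins. Qed.

Lemma size_top_letters Y t : size (top_letters Y t) = size t.
Proof. by elim: t => //= p t ->. Qed.

Lemma zero_at_edge q Y t : q \notin t -> zero_at q (edge Y t).
Proof.
elim: t => [_|p t IH] /=.
  by elim: Y => //= Y IH; split.
rewrite inE negb_or => /andP[/eqP qp /IH zq].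
case: (ltnP p (size (edge Y t))) => pu; last by rewrite ins_out.
exact/zero_at_ins.
Qed.

Lemma drop_edge m Y t : m <= Y -> drop m (edge Y t) = edge (Y - m) t.
Proof.
move=> mY; elim: t => [|p t IH] /=; first by rewrite drop_nseq.
by rewrite -drop_ins IH.
Qed.

Lemma Fbot_edge Y t1 t2 : uniq (t1 ++ t2) ->
  Fbot (edge Y (t1 ++ t2)) (take (size t1) (top_letters Y (t1 ++ t2))) = edge Y t2.
Proof.
rewrite /Fbot; elim: t1 => [|p t1 IH] /=; first by rewrite take0.
move=> /andP[pt ut].
by rewrite apply_ins ?IH //; exact: zero_at_edge.
Qed.

Lemma take_apply_letter m l u : take m (apply_letter l u) = apply_letter l (take m u).
Proof.
elim: u m l => [|x u IH] [|m] l //=; first by rewrite !take0.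
by case: ifP => _ /=; rewrite IH.
Qed.

Lemma take_Fbot m u w : take m (Fbot u w) = Fbot (take m u) w.
Proof. by rewrite /Fbot; elim: w u => //= l w IH u; rewrite IH take_apply_letter. Qed.

Lemma count_edge i Y t1 t2 : 0 < i -> uniq (t1 ++ t2) ->
  count_mem i (edge Y (t1 ++ t2)) =
  count_mem i (take (size t1) (top_letters Y (t1 ++ t2))) + count_mem i (edge Y t2).
Proof.
move=> i0; elim: t1 => [|p t1 IH] /=; first by rewrite take0.
move=> /andP[pt ut].
case: (ltnP p (size (edge Y (t1 ++ t2)))) => pu.
  rewrite count_ins //; last exact: zero_at_edge.
  by rewrite IH // addnC addnA.
by rewrite ins_out //= (ltn_eqF i0) IH.
Qed.

Lemma lattice_edge Y t : uniq t -> lattice (edge Y t).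
Proof.
elim: t => [_|p t IH /= /andP[pt ut]] /=.
  elim: Y => //= Y IH; split=> // l l0; rewrite (ltn_eqF l0) /=.
  exact: lattice_count.
by apply: lattice_ins; [exact: zero_at_edge | exact: IH].
Qed.

Lemma count_ge_sum k u : 0 < k -> exists n, count_ge k u = \sum_(i < n) count_mem (k + i) u
  /\ forall m, n <= m -> count_ge k u = \sum_(i < m) count_mem (k + i) u.
Proof.
move=> k0; suff [n nP] : exists n, forall m, n <= m ->
    count_ge k u = \sum_(i < m) count_mem (k + i) u by exists n; split=> //; exact: nP.
elim: u => [|x u [n IH]].
  by exists 0 => m _; rewrite big1.
exists (maxn n x.+1) => m nm; rewrite /= big_split /= -IH; last by lia.
rewrite /count_ge /=; congr addn.
case: (leqP k x) => kx.
  have xm : x - k < m by lia.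
  rewrite (bigD1 (Ordinal xm)) //= subnKC // eqxx big1 // => i ix.
  case: eqP => // e; move: ix; rewrite -val_eqE /= e; lia.
by rewrite big1 // => i _; case: eqP => // e; lia.
Qed.

Lemma count_ge_eq k u v w : 0 < k ->
  (forall i, 0 < i -> count_mem i u = count_mem i v + count_mem i w) ->
  count_ge k u = count_ge k v + count_ge k w.
Proof.
move=> k0 h.
have [a [_ ha]] := count_ge_sum u k0.
have [b [_ hb]] := count_ge_sum v k0.
have [c [_ hc]] := count_ge_sum w k0.
rewrite (ha (a + b + c)) ?(hb (a + b + c)) ?(hc (a + b + c)); try lia.
by rewrite -big_split; apply: eq_bigr => i _; apply: h; lia.
Qed.

(** Cutting the last columns applies the top letters; cutting the rows above [Y'] then drops the
    first [Y - Y'] letters. Letters act from left to right, so [Fbot] commutes with [take] and the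
    dropped part is [Fbot] of the right edge between the two heights. *)
Lemma count_ge_growth k Y Y' t1 t2 : 0 < k -> Y' <= Y -> uniq (t1 ++ t2) ->
  count_ge k (edge Y (t1 ++ t2)) = count_ge k (edge Y' t2) +
  (count_ge k (take (size t1) (top_letters Y (t1 ++ t2))) +
   count_ge k (Fbot (take (Y - Y') (edge Y (t1 ++ t2)))
     (take (size t1) (top_letters Y (t1 ++ t2))))).
Proof.
move=> k0 YY ut; rewrite -take_Fbot Fbot_edge //.
rewrite (@count_ge_eq k _ _ (edge Y t2) k0 (fun i i0 => count_edge Y i0 ut)).
rewrite -[in LHS](cat_take_drop (Y - Y') (edge Y t2)) {2}/count_ge count_cat.
rewrite drop_edge; last by lia.
by rewrite subKn // /count_ge; lia.
Qed.

Lemma flat_lpp u : flat (lpp ^~ u).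
Proof.
elim: u => // x u IH.
have -> : lpp ^~ (x :: u) = lstep false x (lpp ^~ u) by apply: funext => J; rewrite lpp_cons.
by apply: flat_lstep => //; exact: mono_lpp.
Qed.

Lemma lpp_waiting k u : lattice u ->
  lpp (add_at k 0 empty_state) u = count (fun x => 0 < x <= k) u.
Proof.
move=> lu; pose A i := fun h => if h == 0 then k - i else (h <= i : nat).
have aA i : adm_state (A i).
  split=> [h h0|]; first by rewrite /A gtn_eqF //; lia.
  by exists i.+1 => h hi; rewrite /A gtn_eqF; lia.
have step i : i <= k -> lpp (A 0) u = lpp (A i) u.
  elim: i => // i IH ik; rewrite IH; last by lia.
  have -> : A i.+1 = mv (A i) 0 i.+1 by apply: funext => h; rewrite /A; mv_lia.
  have Ai0 : 0 < A i 0 by rewrite /A /=; lia.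
  have Ai1 : A i i.+1 = 0 by rewrite /A /=; lia.
  apply/eqP; rewrite eqn_leq mono_lpp // andbT; apply: flat_lpp => //.
  by move=> h h0 hi; rewrite /A gtn_eqF //; lia.
have -> : add_at k 0 empty_state = A 0.
  by apply: funext => h; rewrite /A /add_at /empty_state; mv_lia.
rewrite (step k (leqnn k)) lpp_lattice //; last by rewrite /A subnn.
rewrite /count_in; apply: eq_count => x; rewrite /A.
by case: (posnP x) => // x0; case: (x <= k).
Qed.

(** * Greene's theorem for the letters of the right edge *)

Section Greene.
Variables (k Y : nat).

Definition exits (e : 'I_k -> nat) : nat -> nat := fun h => \sum_(i < k) (e i == h).

Definition chains_below (D : nat -> nat) (u : seq nat) : nat :=
  lppm D no_bonus (add_at (D (size u)) 0 empty_state) u.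

Definition set_at (T : eqType) (S : Type) (f : T -> S) (a : T) (s : S) : T -> S :=
  fun x => if x == a then s else f x.

(* Points are identified with their heights, which are distinct. *)
Definition colouring (e : 'I_k -> nat) (t : seq nat) (col : nat -> option 'I_k) : Prop :=
  (forall p i, p \in t -> col p = Some i -> p < e i) /\
  pairwise (fun p q => if col p is Some i then (col q == Some i) ==> (q < p) else true) t.

Lemma exits_set e i p : p < e i -> exits (set_at e i p) = mv (exits e) (e i) p.
Proof.
move=> pe; apply: funext => h; rewrite /exits mvE.
rewrite (bigD1 i) // [X in _ = X - _ + _](bigD1 i) //= /set_at eqxx.
rewrite (eq_bigr (fun j => (e j == h) : nat)); last by move=> j /negPf ->.
by move: (\sum_(_ < _ | _) _) => S; case: (eqVneq (e i) h); case: (eqVneq p h); case: (eqVneq h (e i)); case: (eqVneq h p) => /=; lia.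
Qed.

Lemma exits_gt0 e i : 0 < exits e (e i).
Proof. by rewrite /exits (bigD1 i) //= eqxx. Qed.

Lemma exits_gt0P e h : 0 < exits e h -> exists i, e i = h.
Proof.
move=> eh; apply: contrapT => H; move: eh; rewrite /exits big1 // => i _.
by case: eqP => // ei; case: H; exists i.
Qed.

Lemma colouring_cons e p t col : colouring e (p :: t) col ->
  match col p with
  | Some i => p < e i /\ colouring (set_at e i p) t col
  | None => colouring e t col
  end.
Proof.
move=> [he /= /andP[hp ht]].
case E: (col p) hp => [i|] hp; last first.
  by split=> // q j qt; apply: he; rewrite inE qt orbT.
split; first by apply: he E; rewrite mem_head.
split=> // q j qt cq; rewrite /set_at; case: eqP => [ji|_].
  by move/allP: hp => /(_ q qt); rewrite cq ji eqxx.
by apply: he cq; rewrite inE qt orbT.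
Qed.

Lemma chains_below_ins D p u : zero_at p u -> p < size u ->
  chains_below D (ins p u).1 = lppm D (pred1 p) (add_at (D (size u)) 0 empty_state) u.
Proof. by move=> zp pu; rewrite /chains_below size_ins lppm_ins. Qed.

(** When the last point is given to chain [i], the bound of this chain drops from [e i] to [p]. For
    the particles, this is collecting the bonus at [p] and entering again at that height. *)
Lemma colouring_le e t col : (forall i, e i <= Y) -> uniq t -> colouring e t col ->
  count (fun p => col p != None) t <= chains_below (exits e) (edge Y t).
Proof.
elim: t e => //= p t IH e eY /andP[pt ut] /colouring_cons.
have zp := zero_at_edge Y pt; have sz := size_edge Y t.
case E: (col p) => [i|] /=.
  move=> [pe c']; have pY : p < size (edge Y t) by rewrite sz; apply: leq_trans pe (eY i).
  have e'Y j : set_at e i p j <= Y by rewrite /set_at; case: eqP => // _; lia.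
  have := IH _ e'Y ut c'; rewrite exits_set // => le.
  rewrite chains_below_ins //; apply: (leq_ltn_trans le); rewrite /chains_below sz.
  have [ei|ei] := eqVneq (e i) Y.
    have -> : add_at (mv (exits e) (e i) p Y) 0 empty_state =
       rem0 (add_at (exits e Y) 0 empty_state).
      by apply: funext => h; rewrite /add_at /rem0 /empty_state ei; mv_lia.
    rewrite (@eq_lppm _ (add_at 1 p (exits e)) _ no_bonus) //; last first.
      by move=> h; rewrite sz => hY; rewrite /add_at ei; mv_lia.
    apply: lppm_reenter0 => //; rewrite /add_at /= -ei; exact: exits_gt0.
  have -> : mv (exits e) (e i) p Y = exits e Y by mv_lia.
  apply: lppm_reenter => //; last exact: exits_gt0.
  by rewrite sz; have := eY i; lia.
move=> c'; rewrite add0n; apply: leq_trans (IH _ eY ut c') _.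
case: (ltnP p (size (edge Y t))) => pu; last by rewrite ins_out.
by rewrite chains_below_ins //; exact: lppm_le_bonus.
Qed.

Lemma count_set_at (col : nat -> option 'I_k) p s t : p \notin t ->
  count (fun q => set_at col p s q != None) (p :: t) =
  (s != None) + count (fun q => col q != None) t.
Proof.
move=> pt /=; rewrite {1}/set_at eqxx; congr addn; apply: eq_in_count => q qt.
by rewrite /set_at; case: (eqVneq q p) => // qp; move: pt; rewrite -qp qt.
Qed.

Lemma colouring_set_at (e e' : 'I_k -> nat) p s t col : p \notin t ->
  colouring e' t col -> (forall i, e' i <= e i) ->
  (forall i, s = Some i -> p < e i /\ e' i = p) ->
  colouring e (p :: t) (set_at col p s).
Proof.
move=> pt [h1 h2] ee hs; split=> [q i|] /=.
  rewrite inE /set_at; case: eqP => [-> _ /hs[]//|_ /= qt cq].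
  exact: leq_trans (h1 _ _ qt cq) (ee i).
have out q : q \in t -> set_at col p s q = col q.
  by move=> qt; rewrite /set_at; case: (eqVneq q p) => // qp; move: pt; rewrite -qp qt.
apply/andP; split.
  apply/allP => q qt; rewrite (out q qt) {1}/set_at eqxx.
  case: s hs {out} => // i /(_ i erefl) [_ e'i]; apply/implyP => /eqP cq.
  by have := h1 q i qt cq; rewrite e'i.
move: h2; rewrite (@eq_in_pairwise _ (mem t) _
  (fun p0 q => if set_at col p s p0 is Some i
    then (set_at col p s q == Some i) ==> (q < p0) else true)) //.
  by move=> a b ta tb /=; rewrite (out a ta) (out b tb).
Qed.

(** The particle that earns the bonus in [lppm_bonus_le] designates the chain that receives the
    point; if the bonus brings nothing, the point is left uncoloured. *)
Lemma colouring_ge e t : (forall i, e i <= Y) -> uniq t ->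
  exists2 col, colouring e t col &
    chains_below (exits e) (edge Y t) <= count (fun p => col p != None) t.
Proof.
elim: t e => [|p t IH] e eY.
  move=> _; exists (fun=> None); first by split.
  rewrite /chains_below; have -> : forall J, lppm (exits e) no_bonus J (edge Y [::]) = 0 => //.
  rewrite /=; elim: (Y) => // y IHy J /=.
  by rewrite lstep0 add0n.
move=> /= /andP[pt ut]; have zp := zero_at_edge Y pt; have sz := size_edge Y t.
have skip : chains_below (exits e) (ins p (edge Y t)).1 <= chains_below (exits e) (edge Y t) ->
    exists2 col, colouring e (p :: t) col &
      chains_below (exits e) (ins p (edge Y t)).1 <= count (fun p => col p != None) (p :: t).
  move=> le; have [col c lec] := IH e eY ut.
  exists (set_at col p None); first exact: colouring_set_at c _ _.
  by rewrite count_set_at //; apply: leq_trans le _.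
case: (ltnP p (size (edge Y t))) => pu; last by apply: skip; rewrite ins_out.
have use i : p < e i -> chains_below (exits e) (ins p (edge Y t)).1 <=
      (chains_below (exits (set_at e i p)) (edge Y t)).+1 ->
    exists2 col, colouring e (p :: t) col &
      chains_below (exits e) (ins p (edge Y t)).1 <= count (fun p => col p != None) (p :: t).
  move=> pe le; have e'Y j : set_at e i p j <= Y by rewrite /set_at; case: eqP => // _; lia.
  have [col c lec] := IH _ e'Y ut.
  exists (set_at col p (Some i)).
    apply: colouring_set_at c _ _ => // j; first by rewrite /set_at; case: eqP => [->|//]; lia.
    by case=> <-; rewrite /set_at eqxx.
  by rewrite count_set_at //; apply: leq_trans le _.
have topJ c : c = Y -> 0 < exits e c ->
    lppm (mv (exits e) c p) no_bonus (add_at (mv (exits e) c p Y) 0 empty_state) (edge Y t) =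
    lppm (add_at 1 p (exits e)) no_bonus (rem0 (add_at (exits e Y) 0 empty_state)) (edge Y t).
  move=> -> ec.
  have -> : add_at (mv (exits e) Y p Y) 0 empty_state =
       rem0 (add_at (exits e Y) 0 empty_state).
    by apply: funext => h; rewrite /add_at /rem0 /empty_state; mv_lia.
  by apply: eq_lppm => // h; rewrite sz => hY; rewrite /add_at; mv_lia.
have [|[J0]|[c [pc cu Dc]]] := lppm_bonus_le (exits e)
    (add_at (exits e Y) 0 empty_state) pu zp.
- by move=> le; apply: skip; rewrite chains_below_ins // /chains_below sz.
- move=> le; have eY0 : 0 < exits e Y by move: J0; rewrite /add_at /empty_state /=.
  have [i ei] := exits_gt0P eY0.
  apply: (use i); first by rewrite ei -sz.
  rewrite chains_below_ins // {1}sz; apply: leq_trans le _; rewrite exits_set; last by rewrite ei -sz.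
  by rewrite /chains_below sz ei topJ.
- move=> le; have [i ei] := exits_gt0P Dc.
  apply: (use i); first by rewrite ei.
  rewrite chains_below_ins // {1}sz; apply: leq_trans le _; rewrite exits_set ?ei //.
  rewrite /chains_below sz; have -> : mv (exits e) c p Y = exits e Y.
    by move: cu; rewrite sz; mv_lia.
  by [].
Qed.

Lemma chains_below_edge t : uniq t ->
  chains_below (exits (fun=> Y)) (edge Y t) = count (fun x => 0 < x <= k) (edge Y t).
Proof.
move=> ut; rewrite -(lpp_waiting k (lattice_edge Y ut)) /chains_below size_edge.
have exE h : exits (fun=> Y) h = if h == Y then k else 0.
  rewrite /exits eq_sym; case: eqP => _; last by rewrite big1.
  by rewrite sum1_card card_ord.
rewrite exE eqxx; apply: eq_lppm => // h; rewrite size_edge exE.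
by case: eqP => // ->; rewrite ltnn.
Qed.

Lemma greene_le t col : uniq t -> colouring (fun=> Y) t col ->
  count (fun p => col p != None) t <= count (fun x => 0 < x <= k) (edge Y t).
Proof. by move=> ut c; rewrite -chains_below_edge //; exact: colouring_le. Qed.

Lemma greene_ge t : uniq t -> exists2 col, colouring (fun=> Y) t col &
  count (fun x => 0 < x <= k) (edge Y t) <= count (fun p => col p != None) t.
Proof. by move=> ut; rewrite -chains_below_edge //; exact: colouring_ge. Qed.

End Greene.

(** * Point sets with prescribed cell counts *)

Section Points.
Variables (X M : nat) (q : nat -> nat -> nat).

(* [q a b] points in the cell of column [a] and row [b], increasing within the
   cell; weakly comparable cells then have comparable points. *)
Definition points : seq (nat * nat * nat) :=
  [seq (ab, c) | ab <- [seq (a, b) | a <- iota 0 X, b <- iota 0 M],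
                 c <- iota 0 (q ab.1 ab.2)].

Definition col_le (u v : nat * nat * nat) : bool :=
  (u.1.1 < v.1.1) || (u.1.1 == v.1.1) &&
  ((u.1.2 < v.1.2) || (u.1.2 == v.1.2) && (u.2 <= v.2)).

Definition row_lt (u v : nat * nat * nat) : bool :=
  (u.1.2 < v.1.2) || (u.1.2 == v.1.2) &&
  ((u.1.1 < v.1.1) || (u.1.1 == v.1.1) && (u.2 < v.2)).

Definition height_of (u : nat * nat * nat) : nat := count (row_lt ^~ u) points.

Definition columns (a0 : nat) : seq nat :=
  [seq height_of u | u <- rev [seq u <- sort col_le points | u.1.1 <= a0]].

Definition height (b0 : nat) : nat := count (fun u => u.1.2 <= b0) points.

Lemma sum_points (f : nat -> nat -> nat) :
  \sum_(u <- points) f u.1.1 u.1.2 = \sum_(a < X) \sum_(b < M) q a b * f a b.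
Proof.
rewrite /points big_allpairs_dep big_allpairs_dep /=.
have e N (F : nat -> nat) : \sum_(a <- iota 0 N) F a = \sum_(a < N) F a.
  by rewrite -[in LHS](subn0 N) -/(index_iota 0 N) big_mkord.
rewrite e; apply: eq_bigr => a _; rewrite e; apply: eq_bigr => b _ /=.
by rewrite big_const_seq count_predT size_iota iter_addn_0 mulnC.
Qed.

Lemma uniq_points : uniq points.
Proof.
apply: allpairs_uniq_dep => [|u _|[u c] [v d] _ _ /= [-> ->]] //; last exact: iota_uniq.
by apply: allpairs_uniq; rewrite ?iota_uniq // => -[? ?] [? ?] _ _ /= [-> ->].
Qed.

Lemma col_le_total : total col_le.
Proof. by move=> [[a b] c] [[a' b'] c']; rewrite /col_le /=; lia. Qed.

Lemma col_le_trans : transitive col_le.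
Proof. by move=> [[a b] c] [[a' b'] c'] [[a2 b2] c2]; rewrite /col_le /=; lia. Qed.

Lemma row_lt_trans : transitive row_lt.
Proof. by move=> [[a b] c] [[a' b'] c'] [[a2 b2] c2]; rewrite /row_lt /=; lia. Qed.

Lemma row_lt_total u v : u != v -> row_lt u v || row_lt v u.
Proof.
case: u v => [[a b] c] [[a' b'] c']; rewrite !xpair_eqE /row_lt /= => h.
by move: h; rewrite !negb_and; lia.
Qed.

Lemma count_ltn (T : eqType) (P Q : pred T) (s : seq T) (x : T) :
  subpred P Q -> x \in s -> Q x -> ~~ P x -> count P s < count Q s.
Proof.
move=> PQ; elim: s => // y s IH; rewrite inE => /orP[/eqP <-|xs] Qx Px /=.
  by rewrite Qx (negPf Px) add0n add1n ltnS; exact: sub_count.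
by have := IH xs Qx Px; have := PQ y; case: (P y) => [/(_ isT) ->|_]; case: (Q y); lia.
Qed.

Lemma row_lt_height u v : u \in points -> row_lt u v -> height_of u < height_of v.
Proof.
move=> up uv; apply: (count_ltn (x := u)) => // [w wu|].
  exact: row_lt_trans wu uv.
by case: (u) => [[a b] c]; rewrite /row_lt /=; lia.
Qed.

Lemma height_of_inj : {in points &, injective height_of}.
Proof.
move=> u v up vp h; apply/eqP; apply: contraT => /row_lt_total /orP[] /row_lt_height.
  by rewrite h ltnn => /(_ up).
by rewrite h ltnn => /(_ vp).
Qed.

Lemma height_of_lt u b0 : u \in points -> (height_of u < height b0) = (u.1.2 <= b0).
Proof.
move=> up; apply/idP/idP => h.
  rewrite leqNgt; apply: contraL h => h; rewrite -leqNgt; apply: sub_count => v /= vb.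
  by rewrite /row_lt (leq_ltn_trans vb h).
apply: (count_ltn (x := u)) => // [w|].
  by rewrite /row_lt => /orP[wu|/andP[/eqP -> _]] //; exact: leq_trans (ltnW wu) h.
by case: (u) => [[a b] c]; rewrite /row_lt /=; lia.
Qed.

Lemma height_mono b0 b1 : b0 <= b1 -> height b0 <= height b1.
Proof. by move=> h; apply: sub_count => u /=; lia. Qed.

Lemma uniq_columns a0 : uniq (columns a0).
Proof.
rewrite map_inj_in_uniq ?rev_uniq ?filter_uniq ?sort_uniq ?uniq_points //.
by move=> u v; rewrite !mem_rev !mem_filter !mem_sort => /andP[_ ?] /andP[_ ?]; exact: height_of_inj.
Qed.

Lemma columns_cat a0 a1 : a0 <= a1 -> exists t, columns a1 = t ++ columns a0.
Proof.
move=> h; rewrite /columns; set s := sort col_le points.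
have ss : sorted col_le s by apply: sort_sorted; exact: col_le_total.
suff -> : [seq u <- s | u.1.1 <= a1] =
    [seq u <- s | u.1.1 <= a0] ++ [seq u <- s | a0 < u.1.1 <= a1].
  by rewrite rev_cat map_cat; eexists.
elim: s ss => //= u s IH us.
have {}IH := IH (path_sorted us).
case: (leqP u.1.1 a0) => ua /=; first by rewrite (leq_trans ua h) IH.
have out v : v \in s -> (v.1.1 <= a0) = false.
  move=> vs; have /allP/(_ v vs) := order_path_min col_le_trans us.
  rewrite /col_le => uv; apply/negbTE; rewrite -ltnNge; apply: leq_trans ua _.
  by case/orP: uv => [/ltnW //|/andP[/eqP -> _]].
have -> : [seq u0 <- s | u0.1.1 <= a0] = [::].
  by apply/eqP; rewrite -(negbK (_ == _)) -has_filter; apply/hasPn => v /out ->.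
have e : [seq u0 <- s | u0.1.1 <= a1] = [seq u0 <- s | a0 < u0.1.1 <= a1].
  by apply: eq_in_filter => v vs; rewrite ltnNge (out v vs).
by rewrite e.
Qed.

Lemma mem_columns a0 p : reflect (exists u, [/\ u \in points, u.1.1 <= a0 & p = height_of u])
  (p \in columns a0).
Proof.
apply: (iffP mapP) => [[u]|[u [up ua ->]]].
  by rewrite mem_rev mem_filter mem_sort => /andP[ua up] ->; exists u.
by exists u => //; rewrite mem_rev mem_filter mem_sort ua.
Qed.

Lemma count_columns a0 (P : pred nat) :
  count P (columns a0) = count (fun u => (u.1.1 <= a0) && P (height_of u)) points.
Proof.
rewrite /columns count_map count_rev count_filter (permP (permEl (perm_sort _ _))).
by apply: eq_count => u /=; rewrite andbC.
Qed.

Lemma pairwise_columns (r : rel nat) a0 :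
  (forall u v, u \in points -> v \in points -> u.1.1 <= a0 -> v.1.1 <= a0 ->
    u != v -> col_le v u -> r (height_of u) (height_of v)) ->
  pairwise r (columns a0).
Proof.
move=> h; rewrite /columns pairwise_map.
set s := rev _.
have hs : {subset s <= [pred u | (u \in points) && (u.1.1 <= a0)]}.
  by move=> u; rewrite mem_rev mem_filter mem_sort inE andbC.
have us : uniq s by rewrite rev_uniq filter_uniq // sort_uniq uniq_points.
have ps : pairwise (fun u v => col_le v u) s.
  rewrite -sorted_pairwise; last by move=> v u w /= vu wv; exact: col_le_trans wv vu.
  rewrite rev_sorted; apply: sorted_filter; first exact: col_le_trans.
  by apply: sort_sorted; exact: col_le_total.
elim: s hs us ps => //= u s IH hs /andP[us us'] /andP[au ps].
rewrite IH // ?andbT; last by move=> v vs; apply: hs; rewrite inE vs orbT.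
apply/allP => v vs; have /andP[up ua] := hs u (mem_head _ _).
have /andP[vp va] : v \in [pred u | (u \in points) && (u.1.1 <= a0)].
  by apply: hs; rewrite inE vs orbT.
apply: h => //; last by move/allP: au => /(_ v vs).
by apply: contraNneq us => ->.
Qed.

Lemma col_le_anti : antisymmetric col_le.
Proof.
move=> [[a b] c] [[a' b'] c']; rewrite /col_le /= => h.
by have [-> -> ->] : [/\ a = a', b = b' & c = c'] by split; lia.
Qed.

Lemma pairwise_columnsP (r : rel nat) a0 u v : pairwise r (columns a0) ->
  u \in points -> v \in points -> u.1.1 <= a0 -> v.1.1 <= a0 ->
  u != v -> col_le v u -> r (height_of u) (height_of v).
Proof.
rewrite /columns pairwise_map; set s := rev _ => rs up vp ua va.
have us : u \in s by rewrite mem_rev mem_filter mem_sort ua.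
have vs : v \in s by rewrite mem_rev mem_filter mem_sort va.
have ps : pairwise (fun u v => col_le v u) s.
  rewrite -sorted_pairwise; last by move=> y x w /= vu wv; exact: col_le_trans wv vu.
  rewrite rev_sorted; apply: sorted_filter; first exact: col_le_trans.
  by apply: sort_sorted; exact: col_le_total.
clear ua va; elim: s rs us vs ps => //= w s IH /andP[rw rs].
rewrite !inE => /orP[/eqP ->|us] /orP[/eqP ->|vs] /andP[aw ps] uv vu.
- by rewrite eqxx in uv.
- by move/allP: rw => /(_ v vs).
- have uw : col_le u w by move/allP: aw => /(_ u us).
  by move: uv; rewrite (@col_le_anti u w) ?eqxx // uw vu.
- exact: IH.
Qed.

Definition comparable_cells (f : nat -> nat -> bool) : Prop := forall a b a' b',
  f a b -> f a' b' -> (a <= a') && (b <= b') || (a' <= a) && (b' <= b).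

(** All points of a cell receive the colour of the cell. Weakly comparable cells have comparable
    points, so this is a colouring by chains and Greene's theorem applies. *)
Lemma cells_le_letters k a0 b0 (color : nat -> nat -> option 'I_k) :
  (forall i, comparable_cells (fun a b => color a b == Some i)) ->
  \sum_(a < X) \sum_(b < M) q a b * [&& a <= a0, b <= b0 & color a b != None] <=
  count (fun x => 0 < x <= k) (edge (height b0) (columns a0)).
Proof.
move=> cmp.
(* A colouring is a function of heights; as heights are injective on [points], the cell is recovered
   by searching for the point. *)
pose colr h : option 'I_k := if [seq u <- points | height_of u == h] is u :: _ then
  if u.1.2 <= b0 then color u.1.1 u.1.2 else None else None.
have colrE u : u \in points -> colr (height_of u) = if u.1.2 <= b0 then color u.1.1 u.1.2 else None.
  move=> up; rewrite /colr; case E: [seq v <- points | _] => [|v s].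
    have : u \in [seq v <- points | height_of v == height_of u] by rewrite mem_filter eqxx.
    by rewrite E.
  have : v \in [seq v <- points | height_of v == height_of u] by rewrite E mem_head.
  by rewrite mem_filter => /andP[/eqP h vp]; rewrite (height_of_inj vp up h).
have colouringP : colouring (fun=> height b0) (columns a0) colr.
  split=> [p i /mem_columns[u [up ua ->]]|].
    by rewrite colrE // height_of_lt //; case: ifP.
  apply: pairwise_columns => u v up vp ua va uv vu; rewrite !colrE //.
  case: ifP => // ub; case Eu: (color _ _) => [i|] //; apply/implyP.
  case: ifP => // vb /eqP Ev; apply: row_lt_height => //.
  have := @cmp i u.1.1 u.1.2 v.1.1 v.1.2; rewrite Eu Ev eqxx => /(_ isT isT).
  move: uv vu; case: (u) (v) => [[a b] c] [[a' b'] c'] /=.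
  by rewrite !xpair_eqE /col_le /row_lt /=; lia.
apply: leq_trans (greene_le (uniq_columns a0) colouringP).
rewrite count_columns -(sum_points (fun a b => [&& a <= a0, b <= b0 & color a b != None])) -sum1_count [leqRHS]big_mkcond /= leq_eqVlt; apply/orP; left; apply/eqP.
apply: eq_big_seq => u up; rewrite colrE //.
by case: (u.1.1 <= a0); case: (u.1.2 <= b0) => //=; case: (color _ _).
Qed.

(** The cells visited by one chain of an optimal colouring are pairwise comparable, and counting all
    the points of these cells only increases the total. *)
Lemma letters_le_cells k a0 b0 : exists f : 'I_k -> nat -> nat -> bool,
  [/\ forall i, comparable_cells (f i),
      forall i a b, f i a b -> (a <= a0) && (b <= b0)
    & count (fun x => 0 < x <= k) (edge (height b0) (columns a0)) <=
      \sum_(a < X) \sum_(b < M) q a b * [exists i, f i a b]].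
Proof.
have [col [hcol hpw] le] := greene_ge k (height b0) (uniq_columns a0).
pose f i a b := has (fun u => [&& u.1.1 == a, u.1.2 == b, u.1.1 <= a0 &
  col (height_of u) == Some i]) points.
have colt u i : u \in points -> u.1.1 <= a0 -> col (height_of u) = Some i -> u.1.2 <= b0.
  move=> up ua cu; rewrite -(height_of_lt b0 up); apply: hcol cu.
  by apply/mem_columns; exists u.
exists f; split.
- move=> i a b a' b' /hasP[u up /and4P[/eqP <- /eqP <- ua /eqP cu]].
  move=> /hasP[v vp /and4P[/eqP <- /eqP <- va /eqP cv]].
  have [->|uv] := eqVneq u v; first by rewrite !leqnn.
  have key w w' : w \in points -> w' \in points -> w.1.1 <= a0 -> w'.1.1 <= a0 ->
      col (height_of w) = Some i -> col (height_of w') = Some i -> w != w' -> col_le w' w ->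
      (w'.1.1 <= w.1.1) && (w'.1.2 <= w.1.2).
    move=> wp wp' wa wa' cw cw' ww le'.
    have hlt : height_of w' < height_of w.
      have := pairwise_columnsP hpw wp wp' wa wa' ww le'.
      by rewrite cw cw' eqxx.
    apply/andP; split; first by case/orP: le' => [/ltnW //|/andP[/eqP -> _]].
    rewrite leqNgt; apply/negP => h; have : row_lt w w' by rewrite /row_lt h.
    by move=> /(row_lt_height wp); lia.
  case/orP: (col_le_total u v) => c.
    by rewrite (key v u) // eq_sym.
  by rewrite (key u v) // orbT.
- move=> i a b /hasP[u up /and4P[/eqP <- /eqP <- ua /eqP cu]].
  by rewrite ua (colt u i).
- apply: leq_trans le _; rewrite count_columns -(sum_points (fun a b => [exists i, f i a b])).
  rewrite -sum1_count big_mkcond /=; rewrite big_seq [leqRHS]big_seq; apply: leq_sum => u up.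
  case: ifP => // /andP[ua]; case E: (col _) => [i|] // _; rewrite lt0b.
  by apply/existsP; exists i; apply/hasP; exists u => //; rewrite !eqxx ua E eqxx.
Qed.

Lemma count_letters a0 b0 : count (fun x => 0 < x) (edge (height b0) (columns a0)) =
  \sum_(a < X) \sum_(b < M) q a b * [&& a <= a0 & b <= b0].
Proof.
rewrite -(sum_points (fun a b => [&& a <= a0 & b <= b0])).
have -> : \sum_(u <- points) [&& u.1.1 <= a0 & u.1.2 <= b0] =
    count (fun p => p < height b0) (columns a0).
  rewrite count_columns -sum1_count [RHS]big_mkcond /=.
  by apply: eq_big_seq => u up; rewrite height_of_lt //; case: ifP.
elim: (columns a0) (uniq_columns a0) => [_|p t IH /andP[pt ut]] /=.
  by elim: (height b0).
rewrite -IH // -/(count_ge 1 _) -/(count_ge 1 _).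
have sz := size_edge (height b0) t; have zp := zero_at_edge (height b0) pt.
case: (ltnP p (height b0)) => pu; last by rewrite ins_out ?sz.
rewrite (@count_ge_eq 1 _ (edge (height b0) t) [:: (ins p (edge (height b0) t)).2]) //.
  by rewrite /count_ge /= ins_letter_gt0 ?sz // addn0 addnC.
by move=> i i0; rewrite count_ins ?sz //= addn0.
Qed.

End Points.

Import Order.TTheory GRing.Theory Num.Theory.

Local Open Scope ring_scope.

(** * The continuous extension of phi *)

Definition weight (R : realFieldType) (n : nat) (b : nat -> R) (I : nat -> nat) : R :=
  \sum_(i < n) (I i.+1)%:R * b i.+1.

Section LppLinear.
Variables (R : realFieldType) (n : nat) (b : nat -> R) (tau : nat -> R).
Variables (N d : R) (u0 : seq nat).
Hypothesis letters : all (geq n) u0.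
Hypothesis N0 : 0 <= N.
Hypothesis tau0 : forall m, 0 <= tau m.
Hypothesis tau_mono : forall m m', (m <= m')%N -> tau m <= tau m'.
Hypothesis linear : forall i u1 u2, (0 < i <= n)%N -> u0 = u1 ++ u2 ->
  `|(count_mem i u2)%:R - N * b i * tau (size u2)| <= d.

Lemma count_in_linear I u1 u2 : adm_state I -> I 0%N = 0%N -> u0 = u1 ++ u2 ->
  `|(count_in I u2)%:R - N * weight n b I * tau (size u2)| <= n%:R * d.
Proof.
move=> aI I0 e.
rewrite (@count_in_sum n) //; last by move: letters; rewrite e all_cat => /andP[].
rewrite natr_sum /weight !mulr_sumr mulr_suml -sumrB.
apply: le_trans (ler_norm_sum _ _ _) _.
have -> : n%:R * d = \sum_(i < n) d by rewrite sumr_const card_ord mulr_natl.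
apply: ler_sum => i _; rewrite natrM.
have -> : (I i.+1)%:R * (count_mem i.+1 u2)%:R -
  N * ((I i.+1)%:R * b i.+1) * tau (size u2) =
  (I i.+1)%:R * ((count_mem i.+1 u2)%:R - N * b i.+1 * tau (size u2)) by ring.
have lin : `|(count_mem i.+1 u2)%:R - N * b i.+1 * tau (size u2)| <= d.
  by apply: (linear (u1 := u1)) => //=.
have d0 : 0 <= d := le_trans (normr_ge0 _) lin.
rewrite normrM normr_nat.
have : (I i.+1 <= 1)%N by apply: (proj1 aI).
by case: (I i.+1) => [|[|//]] _; rewrite ?mul0r ?mul1r.
Qed.

(** Measured by the clock [tau], the family collects at rate [weight I] until its first jump and, by
    induction, at most at the rate of some dominated [I'] afterwards. Keeping the better of the two
    rates throughout is at least as good. A jump costs the letter on which it occurs and two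
    counting errors [n%:R * d]; the potential bounds the number of jumps. *)
Lemma lpp_le_linear u1 u I : u0 = u1 ++ u -> adm_state I -> I 0%N = 0%N ->
  exists2 I', dominates I I' & (lpp I u)%:R <=
    N * weight n b I' * tau (size u) +
    (1 + 2 * n%:R * d) * (potential n I).+1%:R.
Proof.
have d0 : (0 < n)%N -> 0 <= d.
  move=> n0; apply: le_trans (normr_ge0 _) (linear (i := 1) (u1 := u0) (u2 := [::]) _ _) => //.
  by rewrite cats0.
have nd0 : 0 <= n%:R * d by case: n d0 => [|m] h; rewrite ?mul0r // mulr_ge0 // h.
move: {2}(potential n I) (leqnn (potential n I)) => p.
elim: p u1 u I => [|p IH] u1 u I pI e aI I0; case: (lpp_split u I0) => [eq|].
- exists I; first exact: dominates_refl.
  have := count_in_linear aI I0 e; rewrite eq ler_norml => /andP[_ h].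
  have h1 : (1 : R) <= (potential n I).+1%:R by rewrite ler1n.
  by nra.
- move=> [v1 [x [v2 [j [ev Ij jx Ix _]]]]].
  have j0 : (0 < j)%N by case: (posnP j) Ij => [->|]; rewrite ?I0.
  have xn : (x <= n)%N by move: letters; rewrite e ev !all_cat /= => /and3P[_ _ /andP[]].
  by have := potential_mv j0 Ij jx xn Ix; lia.
- exists I; first exact: dominates_refl.
  have := count_in_linear aI I0 e; rewrite eq ler_norml => /andP[_ h].
  have h1 : (1 : R) <= (potential n I).+1%:R by rewrite ler1n.
  by nra.
- move=> [v1 [x [v2 [j [ev Ij jx Ix eq]]]]].
  have j0 : (0 < j)%N by case: (posnP j) Ij => [->|]; rewrite ?I0.
  have xn : (x <= n)%N by move: letters; rewrite e ev !all_cat /= => /and3P[_ _ /andP[]].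
  have pM := potential_mv j0 Ij jx xn Ix.
  have x0 : (0 < x)%N by lia.
  have aM := adm_mv j aI x0 Ix.
  have M0 : mv I j x 0 = 0%N by mv_lia.
  have e2 : u0 = (u1 ++ v1 ++ [:: x]) ++ v2 by rewrite e ev -!catA.
  have pM' : (potential n (mv I j x) <= p)%N by lia.
  have [I' dI' le] := IH _ _ _ pM' e2 aM M0.
  have c1 := count_in_linear aI I0 e.
  have c2 := count_in_linear aI I0 e2.
  have dI : dominates I I' by exact: dominates_step dI'.
  have ts : tau (size v2) <= tau (size u) by apply: tau_mono; rewrite ev size_cat /=; lia.
  have t2 := tau0 (size v2).
  have cc : (count_in I v1 + count_in I v2 <= count_in I u)%N.
    by rewrite ev /count_in count_cat /=; lia.
  have {}cc : (count_in I v1)%:R + (count_in I v2)%:R <= (count_in I u)%:R :> R.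
    by rewrite -natrD ler_nat.
  have main : (lpp I u)%:R <= N * weight n b I * (tau (size u) - tau (size v2))
      + N * weight n b I' * tau (size v2)
      + (1 + 2 * n%:R * d) * (potential n I).+1%:R.
    rewrite eq -addn1 !natrD.
    have hp : (potential n (mv I j x)).+1%:R + 1 <= (potential n I).+1%:R :> R.
      by rewrite natr1 ler_nat; lia.
    move: c1 c2; rewrite !ler_norml => /andP[_ c1] /andP[c2 _].
    have : (1 + 2 * n%:R * d) * ((potential n (mv I j x)).+1%:R + 1) <=
       (1 + 2 * n%:R * d) * (potential n I).+1%:R by apply: ler_wpM2l => //; nra.
    by nra.
  case: (leP (weight n b I) (weight n b I')) => ww.
    exists I' => //; apply: le_trans main _; rewrite lerD2r.
    have : N * weight n b I * (tau (size u) - tau (size v2)) <=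
       N * weight n b I' * (tau (size u) - tau (size v2)).
      by apply: ler_wpM2r; [lra | exact: ler_wpM2l].
    by lra.
  exists I; first exact: dominates_refl.
  apply: le_trans main _; rewrite lerD2r.
  have : N * weight n b I' * tau (size v2) <= N * weight n b I * tau (size v2).
    by apply: ler_wpM2r => //; apply: ler_wpM2l => //; lra.
  by lra.
Qed.

End LppLinear.

(** An index [i] stands for the line [i.+1]. The families start on disjoint lines [>= k] and then
    move up independently, so [A] and [B] may overlap. *)
Definition adm_pair (n k : nat) (A B : {set 'I_n}) : Prop :=
  exists I J I' J', [/\ split_state k I J, dominates I I', dominates J J',
    forall i : 'I_n, (i \in A) = (0 < I' i.+1)%N
    & forall i : 'I_n, (i \in B) = (0 < J' i.+1)%N].

(* The normalized limit of [count_ge k w + count_ge k (Fbot v w)] when [c] and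
   [e] are the frequencies of the letters of [v] and [w]. *)
Definition lppV (R : realFieldType) (n k : nat) (c e : 'I_n -> R) : R :=
  \big[Num.max/0]_(p : {set 'I_n} * {set 'I_n} | `[< adm_pair k p.1 p.2 >])
    (\sum_(i in p.1) c i + \sum_(i in p.2) e i).

Lemma lppV_ge (R : realFieldType) (n k : nat) (c e : 'I_n -> R) A B :
  adm_pair k A B -> \sum_(i in A) c i + \sum_(i in B) e i <= lppV k c e.
Proof.
by move=> AB; apply: (bigmax_sup (A, B)) => //; apply/asboolP.
Qed.

Lemma lppV_le (R : realFieldType) (n k : nat) (c e : 'I_n -> R) m : 0 <= m ->
  (forall A B, adm_pair k A B -> \sum_(i in A) c i + \sum_(i in B) e i <= m) ->
  lppV k c e <= m.
Proof.
by move=> m0 h; apply/bigmax_leP; split=> // -[A B] /asboolP; exact: h.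
Qed.

Lemma split_stateC k I J : split_state k I J -> split_state k J I.
Proof. by case=> aI aJ h1 h2; split=> // i *; rewrite addnC; [exact: h1 | exact: h2]. Qed.

Lemma adm_pairC n k (A B : {set 'I_n}) : adm_pair k A B -> adm_pair k B A.
Proof.
move=> [I [J [I' [J' [s d1 d2 hA hB]]]]]; exists J, I, J', I'; split=> //.
exact: split_stateC.
Qed.

Lemma split_state_low k I J : split_state k I J -> (0 < k)%N ->
  I 0%N = 0%N /\ J 0%N = 0%N.
Proof. by case=> _ _ _ h k0; have := h 0%N k0; lia. Qed.

Lemma sum_support (R : realFieldType) n (I : nat -> nat) (A : {set 'I_n}) (c : 'I_n -> R) :
  adm_state I -> (forall i : 'I_n, (i \in A) = (0 < I i.+1)%N) ->
  \sum_(i in A) c i = \sum_(i < n) (I i.+1)%:R * c i.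
Proof.
move=> [I1 _] hA; rewrite big_mkcond; apply: eq_bigr => i _; rewrite hA.
by have := I1 i.+1 (ltn0Sn i); case: (I i.+1) => [|[|//]] _; rewrite ?mul0r ?mul1r.
Qed.

Definition capped (n x : nat) : nat := if (x <= n)%N then x else 0%N.

(** Jumps above line [n] are skipped, which is harmless by [mono]; each erased letter costs at most
    one. *)
Lemma lpp_capped n I u : adm_state I ->
  (lpp I u <= lpp I (map (capped n) u) + count_ge n.+1 u)%N.
Proof.
elim: u I => // x u IH I aI; rewrite /= !lpp_cons /count_ge /= -/(count_ge n.+1 u).
case: (leqP x n) => xn; rewrite /capped ?xn.
  rewrite /= add0n.
  case: (posnP x) => [x0|x0].
    by subst x; rewrite !lstep0 /=; apply: IH.
  case: (posnP (I x)) => [Ix|Ix]; last first.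
    by rewrite !lstep_in // addSn ltnS; apply: IH.
  case: (lstep_case false (lpp ^~ u) x0 Ix) => [->|[j [jx Ij ->]]].
    by apply: leq_trans (IH I aI) _; rewrite leq_add2r; exact: lstep_stay.
  have := IH _ (adm_mv j aI x0 Ix).
  have := lstep_move false (lpp ^~ (map (capped n) u)) Ix jx Ij.
  by rewrite /capped; lia.
rewrite (leqNgt x n) xn /= lstep0 /= add0n.
have x0 : (0 < x)%N by lia.
have := IH I aI.
case: (posnP (I x)) => [Ix|Ix]; last by rewrite lstep_in // /capped; lia.
case: (lstep_case false (lpp ^~ u) x0 Ix) => [->|[j [jx Ij ->]]]; first by rewrite /capped; lia.
by have := mono_lpp u aI Ij jx Ix; rewrite /capped; lia.
Qed.

Lemma count_capped n i u : (0 < i <= n)%N ->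
  count_mem i (map (capped n) u) = count_mem i u.
Proof.
move=> /andP[i0 ni]; rewrite count_map; apply: eq_count => x /=; rewrite /capped.
case: leqP => // nx; rewrite (ltn_eqF i0).
by apply/esym/gtn_eqF; apply: leq_ltn_trans nx.
Qed.

Lemma all_capped n u : all (geq n) (map (capped n) u).
Proof. by apply/allP => _ /mapP[x _ ->]; rewrite /capped; case: ifP. Qed.

Lemma count_in_ge n I u : adm_state I ->
  (\sum_(i < n) I i.+1 * count_mem i.+1 u <= count_in I u)%N.
Proof.
move=> [I1 _]; elim: u => [|x u IH] /=; first by rewrite big1 // => i _; rewrite muln0.
under eq_bigr do rewrite mulnDr.
rewrite big_split /= /count_in /= -/(count_in I u) leq_add //.
case: (boolP [exists i : 'I_n, i.+1 == x]) => [/existsP[i /eqP ix]|/existsPn h].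
  rewrite (bigD1 i) //= big1 => [|j ji].
    have := I1 i.+1 (ltn0Sn i); rewrite -ix eqxx /=; case: (I i.+1) => [|[|//]] //.
  by rewrite -ix eqSS; case: eqP; rewrite ?muln0 // => /val_inj ij; move: ji; rewrite ij eqxx.
rewrite big1 // => j _; have := h j; rewrite eq_sym => /negPf ->.
by rewrite muln0.
Qed.

Lemma adm_pair_le_count n k A B (v w : seq nat) : (0 < k)%N -> @adm_pair n k A B ->
  (\sum_(i in A) count_mem i.+1 v + \sum_(i in B) count_mem i.+1 w <=
   count_ge k w + count_ge k (Fbot v w))%N.
Proof.
move=> k0 [I [J [I' [J' [s dI dJ hA hB]]]]].
have [aI aJ _ _] := s.
have aI' := adm_dominates aI dI; have aJ' := adm_dominates aJ dJ.
apply: leq_trans (count_Fbot_ge v w k0 s).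
have h (S : {set 'I_n}) (K : nat -> nat) u : adm_state K -> (forall i : 'I_n, (i \in S) = (0 < K i.+1)%N) ->
    (\sum_(i in S) count_mem i.+1 u <= count_in K u)%N.
  move=> aK hS; apply: leq_trans (count_in_ge n u aK).
  rewrite big_mkcond; apply: leq_sum => i _; rewrite hS.
  by case: (K i.+1) => [|m] //=; lia.
apply: leq_add.
  by apply: leq_trans (h _ _ _ aI' hA) _; apply: leq_trans (count_in_le_lpp _ _) (lpp_dominates _ aI dI).
by apply: leq_trans (h _ _ _ aJ' hB) _; apply: leq_trans (count_in_le_lpp _ _) (lpp_dominates _ aJ dJ).
Qed.

(** For decreasing words, moving at the start is optimal without any error term; the maximum over
    pairs is therefore exact, which identifies [phi_nat]. *)
Lemma adm_pair_ge_count_decreasing n k (v w : seq nat) : (0 < k)%N ->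
  sorted geq v -> sorted geq w -> all (geq n) v -> all (geq n) w ->
  exists2 AB : {set 'I_n} * {set 'I_n}, adm_pair k AB.1 AB.2 &
  (count_ge k w + count_ge k (Fbot v w) <=
   \sum_(i in AB.1) count_mem i.+1 v + \sum_(i in AB.2) count_mem i.+1 w)%N.
Proof.
move=> k0 sv sw lv lw; have [I [J [s le]]] := count_Fbot_le v w k0.
have [aI aJ _ _] := s; have [I0 J0] := split_state_low s k0.
have [I' [dI leI _]] := lpp_le_decreasing aI I0 sv lv.
have [J' [dJ leJ _]] := lpp_le_decreasing aJ J0 sw lw.
have h (K K' : nat -> nat) u : adm_state K -> K 0%N = 0%N -> dominates K K' -> all (geq n) u ->
    count_in K' u = (\sum_(i in [set i : 'I_n | (0 < K' i.+1)%N]) count_mem i.+1 u)%N.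
  move=> aK K0 dK lu; have aK' := adm_dominates aK dK.
  have K'0 : K' 0%N = 0%N by apply: (dominates_low (k := 1) dK) => // i; rewrite ltnS leqn0 => /eqP ->.
  rewrite (count_in_sum aK' K'0 lu) [RHS]big_mkcond; apply: eq_bigr => i _; rewrite inE.
  by have := proj1 aK' i.+1 (ltn0Sn i); case: (K' i.+1) => [|[|//]] _; rewrite ?mul0n ?mul1n.
exists ([set i : 'I_n | (0 < I' i.+1)%N], [set i : 'I_n | (0 < J' i.+1)%N]).
  by exists I, J, I', J'; split=> // i; rewrite inE.
rewrite /= -(h _ _ _ aI I0 dI lv) -(h _ _ _ aJ J0 dJ lw).
by apply: leq_trans le (leq_add leI leJ).
Qed.

(* [tau m] is the fraction of the word made of its last [m] letters. *)
Definition near_linear (R : realFieldType) (n : nat) (c : 'I_n -> R) (N d : R)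
    (u : seq nat) : Prop :=
  exists tau : nat -> R,
  [/\ forall m, 0 <= tau m, forall m m', (m <= m')%N -> tau m <= tau m',
      tau (size u) = 1
    & forall (i : 'I_n) u1 u2, u = u1 ++ u2 ->
        `|(count_mem i.+1 u2)%:R - N * c i * tau (size u2)| <= d].

Lemma lpp_le_near_linear (R : realFieldType) n (c : 'I_n -> R) (N d : R) u I :
  0 <= N -> near_linear c N d u -> adm_state I -> I 0%N = 0%N ->
  exists2 I', dominates I I' & (lpp I u)%:R <=
    N * (\sum_(i < n) (I' i.+1)%:R * c i) +
    (1 + 2 * n%:R * d) * (n * n).+1%:R + (count_ge n.+1 u)%:R.
Proof.
move=> N0 [tau [tau0 taum tau1 lin]] aI I0.
pose b i := if insub i.-1 is Some j then c j else 0.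
have bE (i : 'I_n) : b i.+1 = c i by rewrite /b /= valK.
have lin' i u1 u2 : (0 < i <= n)%N -> map (capped n) u = u1 ++ u2 ->
    `|(count_mem i u2)%:R - N * b i * tau (size u2)| <= d.
  move=> i0n e.
  have e1 : u = take (size u1) u ++ drop (size u1) u by rewrite cat_take_drop.
  have e2 : u2 = map (capped n) (drop (size u1) u).
    by rewrite map_drop e drop_size_cat.
  rewrite e2 count_capped // size_map; case: i i0n => // i /= ni.
  by rewrite (bE (Ordinal ni)); apply: (lin (Ordinal ni) _ _ e1).
have [I' dI le] := lpp_le_linear (all_capped n u) N0 tau0 taum lin' (u1 := [::]) erefl aI I0.
exists I' => //.
have := lpp_capped n u aI; rewrite -(ler_nat R) natrD => /le_trans; apply.
rewrite lerD2r; apply: le_trans le _; rewrite size_map tau1 mulr1 /weight.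
under eq_bigr do rewrite bE.
rewrite lerD2l; have : (potential n I).+1%:R <= (n * n).+1%:R :> R.
  by rewrite ler_nat ltnS; exact: potential_le.
case: (posnP n) => [n0|n0].
  have -> : n%:R = 0 :> R by rewrite n0.
  by rewrite mulr0 mul0r addr0 !mul1r.
apply: ler_wpM2l.
have d0 : 0 <= d := le_trans (normr_ge0 _) (lin (Ordinal n0) u [::] (esym (cats0 _))).
by rewrite addr_ge0 // mulr_ge0 // mulr_ge0.
Qed.

(** In the constant, the first term pays for the jumps of the two families, the 2 for the letters
    above [n] in the two words, and [2 * n%:R] for replacing counts by frequencies in the lower
    bound. *)
Lemma near_linear_count (R : realFieldType) n k (c e : 'I_n -> R) (N d : R) v w :
  0 <= N -> 0 <= d -> (0 < k)%N ->
  near_linear c N d v -> near_linear e N d w ->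
  (count_ge n.+1 v)%:R <= d -> (count_ge n.+1 w)%:R <= d ->
  `|(count_ge k w + count_ge k (Fbot v w))%:R - N * lppV k c e| <=
  (2 * (1 + 2 * n%:R) * (n * n).+1%:R + 2 + 2 * n%:R) * (1 + d).
Proof.
move=> N0 d0 k0 nv nw hv hw.
have nn0 : 0 <= n%:R :> R by [].
have P0 : 0 <= (n * n).+1%:R :> R by [].
have [I [J [s le]]] := count_Fbot_le v w k0.
have [aI aJ _ _] := s; have [I0 J0] := split_state_low s k0.
have [I' dI leI] := lpp_le_near_linear N0 nv aI I0.
have [J' dJ leJ] := lpp_le_near_linear N0 nw aJ J0.
have aI' := adm_dominates aI dI; have aJ' := adm_dominates aJ dJ.
rewrite ler_norml; apply/andP; split; last first.
  pose A := [set i : 'I_n | (0 < I' i.+1)%N]; pose B := [set i : 'I_n | (0 < J' i.+1)%N].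
  have AB : adm_pair k A B by exists I, J, I', J'; split=> // i; rewrite inE.
  have := lppV_ge c e AB.
  rewrite (@sum_support _ _ I') // => [|i]; last by rewrite inE.
  rewrite (@sum_support _ _ J') // => [|i]; last by rewrite inE.
  move=> /(ler_wpM2l N0); rewrite mulrDr => h.
  move: le; rewrite -(ler_nat R) natrD.
  set V := (_ + _)%:R; set a := (lpp I v)%:R in leI *; set b := (lpp J w)%:R in leJ *.
  move: leI leJ h; set SI := N * \sum_(i < n) _; set SJ := N * \sum_(i < n) _.
  move: P0; set P := (n * n).+1%:R => P0.
  move=> leI leJ h le.
  have : 2 * (1 + 2 * n%:R * d) * P <= 2 * (1 + 2 * n%:R) * P * (1 + d).
    rewrite -mulrA -[leRHS]mulrA -mulrA [leRHS]mulrCA mulrCA.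
    suff : (1 + 2 * n%:R * d) * P <= (1 + 2 * n%:R) * (1 + d) * P by nra.
    by apply: ler_wpM2r => //; nra.
  by nra.
have term0 : 0 <= (2 * (1 + 2 * n%:R) * (n * n).+1%:R + 2 + 2 * n%:R) * (1 + d).
  by rewrite mulr_ge0 ?addr_ge0 // ?mulr_ge0 ?addr_ge0 // mulr_ge0.
have part (f : 'I_n -> R) u (S : {set 'I_n}) : near_linear f N d u ->
    N * \sum_(i in S) f i <= (\sum_(i in S) count_mem i.+1 u)%:R + n%:R * d.
  move=> [tau [_ _ tau1 lin]]; rewrite mulr_sumr natr_sum.
  have -> : n%:R * d = \sum_(i < n) d by rewrite sumr_const card_ord mulr_natl.
  apply: (@le_trans _ _ (\sum_(i in S) ((count_mem i.+1 u)%:R + d))).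
    apply: ler_sum => i _; have := lin i [::] u erefl.
    by rewrite tau1 mulr1 ler_norml => /andP[h _]; lra.
  rewrite big_split /= lerD2l big_mkcond; apply: ler_sum => i _.
  by case: ifP.
have : N * lppV k c e <= (count_ge k w + count_ge k (Fbot v w))%:R +
    2 * (n%:R * d); last first.
  have : 2 * (n%:R * d) <= (2 * (1 + 2 * n%:R) * (n * n).+1%:R + 2 + 2 * n%:R) * (1 + d).
    have : 0 <= 2 * (1 + 2 * n%:R) * (n * n).+1%:R :> R by rewrite mulr_ge0 // mulr_ge0 // addr_ge0 // mulr_ge0.
    by nra.
  by lra.
have nd0 : 0 <= 2 * (n%:R * d) by rewrite mulr_ge0 // mulr_ge0.
case: (eqVneq N 0) => [->|Nn0]; first by rewrite mul0r addr_ge0.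
have Np : 0 < N by rewrite lt_neqAle eq_sym Nn0.
rewrite mulrC -ler_pdivlMr //; apply: lppV_le; first by rewrite divr_ge0 // addr_ge0.
move=> A B AB; rewrite ler_pdivlMr // mulrC mulrDr.
have := part c v A nv; have := part e w B nw.
have := adm_pair_le_count v w k0 AB; rewrite -(ler_nat R) natrD.
by lra.
Qed.

Import numFieldNormedType.Exports.

Local Open Scope classical_set_scope.
Local Open Scope ring_scope.

(** * Decreasing words and the uniqueness of the extension *)

Lemma sorted_decreasing_word r (a : 'rV[nat]_r) : sorted geq (decreasing_word a).
Proof.
have geq_trans : transitive geq by move=> x y z /=; lia.
rewrite sorted_pairwise // /decreasing_word.
have : pairwise (fun i j : 'I_r => (j <= i)%N) (rev (enum 'I_r)).
  rewrite -sorted_pairwise; last by move=> x y z /=; lia.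
  rewrite rev_sorted; have := iota_sorted 0 r; rewrite -val_enum_ord sorted_map.
  by apply: sub_sorted => i j.
elim: (rev _) => //= i s IH /andP[ilt /IH {}IH].
rewrite pairwise_cat IH andbT; apply/andP; split; last first.
  by elim: (a _ _) => //= m ->; rewrite andbT all_nseq /= leqnn orbT.
apply/allrelP => x y /nseqP[-> _] /flatten_mapP[j js /nseqP[-> _]] /=.
by rewrite ltnS; move/allP: ilt => /(_ j js).
Qed.

Lemma all_decreasing_word r (a : 'rV[nat]_r) : all (geq r) (decreasing_word a).
Proof. by apply/allP => x /flatten_mapP[j _ /nseqP[-> _]] /=. Qed.

Lemma count_decreasing_word r (a : 'rV[nat]_r) (i : 'I_r) :
  count_mem i.+1 (decreasing_word a) = a ord0 i.
Proof.
rewrite count_flatten -map_comp sumnE big_map.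
rewrite (perm_big (enum 'I_r)) ?perm_rev //= big_enum /= (bigD1 i) //=.
rewrite count_nseq /= eqxx mul1n big1 ?addn0 // => j ji.
by rewrite count_nseq /= eqSS (inj_eq val_inj) (negPf ji).
Qed.

Lemma lppVZ (R : realType) (n k : nat) (c e : 'I_n -> R) (t : R) : 0 <= t ->
  lppV k (fun i => t * c i) (fun i => t * e i) = t * lppV k c e.
Proof.
have V0 k' c' e' : 0 <= @lppV R n k' c' e' by exact: bigmax_ge_id.
have sumZ (f : 'I_n -> R) s (A : {set 'I_n}) : \sum_(i in A) s * f i = s * \sum_(i in A) f i.
  by rewrite mulr_sumr.
have le c' e' s : 0 <= s -> lppV k (fun i => s * c' i) (fun i => s * e' i) <= s * @lppV R n k c' e'.
  move=> s0; apply: lppV_le; first by rewrite mulr_ge0.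
  by move=> A B AB; rewrite !sumZ -mulrDr ler_wpM2l // lppV_ge.
rewrite le0r => /orP[/eqP ->|t0].
  by rewrite mul0r; apply/eqP; rewrite eq_le V0 andbT -[leRHS](mul0r (lppV k c e)) le.
apply/eqP; rewrite eq_le le ?(ltW t0) //=.
rewrite -ler_pdivlMl //; have := @le (fun i => t * c i) (fun i => t * e i) t^-1.
rewrite invr_ge0 (ltW t0) => /(_ isT); apply: le_trans.
have eK (f : 'I_n -> R) : (fun i => t^-1 * (t * f i)) = f.
  by apply/funext => i; rewrite mulKf // gt_eqF.
by rewrite !eK.
Qed.

Lemma continuous_big (R : realType) (T : topologicalType) (op : R -> R -> R) (idx : R)
    (I : Type) (s : seq I) (P : pred I) (F : I -> T -> R) :
  (forall f g : T -> R, continuous f -> continuous g ->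
    continuous (fun x => op (f x) (g x))) ->
  (forall i, continuous (F i)) ->
  continuous (fun x => \big[op/idx]_(i <- s | P i) F i x).
Proof.
move=> cop cF; elim: s => [|i s IH].
  have -> : (fun x => \big[op/idx]_(i <- [::] | P i) F i x) = fun=> idx.
    by apply/funext => x; rewrite big_nil.
  by move=> x; exact: cvg_cst.
have -> : (fun x => \big[op/idx]_(j <- i :: s | P j) F j x) =
    (fun x => if P i then op (F i x) (\big[op/idx]_(j <- s | P j) F j x)
              else \big[op/idx]_(j <- s | P j) F j x).
  by apply/funext => x; rewrite big_cons.
by case: (P i); [exact: cop | exact: IH].
Qed.

(** On integers, [phi_nat] counts the letters 1 of the second word and of [Fbot], that is, letters
    [>= 1] minus letters [>= 2]. Each of these counts is a maximum of finitely many linear forms,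
    hence continuous and homogeneous. *)
Definition phi_ext (R : realType) (n : nat) (p : 'rV[R]_n.+1 * 'rV[R]_n.+1) : R :=
  lppV 1 (p.1 ord0) (p.2 ord0) - lppV 2 (p.1 ord0) (p.2 ord0).

Lemma continuous_lppV (R : realType) (n k : nat) :
  continuous (fun p : 'rV[R]_n * 'rV[R]_n => lppV k (p.1 ord0) (p.2 ord0)).
Proof.
have csum (f : 'rV[R]_n * 'rV[R]_n -> 'rV[R]_n) (A : {set 'I_n}) : continuous f ->
    continuous (fun p => \sum_(i in A) f p ord0 i).
  move=> cf; apply: continuous_big => [g h cg ch x|i x]; first exact: cvgD (cg x) (ch x).
  exact: cvg_comp (cf x) (@coord_continuous _ _ _ _ _ _).
apply: continuous_big => [g h cg ch x|[A B] x].
  exact: continuous_max (cg x) (ch x).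
by apply: cvgD; apply: csum => p; [exact: cvg_fst | exact: cvg_snd].
Qed.

Lemma lppV_nat (R : realType) (n k : nat) (a b : 'rV[nat]_n) : (0 < k)%N ->
  @lppV R n k (map_mx (fun m => m%:R) a ord0) (map_mx (fun m => m%:R) b ord0) =
  (count_ge k (decreasing_word b) + count_ge k (Fbot (decreasing_word a) (decreasing_word b)))%:R.
Proof.
move=> k0; have cw (A : {set 'I_n}) (c : 'rV[nat]_n) :
    \sum_(i in A) (map_mx (fun m => m%:R) c ord0 i : R) =
    (\sum_(i in A) count_mem i.+1 (decreasing_word c))%:R.
  by rewrite natr_sum; apply: eq_bigr => i _; rewrite mxE count_decreasing_word.
apply/eqP; rewrite eq_le; apply/andP; split.
  apply: lppV_le => // A B AB; rewrite !cw -natrD ler_nat.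
  exact: adm_pair_le_count.
have [[A B] AB le] := adm_pair_ge_count_decreasing k0 (sorted_decreasing_word a)
  (sorted_decreasing_word b) (all_decreasing_word a) (all_decreasing_word b).
by apply: le_trans (lppV_ge _ _ AB); rewrite !cw -natrD ler_nat.
Qed.

Lemma count_ge1 u : count_ge 1 u = (count_mem 1 u + count_ge 2 u)%N.
Proof. by rewrite /count_ge; elim: u => //= x u ->; case: x => [|[|x]] /=; lia. Qed.

Lemma phi_ext_extension (R : realType) (n : nat) : is_phi_extension (@phi_ext R n).
Proof.
split.
- apply: continuous_subspaceT => p; apply: cvgB; exact: continuous_lppV.
- move=> c a b c0 _ _.
  have e k : lppV k ((c *: a) ord0) ((c *: b) ord0) = c * lppV k (a ord0) (b ord0).
    rewrite -lppVZ //; have f (u : 'rV[R]_n.+1) : (c *: u) ord0 = (fun i => c * u ord0 i).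
      by apply/funext => i; rewrite mxE.
    by rewrite !f.
  by rewrite /phi_ext /= !e mulrBr.
- move=> a b; rewrite /phi_ext /= !lppV_nat // /phi_nat !count_ge1.
  have -> : b ord0 ord0 = count_mem 1%N (decreasing_word b) :=
    esym (count_decreasing_word b ord0).
  rewrite -natrB; last by lia.
  by congr (_%:R); lia.
Qed.

Lemma cvg_row (R : realType) (n : nat) (u : nat -> 'rV[R]_n.+1) (a : 'rV[R]_n.+1) :
  (forall m i, `|a ord0 i - u m ord0 i| <= m.+1%:R^-1) -> u @ \oo --> a.
Proof.
move=> h; apply/cvgrPdist_le => eps eps0.
near=> m.
have: `|a - u m| <= m.+1%:R^-1.
  rewrite [`|_|]mx_normrE; apply/bigmax_leP; split=> //= -[i j] _ /=.
  by rewrite !mxE (ord1 i).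
move=> /le_trans; apply.
by apply: ltW; near: m; exact: (near_infty_natSinv_lt (PosNum eps0)).
Unshelve. all: by end_near.
Qed.

(** By homogeneity, two extensions agree at the truncations of [m.+1 * a] and [m.+1 * b] divided by
    [m.+1]. These points converge to [(a, b)] inside the orthants, where both extensions are
    continuous. *)
Lemma phiE (R : realType) (n : nat) (a b : 'rV[R]_n.+1) :
  orthant a -> orthant b -> phi a b = phi_ext (a, b).
Proof.
move=> oa ob; rewrite /phi; case: xgetP => [g _ [gcont ghom gnat]|].
  2: by move=> /(_ (@phi_ext R n)) []; exact: phi_ext_extension.
have [fcont fhom fnat] := phi_ext_extension R n.
pose trunc (m : nat) (c : 'rV[R]_n.+1) : 'rV[nat]_n.+1 := \row_i Num.truncn (m.+1%:R * c ord0 i).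
pose app (m : nat) (c : 'rV[R]_n.+1) : 'rV[R]_n.+1 :=
  m.+1%:R^-1 *: map_mx (fun k => k%:R) (trunc m c).
have o_nat (c : 'rV[nat]_n.+1) : orthant (map_mx (fun k => k%:R : R) c) by move=> i; rewrite mxE.
have o_app m c : orthant (app m c) by move=> i; rewrite !mxE mulr_ge0 // invr_ge0.
have cvg_app c : orthant c -> app ^~ c @ \oo --> c.
  move=> oc; apply: cvg_row => m i; rewrite !mxE.
  have m0 : 0 < m.+1%:R :> R by rewrite ltr0n.
  have x0 : 0 <= m.+1%:R * c ord0 i by rewrite mulr_ge0.
  have /andP[t1 t2] := Num.Theory.truncn_itv x0.
  have -> : c ord0 i - m.+1%:R^-1 * (Num.truncn (m.+1%:R * c ord0 i))%:R =
     m.+1%:R^-1 * (m.+1%:R * c ord0 i - (Num.truncn (m.+1%:R * c ord0 i))%:R).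
    by rewrite mulrBr mulKf // gt_eqF.
  rewrite normrM ger0_norm ?invr_ge0 // ler_piMr ?invr_ge0 //.
  by rewrite ger0_norm ?subr_ge0 //; move: t2; rewrite -[ltRHS]natr1; lra.
pose ab m := (app m a, app m b).
have eq_ab m : g (ab m) = phi_ext (ab m).
  rewrite /ab /app ghom ?fhom ?invr_ge0 //; do ?exact: o_nat.
  by rewrite gnat fnat.
have cvg_ab : ab @ \oo --> within (@orthant R n.+1 `*` @orthant R n.+1) (nbhs (a, b)).
  have cp : ab @ \oo --> (a, b) by exact: (cvg_pair (cvg_app a oa) (cvg_app b ob)).
  move=> S wS; change (\forall m \near \oo, S (ab m)).
  have h : \forall m \near \oo,
      (@orthant R n.+1 `*` @orthant R n.+1) (ab m) -> S (ab m) := cp _ wS.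
  by apply: filterS h => m; apply; split; [exact: (o_app m a) | exact: (o_app m b)].
have lim f : {within (@orthant R n.+1 `*` @orthant R n.+1), continuous f} ->
    (fun m => f (ab m)) @ \oo --> (f (a, b) : R).
  move=> /subspace_continuousP /(_ (a, b) (conj oa ob)) fc.
  exact: cvg_comp cvg_ab fc.
have lg := lim g gcont; have lf := lim _ fcont.
apply: (@cvg_unique _ (@norm_hausdorff _ _) _ _ _ _ lg).
have -> // : (fun m => g (ab m)) = (fun m => phi_ext (ab m)).
by apply/funext => m; exact: eq_ab.
Unshelve. all: by end_near.
Qed.

(** * Discretization of the measure *)

(** The sigma-algebra of the plane is the product one, so an open set is written as a countable
    union of boxes with rational centres. *)
Lemma open_measurable_plane (R : realType) (O : set (R * R)) : open O -> measurable O.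
Proof.
move=> oO; pose box (i : rat * rat * nat) : set (R * R) :=
  `]ratr i.1.1 - i.2.+1%:R^-1, ratr i.1.1 + i.2.+1%:R^-1[ `*`
  `]ratr i.1.2 - i.2.+1%:R^-1, ratr i.1.2 + i.2.+1%:R^-1[.
pose F m := if unpickle m is Some i then
  if `[< box i `<=` O >] then box i else set0 else set0.
have -> : O = \bigcup_m F m.
  apply/seteqP; split=> [p Op|p [m _]]; last first.
    by rewrite /F; case: unpickle => // i; case: asboolP => // h /h.
  have := oO; rewrite openE => /(_ p Op) /nbhs_ballP [e /= e0 eO].
  have [m _ /(_ m (leqnn m)) /= me] := near_infty_natSinv_lt (PosNum (divr_gt0 e0 (ltr0n R 2))).
  rewrite /= in me; have m0 : 0 < m.+1%:R^-1 :> R by rewrite invr_gt0 ltr0n.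
  pose d : R := m.+1%:R^-1; rewrite -/d in me m0.
  have rat_near (z : R) : exists q : rat, z - d < ratr q < z + d.
    have zd : z - d < z + d by move: (d) m0 => ? ?; lra.
    by have [q] := rat_in_itvoo zd; rewrite in_itv /=; exists q.
  have [q1 /andP[q1a q1b]] := rat_near p.1; have [q2 /andP[q2a q2b]] := rat_near p.2.
  pose i : rat * rat * nat := (q1, q2, m).
  have bO : box i `<=` O.
    move=> z [] /=; rewrite !in_itv /= -/d => /andP[z1 z2] /andP[z3 z4]; apply: eO.
    move: (d) m0 me q1a q1b q2a q2b z1 z2 z3 z4 => ? *.
    by split=> /=; rewrite /ball /= ltr_norml; apply/andP; split; lra.
  exists (pickle i); first exact: I.
  rewrite /F pickleK; move/asboolP: bO => ->.
  rewrite /box /= -/d; move: (d) m0 q1a q1b q2a q2b => ? *.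
  by split=> /=; rewrite in_itv /=; apply/andP; split; lra.
apply: bigcup_measurable => m _; rewrite /F; case: unpickle => // i.
by case: asboolP => // _; apply: measurableX; exact: measurable_itv.
Qed.

Lemma closed_measurable_plane (R : realType) (C : set (R * R)) : closed C -> measurable C.
Proof.
by move=> cC; have := measurableC (open_measurable_plane (closed_openC cC)); rewrite setCK.
Qed.

(** * Masses and upper semicontinuity of [LIS] *)

Section Mass.
Variables (R : realType) (mu : probability (R * R)%type R).

Definition mass (A : set (R * R)) : R := fine (mu A).

Lemma massE A : measurable A -> mu A = (mass A)%:E.
Proof.
by move=> mA; rewrite /mass fineK // fin_num_measure.
Qed.

Lemma mass_ge0 A : 0 <= mass A.
Proof. by rewrite /mass fine_ge0. Qed.

Lemma mass_set0 : mass set0 = 0.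
Proof. by rewrite /mass measure0. Qed.

Lemma mass_le A B : measurable A -> measurable B -> A `<=` B -> mass A <= mass B.
Proof.
by move=> mA mB AB; rewrite -lee_fin -!massE //; apply: le_measure; rewrite ?inE.
Qed.

Lemma mass_partition n (f : R * R -> nat) A : measurable A ->
  (forall i, measurable (f @^-1` [set i])) -> (forall p, A p -> (f p < n)%N) ->
  mass A = \sum_(i < n) mass (A `&` f @^-1` [set (i : nat)]).
Proof.
move=> mA mf fn; pose F (i : nat) := A `&` f @^-1` [set (i : nat)].
have mF i : measurable (F i) by exact: measurableI.
have tF : trivIset setT (fun i : 'I_n => F i).
  apply/trivIsetP => i j _ _ ij; apply/seteqP; split=> // p [[_ /= pi] [_ /= pj]].
  by move: ij; rewrite -val_eqE /= -pi -pj eqxx.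
have AE : A = \big[setU/set0]_(i < n) F i.
  rewrite -bigcup_mkord; apply/seteqP; split=> [p Ap|p [i _ []] //].
  by exists (f p); [exact: fn | split].
apply: EFin_inj; rewrite -sumEFin -massE // {1}AE measure_bigsetU_ord //.
by apply: eq_bigr => i _; exact: massE.
Qed.

Definition lis (k : nat) (x y : R) : R :=
  fine (LIS k (mrestr mu (measurable_rectangle x y))).

Lemma LIS_fin k x y : LIS k (mrestr mu (measurable_rectangle x y)) = (lis k x y)%:E /\
  0 <= lis k x y <= 1.
Proof.
suff h : (0 <= LIS k (mrestr mu (measurable_rectangle x y)) <= 1)%E.
  have /andP[h0 h1] := h; have fin : LIS k (mrestr mu (measurable_rectangle x y)) \is a fin_num.
    rewrite ge0_fin_numE //; exact: le_lt_trans h1 (ltry _).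
  by rewrite /lis fineK //; split=> //; rewrite -!lee_fin fineK.
rewrite /LIS; case: k => [|k]; first by rewrite lexx lee_fin ler01.
apply/andP; split.
  apply: ereal_sup_ubound; exists set0; last by rewrite measure0.
  split=> //; first exact: closed0.
  by exists (fun=> set0); split; [move=> i p q [] | rewrite bigcup0].
apply: ge_ereal_sup => _ [A [cA _ _] <-]; apply: probability_le1.
by apply: measurableI; [exact: closed_measurable_plane | exact: measurable_rectangle].
Qed.

Lemma lis_ub k x y A : (0 < k)%N -> closed A -> A `<=` rectangle 1 1 ->
  k_nondecreasing_set k A -> mass (A `&` rectangle x y) <= lis k x y.
Proof.
move=> k0 cA A1 kA; rewrite -lee_fin -(proj1 (LIS_fin k x y)) -massE; last first.
  by apply: measurableI; [exact: closed_measurable_plane | exact: measurable_rectangle].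
by case: k k0 kA => // k _ kA; apply: ereal_sup_ubound; exists A.
Qed.

Lemma lis_approx k (x y eps : R) : (0 < k)%N -> 0 < eps ->
  exists A, [/\ closed A, A `<=` rectangle 1 1, k_nondecreasing_set k A &
    lis k x y < mass (A `&` rectangle x y) + eps].
Proof.
move=> k0 eps0; have := proj1 (LIS_fin k x y).
case: k k0 => // k _ e.
have fin : LIS k.+1 (mrestr mu (measurable_rectangle x y)) \is a fin_num by rewrite e.
have [_ [A [cA A1 kA] <-]] := ub_ereal_sup_adherent eps0 fin.
rewrite -/(LIS k.+1 _) e => h; exists A; split=> //.
rewrite -ltrBlDr -lte_fin EFinB -massE //.
by apply: measurableI; [exact: closed_measurable_plane | exact: measurable_rectangle].
Qed.

Lemma closed_rectangle (x y : R) : closed (rectangle x y).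
Proof.
have -> : rectangle x y = fst @^-1` `[0, x] `&` snd @^-1` `[0, y] by [].
by apply: closedI; apply: preimage_closed; [move=> ? _; exact: cvg_fst | exact: itv_closed | move=> ? _; exact: cvg_snd | exact: itv_closed].
Qed.

Lemma compact_rectangle (x y : R) : compact (rectangle x y).
Proof. by apply: compact_setX; exact: segment_compact. Qed.

(** The property satisfied by a union of pairwise comparable cells of a fine grid: two of its points
    cannot be inverted by more than [delta] in both coordinates. *)
Definition roughly_nondecreasing (delta : R) (B : set (R * R)) : Prop :=
  forall p q, B p -> B q -> ~ (p.1 + delta < q.1 /\ q.2 + delta < p.2).

Lemma bigcup_ord_closed k (L : 'I_k -> set (R * R)) :
  (forall i, closed (L i)) -> closed (\bigcup_(i in [set: 'I_k]) L i).
Proof.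
by move=> cL; apply: closed_bigcup => //; exact: finite_finset.
Qed.

Lemma bigcup_ord_measurable k (L : 'I_k -> set (R * R)) :
  (forall i, measurable (L i)) -> measurable (\bigcup_(i in [set: 'I_k]) L i).
Proof.
by move=> mL; apply: fin_bigcup_measurable => // ; exact: finite_finset.
Qed.

(** Continuity of the measure from above, along the neighbourhoods of radius [m.+1%:R^-1], which
    shrink to the closed set. *)
Lemma nbhds_mass_cvg (A : set (R * R)) (c : R) : closed A -> mass A < c ->
  exists O, [/\ open O, A `<=` O & mass O < c].
Proof.
move=> cA Ac; pose O m := \bigcup_(q in A) ball q m.+1%:R^-1.
have oO m : open (O m) by apply: bigcup_open => q _; apply: ball_open; rewrite invr_gt0 ltr0n.
have AO m : A `<=` O m.
  by move=> p Ap; exists p => //; apply: ballxx; rewrite invr_gt0 ltr0n.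
have OA : \bigcap_m O m = A.
  apply/seteqP; split=> [p Op|p Ap m _]; last exact: AO.
  apply: cA => V /nbhs_ballP [e /= e0 eV].
  have [m _ /(_ m (leqnn m)) /= me] := near_infty_natSinv_lt (PosNum e0).
  have [q Aq qp] := Op m I; exists q; split=> //; apply: eV.
  by apply: ball_sym; apply: le_ball qp; exact: ltW.
apply: contrapT => H.
have Oc m : (c%:E <= mu (O m))%E.
  rewrite massE ?lee_fin; last exact: open_measurable_plane.
  by rewrite leNgt; apply/negP => h; apply: H; exists (O m).
have niO : nonincreasing_seq O.
  move=> m m' mm; apply/subsetPset => p [q Aq qp]; exists q => //.
  by apply: le_ball qp; rewrite lef_pV2 ?posrE ?ltr0n // ler_nat ltnS.
have := nonincreasing_cvg_mu (mu := mu) _ (fun m => open_measurable_plane (oO m)) _ niO.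
rewrite OA => /(_ _ (closed_measurable_plane cA)) => cv.
have {}cv : mu \o O @ \oo --> mu A.
  by apply: cv; apply: le_lt_trans (ltry 1); apply: probability_le1; exact: open_measurable_plane.
have : (c%:E <= mu A)%E.
  rewrite -(cvg_lim _ cv) //; apply: lime_ge; first by apply/cvg_ex; exists (mu A).
  exact: nearW.
by rewrite massE ?lee_fin; [rewrite leNgt Ac | exact: closed_measurable_plane].
Qed.

(* Upper semicontinuity: an ultralimit of roughly nondecreasing sets, with
   smaller and smaller roughness, is nondecreasing. *)
Lemma lis_usc k (x y eps : R) : (0 < k)%N -> x <= 1 -> y <= 1 -> 0 < eps ->
  exists2 delta, 0 < delta & forall B : 'I_k -> set (R * R),
    (forall i, roughly_nondecreasing delta (B i)) ->
    (forall i, B i `<=` rectangle x y) ->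
    measurable (\bigcup_(i in [set: 'I_k]) B i) ->
    mass (\bigcup_(i in [set: 'I_k]) B i) <= lis k x y + eps.
Proof.
move=> k0 x1 y1 eps0; apply: contrapT => H.
have bad (j : nat) : exists B : 'I_k -> set (R * R),
   [/\ forall i, roughly_nondecreasing j.+1%:R^-1 (B i),
       forall i, B i `<=` rectangle x y,
       measurable (\bigcup_(i in [set: 'I_k]) B i)
     & lis k x y + eps < mass (\bigcup_(i in [set: 'I_k]) B i)].
  apply: contrapT => H2; apply: H; exists j.+1%:R^-1; first by rewrite invr_gt0 ltr0n.
  move=> B h1 h2 h3; rewrite leNgt; apply/negP => h4; apply: H2.
  by exists B.
have [B hB] := choice bad; clear bad H.
have [G [UG FG]] := @ultraFilterLemma nat \oo _.
have PG : ProperFilter G := @ultra_proper _ _ UG.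
have FilG : Filter G := @filter_filter _ G PG.
(* Thanks to the ultrafilter, a point outside [L i] has a neighbourhood that [B j i] misses for
   [G]-almost every [j]. *)
pose L (i : 'I_k) : set (R * R) := [set p : R * R | forall V : set (R * R), nbhs p V -> G [set j | B j i `&` V !=set0]].
have cL i : closed (L i).
  move=> p clp V; rewrite -[V in nbhs _ V]/V => pV.
  have [q [Lq Vq]] := clp _ (open_nbhs_nbhs (conj (@open_interior _ V) pV)).
  by apply: filterS (Lq _ (open_nbhs_nbhs (conj (@open_interior _ V) Vq))) => j [z [Bz /interior_subset Vz]]; exists z.
have Lr i : L i `<=` rectangle x y.
  move=> p Lp; apply: contrapT => np.
  have := Lp _ (open_nbhs_nbhs (conj (closed_openC (closed_rectangle (x := x) (y := y))) np)).
  move=> /filter_ex [j [z [Bz]]]; apply.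
  by have [_ + _ _] := hB j; apply; exact: Bz.
have Lcmp i p q : L i p -> L i q -> p.1 < q.1 -> q.2 < p.2 -> False.
  move=> Lp Lq pq1 qp2.
  pose d := Num.min (q.1 - p.1) (p.2 - q.2) / 4.
  have d0 : 0 < d by rewrite divr_gt0 // lt_min !subr_gt0 pq1.
  have d1 : 4 * d <= q.1 - p.1 by rewrite /d mulrC divfK // ge_min lexx.
  have d2 : 4 * d <= p.2 - q.2 by rewrite /d mulrC divfK // ge_min lexx orbT.
  have hj : G [set j | j.+1%:R^-1 < d] by apply: FG; exact: (near_infty_natSinv_lt (PosNum d0)).
  have := filterI hj (filterI (Lp _ (nbhsx_ballx p _ d0)) (Lq _ (nbhsx_ballx q _ d0))).
  move=> /(_ FilG FilG) /filter_ex [j [/= jd [[p' [Bp [pp1 pp2]]] [q' [Bq [qq1 qq2]]]]]].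
  have [/(_ i) /(_ p' q' Bp Bq) + _ _ _] := hB j; apply.
  move: pp1 pp2 qq1 qq2; rewrite /ball /= !ltr_norml => /andP[? ?] /andP[? ?] /andP[? ?] /andP[? ?].
  by move: (j.+1%:R^-1 : R) jd => ? ?; split; lra.
pose A := \bigcup_(i in [set: 'I_k]) L i.
have cA : closed A by exact: bigcup_ord_closed.
have Ar : A `<=` rectangle x y by move=> p [i _ /Lr].
have A1 : A `<=` rectangle 1 1.
  move=> p /Ar [] /=; rewrite /rectangle /= !in_itv /= => /andP[? ?] /andP[? ?].
  by split; apply/andP; split=> //; [exact: le_trans x1 | exact: le_trans y1].
have kA : k_nondecreasing_set k A.
  exists L; split=> // i p q Lp Lq; rewrite leNgt; apply/negP => h.
  case: (ltgtP p.1 q.1) => c1; case: (ltgtP p.2 q.2) => c2.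
  - by move: h; rewrite ltNge mulr_ge0 // subr_ge0 ltW.
  - exact: Lcmp Lp Lq c1 c2.
  - by move: h; rewrite c2 subrr mulr0 ltxx.
  - exact: Lcmp Lq Lp c1 c2.
  - by move: h; rewrite ltNge mulr_le0 // subr_le0 ltW.
  - by move: h; rewrite c2 subrr mulr0 ltxx.
  - by move: h; rewrite c1 subrr mul0r ltxx.
  - by move: h; rewrite c1 subrr mul0r ltxx.
  - by move: h; rewrite c1 subrr mul0r ltxx.
have mA : mass A < lis k x y + eps.
  have := lis_ub x y k0 cA A1 kA.
  by rewrite (setIidl Ar) => h; rewrite ltr_pwDr.
have [W [oW AW Wc]] := nbhds_mass_cvg cA mA.
(* By compactness, all the [B j i] avoid the complement of [W] for some [j]; their union then lies
   in [W], whose mass is too small. *)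
have cK : compact (rectangle x y `&` ~` W).
  apply: subclosed_compact (@compact_rectangle x y) _.
    by apply: closedI; [exact: closed_rectangle | exact: open_closedC].
  exact: subIsetl.
have : \forall j \near G, (rectangle x y `&` ~` W) `<=` (fun p => forall i, ~ B j i p).
  move: cK; rewrite compact_near_coveringP; apply=> p [_ np].
  suff h (i : 'I_k) : \forall x' \near p & j \near G, ~ B j i x'.
    exact: (@filter_forall _ _ (fun (i : 'I_k) (z : (R * R) * nat) => ~ B z.2 i z.1) (filter_prod (nbhs p) G) _ h).
  have : ~ L i p by move=> Lp; apply: np; apply: AW; exists i.
  move=> /existsNP [V /not_implyP [pV nG]].
  have [//|GV] := in_ultra_setVsetC [set j | B j i `&` V !=set0] UG.
  exists (V, ~` [set j | B j i `&` V !=set0]) => //= -[q j] [/= Vq nj] Bq.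
  by apply: nj; exists q.
move=> /filter_ex [j Kj]; have [_ hr mB] := hB j; apply/negP; rewrite -leNgt.
apply: ltW; apply: le_lt_trans Wc; apply: mass_le => //; first exact: open_measurable_plane.
move=> p [i _ Bp]; apply: contrapT => nW; exact: (Kj p (conj (hr i p Bp) nW) i Bp).
Qed.

End Mass.

(** * Sampling the measure on a grid *)

Section Grid.
Variables (R : realType).

(** The inequality is strict so that a cut belongs to the cell on its left: a rectangle whose corner
    has its coordinates among the cuts is then a union of cells. *)
Definition rank (s : seq R) (z : R) : nat := count (fun c => c < z) s.

Lemma rank_le s z z' : z <= z' -> (rank s z <= rank s z')%N.
Proof. by move=> zz; apply: sub_count => c /= cz; exact: lt_le_trans cz zz. Qed.

Lemma rank_lt s c z z' : c \in s -> z <= c -> c < z' -> (rank s z < rank s z')%N.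
Proof.
move=> cs zc cz; apply: (count_ltn (x := c)) => // [d /= dz|].
  exact: lt_le_trans dz (le_trans zc (ltW cz)).
by rewrite -leNgt.
Qed.

Lemma rank_mem s c z : c \in s -> (rank s z <= rank s c)%N = (z <= c).
Proof.
move=> cs; apply/idP/idP => [|zc]; last exact: rank_le.
by apply: contraTT; rewrite -ltNge -ltnNge => cz; exact: rank_lt cs (lexx c) cz.
Qed.

Lemma measurable_rank s i : measurable (rank s @^-1` [set i]).
Proof.
elim: s i => [|c s IH] i.
  case: i => [|i]; first by rewrite (_ : _ @^-1` _ = setT) //; apply/seteqP; split.
  by rewrite (_ : _ @^-1` _ = set0) //; apply/seteqP; split.
have -> : rank (c :: s) @^-1` [set i] =
    (`]c, +oo[ `&` (if i is j.+1 then rank s @^-1` [set j] else set0)) `|`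
    (`]-oo, c] `&` rank s @^-1` [set i]).
  apply/seteqP; split=> z; rewrite /rank /=.
    case: ltP => cz /= <-; [left; rewrite add1n|right; rewrite add0n];
      by split; rewrite //= in_itv /= ?andbT.
  case=> [[]|[]]; rewrite /= in_itv /= ?andbT => cz.
    by case: i => // j; rewrite cz => ->.
  by rewrite ltNge cz.
apply: measurableU; apply: measurableI; do ?exact: measurable_itv; last exact: IH.
by case: i => [|j]; [exact: measurable0 | exact: IH].
Qed.

Variables (mu : probability (R * R)%type R) (xs ys : seq R).
Local Notation mass := (mass mu).

Definition cell (a b : nat) : set (R * R) :=
  rectangle 1 1 `&` (rank xs @^-1` [set a] `*` rank ys @^-1` [set b]).

Definition region (P : nat -> nat -> bool) : set (R * R) :=
  [set p | rectangle 1 1 p /\ P (rank xs p.1) (rank ys p.2)].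

Lemma measurable_cell a b : measurable (cell a b).
Proof.
by apply: measurableI; [exact: measurable_rectangle | apply: measurableX; exact: measurable_rank].
Qed.

Lemma measurable_region P : measurable (region P).
Proof.
have -> : region P = \bigcup_a \bigcup_b (if P a b then cell a b else set0).
  apply/seteqP; split=> [p [rp Pp]|p [a _ [b _]]].
    by exists (rank xs p.1) => //; exists (rank ys p.2) => //; rewrite Pp.
  by case: ifP => // Pab [rp [/= pa pb]]; split=> //; rewrite pa pb.
apply: bigcup_measurable => a _; apply: bigcup_measurable => b _.
by case: ifP => _; [exact: measurable_cell | exact: measurable0].
Qed.

Let X := (size xs).+1.
Let M := (size ys).+1.

Lemma mass_cells S : measurable S -> S `<=` rectangle 1 1 ->
  mass S = \sum_(a < X) \sum_(b < M) mass (S `&` cell a b).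
Proof.
move=> mS S1.
have mf1 i : measurable ((rank xs \o fst) @^-1` [set i] : set (R * R)).
  rewrite (_ : _ @^-1` _ = rank xs @^-1` [set i] `*` setT); last by apply/seteqP; split=> p //= [].
  by apply: measurableX => //; exact: measurable_rank.
have mf2 i : measurable ((rank ys \o snd) @^-1` [set i] : set (R * R)).
  rewrite (_ : _ @^-1` _ = setT `*` rank ys @^-1` [set i]); last by apply/seteqP; split=> p //= [].
  by apply: measurableX => //; exact: measurable_rank.
rewrite (@mass_partition _ _ X (rank xs \o fst) S mS mf1); last first.
  by move=> p _; rewrite ltnS; exact: count_size.
apply: eq_bigr => a _.
rewrite (@mass_partition _ _ M (rank ys \o snd) _ _ mf2); last first.
- by move=> p _; rewrite ltnS; exact: count_size.
- exact: measurableI.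
apply: eq_bigr => b _; congr mass; apply/seteqP; split=> p /=.
  by move=> [[Sp pa] pb]; do 2 split => //; exact: S1.
by move=> [Sp [_ [pa pb]]].
Qed.

Lemma mass_region P : mass (region P) =
  \sum_(a < X) \sum_(b < M) (P a b)%:R * mass (cell a b).
Proof.
rewrite mass_cells; [|exact: measurable_region | by move=> p []].
apply: eq_bigr => a _; apply: eq_bigr => b _.
case E: (P a b); rewrite ?mul1r ?mul0r.
  congr mass; apply/seteqP; split=> p /= [] //.
  by move=> rp [pa pb]; split; [split=> //; rewrite pa pb | split].
rewrite (_ : _ `&` _ = set0) ?mass_set0 //.
by apply/seteqP; split=> // p [[_ Pp] [_ [/= pa pb]]]; move: Pp; rewrite pa pb E.
Qed.

Lemma rectangle_region x y : x \in xs -> y \in ys -> x <= 1 -> y <= 1 ->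
  rectangle x y = region (fun a b => (a <= rank xs x)%N && (b <= rank ys y)%N).
Proof.
move=> xx yy x1 y1; apply/seteqP; split=> p; rewrite /region /rectangle /= !in_itv /= !rank_mem //.
  move=> [/andP[p1 px] /andP[p2 py]]; rewrite p1 p2 px py; split=> //.
  by rewrite (le_trans px) // (le_trans py).
by move=> [[/andP[p1 _] /andP[p2 _]] /andP[px py]]; rewrite p1 p2 px py.
Qed.

Variable n : R.
Hypothesis n0 : 0 <= n.

Definition multiplicity (a b : nat) : nat := Num.truncn (n * mass (cell a b)).

Lemma multiplicity_itv a b :
  (multiplicity a b)%:R <= n * mass (cell a b) < (multiplicity a b)%:R + 1.
Proof.
have h : 0 <= n * mass (cell a b) by rewrite mulr_ge0 // mass_ge0.
by have := truncn_itv h; rewrite -[ltRHS]natr1.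
Qed.

Definition word (x y : R) : seq nat :=
  edge (height X M multiplicity (rank ys y)) (columns X M multiplicity (rank xs x)).

(** A cell takes the colour [i] if [B i] meets it, and the cells met by a nondecreasing set are
    pairwise comparable. Rounding down loses at most one point per cell, hence the term [X * M]. *)
Lemma mass_le_word k (B : 'I_k -> set (R * R)) x y :
  x \in xs -> y \in ys -> x <= 1 -> y <= 1 ->
  (forall i, nondecreasing_set (B i)) -> measurable (\bigcup_(i in [set: 'I_k]) B i) ->
  n * mass ((\bigcup_(i in [set: 'I_k]) B i) `&` rectangle x y) <=
  (count (fun l => 0 < l <= k)%N (word x y))%:R + (X * M)%:R.
Proof.
move=> xx yy x1 y1 ndB mB; set A := \bigcup_(i in _) _.
pose color a b : option 'I_k := [pick i | `[< exists2 p, B i p & cell a b p >]].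
have cmp i : comparable_cells (fun a b => color a b == Some i).
  have colorP a b : color a b == Some i -> exists2 p, B i p & cell a b p.
    by rewrite /color; case: pickP => // j /asboolP h /eqP [<-].
  move=> a b a' b' /colorP[p Bp [_ [/= <- <-]]] /colorP[p' Bp' [_ [/= <- <-]]].
  have := ndB i p p' Bp Bp'.
  case: (leP p.1 p'.1) => h1; case: (leP p.2 p'.2) => h2 h.
  - by rewrite (rank_le xs h1) (rank_le ys h2).
  - have e : p'.1 = p.1.
      apply/eqP; rewrite eq_le h1 andbT -subr_le0.
      have : p'.2 - p.2 < 0 by rewrite subr_lt0.
      by move=> h3; move: h; rewrite nmulr_lge0.
    by rewrite e !leqnn (rank_le ys (ltW h2)) orbT.
  - have e : p'.2 = p.2.
      apply/eqP; rewrite eq_le h2 andbT -subr_le0.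
      have : p'.1 - p.1 < 0 by rewrite subr_lt0.
      by move=> h3; move: h; rewrite nmulr_rge0.
    by rewrite e !leqnn (rank_le xs (ltW h1)) orbT.
  - by rewrite (rank_le xs (ltW h1)) (rank_le ys (ltW h2)) orbT.
have := cells_le_letters X M multiplicity (rank xs x) (rank ys y) cmp.
rewrite -(ler_nat R) -/(word x y) => le.
have mAr : measurable (A `&` rectangle x y) by apply: measurableI => //; exact: measurable_rectangle.
rewrite mass_cells //; last first.
  by move=> p [_]; rewrite (rectangle_region xx yy x1 y1) => -[].
have -> : (X * M)%:R = \sum_(a < X) \sum_(b < M) 1 :> R.
  by rewrite !sumr_const !card_ord -mulrnA mulnC.
apply: le_trans (lerD le (lexx _)).
rewrite natr_sum -big_split mulr_sumr; apply: ler_sum => a _ /=.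
rewrite natr_sum -big_split mulr_sumr; apply: ler_sum => b _ /=.
have /andP[_ q1] := multiplicity_itv a b.
case: (boolP [&& _, _ & _]) => [_|out].
  rewrite muln1; apply: (@le_trans _ _ (n * mass (cell a b))); last exact: ltW.
  by apply: ler_wpM2l => //; apply: mass_le; [exact: measurableI (measurable_cell _ _) | exact: measurable_cell |].
rewrite muln0 add0r (_ : _ `&` _ = set0) ?mass_set0 ?mulr0 //.
apply/seteqP; split=> // p [[[i _ Bp] rp] cp]; move: out.
have [_ [/= pa pb]] := cp.
move: rp; rewrite (rectangle_region xx yy x1 y1) => -[_]; rewrite pa pb => /andP[-> ->] /=.
rewrite negbK /color; case: pickP => // /(_ i) /asboolP; case.
by exists p.
Qed.

Definition gridded (s : seq R) (delta : R) : Prop := forall z z', 0 <= z ->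
  z + delta < z' -> z' <= 1 -> (rank s z < rank s z')%N.

(** Greene's theorem turns the letters into [k] families of comparable cells. Points inverted by
    more than [delta] in both coordinates lie in incomparable cells, so each family covers a roughly
    nondecreasing set. *)
Lemma word_le_lis k x y delta eps :
  x \in xs -> y \in ys -> x <= 1 -> y <= 1 -> gridded xs delta -> gridded ys delta ->
  (forall B : 'I_k -> set (R * R), (forall i, roughly_nondecreasing delta (B i)) ->
    (forall i, B i `<=` rectangle x y) ->
    measurable (\bigcup_(i in [set: 'I_k]) B i) ->
    mass (\bigcup_(i in [set: 'I_k]) B i) <= eps) ->
  (count (fun l => 0 < l <= k)%N (word x y))%:R <= n * eps.
Proof.
move=> xx yy x1 y1 gx gy hB.
have [f [cmp fr le]] := letters_le_cells X M multiplicity k (rank xs x) (rank ys y).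
apply: le_trans (_ : n * mass (region (fun a b => [exists i, f i a b])) <= _); last first.
  have -> : region (fun a b => [exists i, f i a b]) = \bigcup_(i in [set: 'I_k]) region (f i).
    apply/seteqP; split=> [p [rp /existsP[i fp]]|p [i _ [rp fp]]]; first by exists i.
    by split=> //; apply/existsP; exists i.
  apply: ler_wpM2l => //; apply: hB => [i p p' [rp fp] [rp' fp'] [h1 h2]|i p [rp fp]|].
  - have [/= rp1 rp2] := rp; have [/= rp1' rp2'] := rp'.
    move: rp1 rp2 rp1' rp2'; rewrite !in_itv /= => /andP[? ?] /andP[? ?] /andP[? ?] /andP[? ?].
    have c1 : (rank xs p.1 < rank xs p'.1)%N by exact: gx.
    have c2 : (rank ys p'.2 < rank ys p.2)%N by exact: gy.
    have := cmp i _ _ _ _ fp fp'.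
    by rewrite (leqNgt (rank ys p.2)) c2 (leqNgt (rank xs p'.1)) c1 andbF.
  - by rewrite (rectangle_region xx yy x1 y1); split=> //; exact: fr fp.
  - by apply: bigcup_ord_measurable => i; exact: measurable_region.
rewrite mass_region mulr_sumr; move: le; rewrite -(ler_nat R) => /le_trans; apply.
rewrite natr_sum; apply: ler_sum => a _; rewrite natr_sum mulr_sumr; apply: ler_sum => b _.
have /andP[q0 _] := multiplicity_itv a b.
by case: [exists _, _]; rewrite ?muln1 ?mul1r // muln0 mul0r mulr0.
Qed.

Lemma count_word_le x y : x \in xs -> y \in ys -> x <= 1 -> y <= 1 ->
  (count (fun l => 0 < l)%N (word x y))%:R <= n * mass (rectangle x y).
Proof.
move=> xx yy x1 y1; rewrite /word count_letters (rectangle_region xx yy x1 y1) mass_region.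
rewrite natr_sum mulr_sumr; apply: ler_sum => a _.
rewrite natr_sum mulr_sumr; apply: ler_sum => b _.
have /andP[q0 _] := multiplicity_itv a b.
by case: (_ && _); rewrite ?muln1 ?mul1r // muln0 mul0r mulr0.
Qed.

End Grid.

Lemma gridded_uniform (R : realType) (delta : R) : 0 < delta ->
  exists s : seq R, forall s', {subset s <= s'} -> gridded s' delta.
Proof.
move=> d0; have [m _ /(_ m (leqnn m)) /= md] := near_infty_natSinv_lt (PosNum d0).
exists [seq i%:R / m.+1%:R | i <- iota 0 m.+2] => s' ss z z' z0 zd z1.
have m0 : 0 < m.+1%:R :> R by rewrite ltr0n.
have zm0 : 0 <= m.+1%:R * z by rewrite mulr_ge0 // ltW.
have /andP[t1 t2] := truncn_itv zm0.
set i := (Num.truncn (m.+1%:R * z)).+1 in t2 *.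
have c1 : z <= i%:R / m.+1%:R by rewrite ler_pdivlMr // mulrC ltW.
have c2 : i%:R / m.+1%:R < z'.
  apply: le_lt_trans zd; apply: (@le_trans _ _ (z + m.+1%:R^-1)); last by rewrite lerD2l ltW.
  rewrite ler_pdivrMr // mulrDl mulVf ?gt_eqF // /i -natr1 lerD2r mulrC.
  by move: t1; rewrite mulrC.
apply: (rank_lt (c := i%:R / m.+1%:R)) => //; apply: ss; apply/mapP; exists i => //.
rewrite mem_iota add0n /=.
have : i%:R / m.+1%:R < 1 :> R by exact: lt_le_trans c2 z1.
by rewrite ltr_pdivrMr // mul1r ltr_nat => /leqW.
Qed.

Lemma common_delta (R : realFieldType) (T : Type) (s : seq T) (P : T -> R -> Prop) :
  (forall a, exists2 d, 0 < d & forall d', d' <= d -> P a d') ->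
  exists2 d, 0 < d & forall d', d' <= d -> List.Forall (fun a => P a d') s.
Proof.
move=> h; elim: s => [|a s [d d0 IH]].
  by exists 1 => // d' _; exact: List.Forall_nil.
have [e e0 eP] := h a.
exists (Num.min d e); first by rewrite lt_min d0.
move=> d'; rewrite le_min => /andP[dd de].
by apply: List.Forall_cons; [exact: eP | exact: IH].
Qed.

Lemma Forall_mem (T : eqType) (P : T -> Prop) (s : seq T) a :
  List.Forall P s -> a \in s -> P a.
Proof.
elim=> // b s' Pb _ IH; rewrite inE => /orP[/eqP -> //|]; exact: IH.
Qed.

(** A union of [r] nondecreasing sets with almost full mass carries almost all the mass of every
    rectangle; this will make the letters above [r] rare. *)
Lemma mass_near_full (R : realType) (mu : probability (R * R)%type R) r (eps : R) :
  (0 < r)%N -> LIS r mu = 1%E -> 0 < eps ->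
  exists B : 'I_r -> set (R * R), [/\ forall i, nondecreasing_set (B i),
    measurable (\bigcup_(i in [set: 'I_r]) B i) &
    forall x y, mass mu (rectangle x y) <=
      mass mu ((\bigcup_(i in [set: 'I_r]) B i) `&` rectangle x y) + eps].
Proof.
case: r => // r _ full eps0.
have fin : LIS r.+1 mu \is a fin_num by rewrite full.
have [_ [A [cA A1 [B [ndB AB]]] <-]] := ub_ereal_sup_adherent eps0 fin.
rewrite -/(LIS r.+1 mu) full => h; exists B; rewrite -AB.
have mA := closed_measurable_plane cA; split=> // x y.
have mr := measurable_rectangle x y.
have mD : measurable (rectangle x y `\` A) by exact: measurableD.
have e1 : mass mu (rectangle x y) = mass mu (A `&` rectangle x y) + mass mu (rectangle x y `\` A).
  apply: EFin_inj; rewrite EFinD -!massE //; last exact: measurableI.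
  rewrite -[in LHS](setUIDK (rectangle x y) A) setIC measureU //.
    exact: measurableI.
  apply/seteqP; split=> [p [[Ap _] [_ nA]]|p []]; exact: nA.
have e2 : mass mu (rectangle x y `\` A) <= mass mu (~` A).
  by apply: mass_le; [exact: mD | exact: measurableC | move=> p []].
have e3 : mass mu (~` A) = 1 - mass mu A.
  by apply: EFin_inj; rewrite EFinB -!massE ?probability_setC //; exact: measurableC.
have : 1 - eps < mass mu A by rewrite -lte_fin EFinB -massE.
by lra.
Qed.

Lemma count_pos_split r u :
  count (fun l => 0 < l)%N u = (count (fun l => 0 < l <= r)%N u + count_ge r.+1 u)%N.
Proof. by rewrite /count_ge; elim: u => //= l u ->; case: (ltnP 0 l); case: (leqP l r) => /=; lia. Qed.

(** The corners of interest are fixed beforehand. Being finitely many, they admit one sample that is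
    accurate for all of them and for all [k <= r]; [t x] lists the heights of the columns up to [x],
    and [Y y] is the number of rows up to [y]. *)
Lemma discretize (R : realType) (mu : probability (R * R)%type R) r (xs ys : seq R) (eta : R) :
  (0 < r)%N -> LIS r mu = 1%E -> 0 < eta ->
  (forall x, x \in xs -> x <= 1) -> (forall y, y \in ys -> y <= 1) ->
  exists (n : R) (t : R -> seq nat) (Y : R -> nat),
  [/\ [/\ 0 < n, 1 <= n * eta & forall x, uniq (t x)],
      forall x x', x <= x' -> exists t1, t x' = t1 ++ t x,
      forall y y', y <= y' -> (Y y <= Y y')%N,
      forall x y k, x \in xs -> y \in ys -> (k <= r)%N ->
        `|(count (fun l => 0 < l <= k)%N (edge (Y y) (t x)))%:R - n * lis mu k x y| <= n * eta
    & forall x y, x \in xs -> y \in ys ->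
        (count_ge r.+1 (edge (Y y) (t x)))%:R <= n * eta].
Proof.
move=> r0 full eta0 xs1 ys1; have eta2 : 0 < eta / 2 by rewrite divr_gt0.
pose items := [seq (k, xy) | k <- iota 1 r, xy <- [seq (x, y) | x <- xs, y <- ys]].
pose P (a : nat * (R * R)) (d : R) := (0 < a.1)%N -> a.2.1 <= 1 -> a.2.2 <= 1 ->
  forall B : 'I_a.1 -> set (R * R), (forall i, roughly_nondecreasing d (B i)) ->
    (forall i, B i `<=` rectangle a.2.1 a.2.2) ->
    measurable (\bigcup_(i in [set: 'I_a.1]) B i) ->
    mass mu (\bigcup_(i in [set: 'I_a.1]) B i) <= lis mu a.1 a.2.1 a.2.2 + eta.
have hP a : exists2 d, 0 < d & forall d', d' <= d -> P a d'.
  case: (pselect [/\ (0 < a.1)%N, a.2.1 <= 1 & a.2.2 <= 1]) => [[a1 a2 a3]|na]; last first.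
    by exists 1 => // d' _ h1 h2 h3; case: na.
  have [d d0 dB] := lis_usc mu a1 a2 a3 eta0.
  exists d => // d' dd _ _ _ B hB; apply: dB => i p q Bp Bq [h1 h2].
  by apply: (hB i p q Bp Bq); split; [apply: le_lt_trans h1 | apply: le_lt_trans h2]; rewrite lerD2l.
have [d d0 dP] := common_delta items hP.
have {dP} dP := dP d (lexx d).
have [s hs] := gridded_uniform d0.
pose xs' := xs ++ s; pose ys' := ys ++ s.
have gx : gridded xs' d by apply: hs => z zs; rewrite mem_cat zs orbT.
have gy : gridded ys' d by apply: hs => z zs; rewrite mem_cat zs orbT.
have xx x : x \in xs -> x \in xs' by move=> h; rewrite mem_cat h.
have yy y : y \in ys -> y \in ys' by move=> h; rewrite mem_cat h.
pose XM := ((size xs').+1 * (size ys').+1)%N.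
(* With this choice the rounding loss, one point per cell, is exactly [n * (eta / 2)]. *)
pose n := XM%:R / (eta / 2).
have XM1 : (1 : R) <= XM%:R by rewrite ler1n.
have n0 : 0 < n by rewrite divr_gt0 // (lt_le_trans ltr01).
have nXM : XM%:R = n * (eta / 2) by rewrite divfK // gt_eqF.
pose Q := multiplicity mu xs' ys' n.
exists n, (fun x => columns (size xs').+1 (size ys').+1 Q (rank xs' x)),
  (fun y => height (size xs').+1 (size ys').+1 Q (rank ys' y)).
have n00 := ltW n0.
split; [split=> // | | | | ].
- by have : n * (eta / 2) <= n * eta; [apply: ler_wpM2l => //; lra | lra].
- by move=> x; exact: uniq_columns.
- by move=> x x' h; apply: columns_cat; exact: rank_le.
- by move=> y y' h; apply: height_mono; exact: rank_le.
- move=> x y k xin yin kr; rewrite -/(word mu xs' ys' n x y).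
  have x1 := xs1 x xin; have y1 := ys1 y yin.
  case: (posnP k) => [->|k0].
    rewrite (@eq_count _ _ pred0) ?count_pred0; last by case.
    by rewrite /lis /= mulr0 subrr normr0 mulr_ge0 // ltW.
  have upper : (count (fun l => 0 < l <= k)%N (word mu xs' ys' n x y))%:R <= n * (lis mu k x y + eta).
    apply: (word_le_lis n00 (xx x xin) (yy y yin) x1 y1 gx gy) => B h1 h2 h3.
    have it : (k, (x, y)) \in items.
      apply/allpairsP; exists (k, (x, y)); split=> //=; first by rewrite mem_iota k0 add1n ltnS kr.
      by apply/allpairsP; exists (x, y).
    exact: (Forall_mem dP it).
  have lower e : 0 < e -> n * lis mu k x y <=
      (count (fun l => 0 < l <= k)%N (word mu xs' ys' n x y))%:R + n * (eta / 2) + n * e.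
    move=> e0; have [A [cA A1 [B [ndB AB]] Ae]] := lis_approx mu x y k0 e0.
    have mA := closed_measurable_plane cA; rewrite AB in mA Ae.
    have := mass_le_word mu n00 (xx x xin) (yy y yin) x1 y1 ndB mA.
    rewrite -nXM -/XM; have := ler_wpM2l n00 (ltW Ae); rewrite mulrDr.
    by lra.
  have {}lower := lower (eta / 2) eta2.
  rewrite ler_norml; apply/andP; split; last by move: upper; rewrite mulrDr; lra.
  by move: lower; rewrite -addrA -mulrDr -splitr; lra.
- move=> x y xin yin; rewrite -/(word mu xs' ys' n x y).
  have x1 := xs1 x xin; have y1 := ys1 y yin.
  have [B [ndB mB hB]] := mass_near_full r0 full eta2.
  have h1 := mass_le_word mu n00 (xx x xin) (yy y yin) x1 y1 ndB mB.
  have h2 := count_word_le mu n00 (xx x xin) (yy y yin) x1 y1.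
  have h3 : (count (fun l => 0 < l)%N (word mu xs' ys' n x y) =
     count (fun l => 0 < l <= r)%N (word mu xs' ys' n x y) + count_ge r.+1 (word mu xs' ys' n x y))%N.
    exact: count_pos_split.
  have := ler_wpM2l n00 (hB x y); rewrite mulrDr.
  move: h1 h2; rewrite h3 natrD -/XM nXM.
  have : n * eta = n * (eta / 2) + n * (eta / 2) by rewrite -mulrDr -splitr.
  by lra.
Qed.

(** * Local behaviour of lambda *)

Lemma count_take_le (T : Type) (P : pred T) (u : seq T) i j :
  (i <= j)%N -> (count P (take i u) <= count P (take j u))%N.
Proof.
by move=> ij; rewrite -(subnKC ij) takeD count_cat leq_addr.
Qed.

Lemma grid_index (L : nat -> nat) Mg p : (0 < Mg)%N -> L 0%N = 0%N -> (p < L Mg)%N ->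
  exists i, [/\ (i < Mg)%N, (L i <= p)%N & (p < L i.+1)%N].
Proof.
move=> _ L0; elim: Mg => [|Mg IH]; first by rewrite L0.
case: (ltnP p (L Mg)) => [/IH [i [iM h1 h2]] _|h1 h2].
  by exists i; split=> //; exact: ltnW.
by exists Mg.
Qed.

Lemma sum_ord_lt i m : (\sum_(j < m) (j < i)%N = minn i m)%N.
Proof.
elim: m => [|m IH]; first by rewrite big_ord0 minn0.
by rewrite big_ord_recr /= IH; case: ltnP; lia.
Qed.

(** The counts are controlled only at the positions [L i], and [tau] is a step function that is
    constant between them. The total count, the count at a grid position and the variation over one
    grid step each contribute at most [D]. *)
Lemma near_linear_grid (R : realFieldType) n (c : 'I_n -> R) (N D : R) (Mg : nat)
    (L : nat -> nat) (u : seq nat) :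
  (0 < Mg)%N -> L 0%N = 0%N -> L Mg = size u ->
  (forall i, i < Mg -> L i <= L i.+1)%N ->
  0 <= D -> (forall j, 0 <= N * c j / Mg%:R <= D) ->
  (forall (j : 'I_n) i, (i <= Mg)%N ->
     `|(count_mem j.+1 (take (L i) u))%:R - N * c j * (i%:R / Mg%:R)| <= D) ->
  near_linear c N (4 * D) u.
Proof.
move=> M0 L0 LM Lmono D0 cD lin.
have MR : 0 < Mg%:R :> R by rewrite ltr0n.
pose idx p := (\sum_(i < Mg) (L i.+1 <= p))%N.
have idx_le p : (idx p <= Mg)%N.
  rewrite -[leqRHS]card_ord -sum1_card /idx; apply: leq_sum => i _; exact: leq_b1.
have idx_mono p p' : (p <= p')%N -> (idx p <= idx p')%N.
  move=> pp; apply: leq_sum => i _; case: (leqP (L i.+1) p) => // h.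
  by rewrite (leq_trans h pp).
have Lle i j : (i <= j)%N -> (j <= Mg)%N -> (L i <= L j)%N.
  move=> ij; rewrite -(subnKC ij); elim: (j - i)%N => [|m IH] jM; first by rewrite addn0.
  rewrite addnS in jM *; apply: leq_trans (IH (ltnW jM)) _; exact: Lmono.
have idxE i p : (i < Mg)%N -> (L i <= p)%N -> (p < L i.+1)%N -> idx p = i.
  move=> iM h1 h2; rewrite /idx (eq_bigr (fun j : 'I_Mg => ((j < i)%N : nat))).
    by rewrite sum_ord_lt; apply/minn_idPl/ltnW.
  move=> j _; congr nat_of_bool; apply/idP/idP => h.
    rewrite ltnNge; apply/negP => ij; have := Lle i.+1 j.+1 ij (ltn_ord j).
    by rewrite leqNgt (leq_ltn_trans h h2).
  apply: leq_trans h1; apply: Lle => //; exact: ltnW.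
(* Grid positions may coincide, so [idx 0] need not be 0; the first branch gives the whole word the
   value 1. *)
pose tau l : R := if (size u <= l)%N then 1 else 1 - (idx (size u - l)%N)%:R / Mg%:R.
have frac1 i : (i <= Mg)%N -> i%:R / Mg%:R <= 1 :> R.
  by move=> iM; rewrite ler_pdivrMr // mul1r ler_nat.
exists tau; split.
- by move=> l; rewrite /tau; case: ifP => // _; rewrite subr_ge0 frac1.
- move=> l l' ll; rewrite /tau; case: ifP => h; first by rewrite (leq_trans h ll).
  case: ifP => h'; first by rewrite lerBlDr lerDl divr_ge0.
  by rewrite lerD2l lerN2 ler_pM2r ?invr_gt0 // ler_nat idx_mono // leq_sub2l.
- by rewrite /tau leqnn.
- move=> j u1 u2 e; have := lin j Mg (leqnn Mg); rewrite LM take_size divff ?gt_eqF // mulr1 => tot.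
  have cnt : (count_mem j.+1 u = count_mem j.+1 u1 + count_mem j.+1 u2)%N by rewrite e count_cat.
  rewrite /tau; have su : size u = (size u1 + size u2)%N by rewrite e size_cat.
  case: ifP => h.
    have u1e : u1 = [::] by apply: size0nil; move: h; rewrite su; lia.
    rewrite mulr1; move: cnt; rewrite u1e /= add0n => <-.
    by apply: le_trans tot _; lra.
  rewrite su addnK.
  case: (ltnP (size u1) (L Mg)) => p1; last first.
    have u2e : u2 = [::] by apply: size0nil; move: p1; rewrite LM su; lia.
    have -> : idx (size u1) = Mg.
      apply/eqP; rewrite eqn_leq idx_le /= -[leqLHS]card_ord -sum1_card /idx.
      apply: leq_sum => i _; rewrite lt0b (leq_trans _ p1) //; apply: Lle => //; exact: ltn_ord.
    by rewrite u2e /= divff ?gt_eqF // subrr mulr0 subr0 normr0 mulr_ge0.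
  have [i [iM h1 h2]] := grid_index M0 L0 p1.
  rewrite (idxE i) //.
  have t1 : u1 = take (size u1) u by rewrite e take_size_cat.
  have c1 := count_take_le (pred1 j.+1) u h1; have c2 := count_take_le (pred1 j.+1) u (ltnW h2).
  rewrite -t1 -(ler_nat R) in c1; rewrite -t1 -(ler_nat R) in c2.
  have /andP[g0 g1] := cD j.
  have := lin j i (ltnW iM); have := lin j i.+1 iM.
  have e1 : N * c j * (i.+1%:R / Mg%:R) = N * c j * (i%:R / Mg%:R) + N * c j / Mg%:R.
    by rewrite -natr1; field; rewrite gt_eqF.
  rewrite e1 mulrBr mulr1; move: tot; rewrite cnt natrD.
  move: c1 c2 g0 g1.
  set a := (count_mem _ (take (L i) u))%:R; set a' := (count_mem _ (take (L i.+1) u))%:R.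
  set b := (count_mem _ u1)%:R; set b' := (count_mem _ u2)%:R.
  set X := N * c j * (i%:R / Mg%:R); set Y := N * c j / Mg%:R; set Z := N * c j.
  rewrite !ler_norml => ? ? ? ? /andP[? ?] /andP[? ?] /andP[? ?].
  by apply/andP; split; lra.
Qed.

(* The letters up to [k] never influence those above [k], hence become 0. *)
Definition shift_letter (k l : nat) : nat := (l - k)%N.

Lemma apply_letter_shift k l u :
  apply_letter (shift_letter k l) (map (shift_letter k) u) =
  map (shift_letter k) (apply_letter l u).
Proof.
elim: u l => //= x u IH l.
case: (leqP l k) => lk.
  have -> : shift_letter k l = 0%N by apply/eqP; rewrite subn_eq0.
  rewrite ltnn /= apply_letter0.
  have low l' w : (l' <= k)%N -> map (shift_letter k) (apply_letter l' w) = map (shift_letter k) w.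
    elim: w l' => //= y w IHw l' lk'; case: ifP => [/andP[l0 /eqP ->]|_] /=; rewrite IHw //; last by lia.
    by congr cons; rewrite /shift_letter; lia.
  case: ifP => [/andP[l0 /eqP ->]|_] /=; rewrite low //; last by lia.
  by congr cons; rewrite /shift_letter; lia.
have -> : (0 < shift_letter k l)%N by rewrite /shift_letter; lia.
have -> : (0 < l)%N by lia.
have -> : (shift_letter k x == shift_letter k l) = (x == l).
  by rewrite /shift_letter; apply/eqP/eqP; lia.
have -> : (shift_letter k l).-1 = shift_letter k l.-1 by rewrite /shift_letter; lia.
by case: eqP => [_|_] /=; rewrite -IH.
Qed.

Lemma Fbot_shift k u w :
  Fbot (map (shift_letter k) u) (map (shift_letter k) w) = map (shift_letter k) (Fbot u w).
Proof. by rewrite /Fbot; elim: w u => //= l w IH u; rewrite apply_letter_shift IH. Qed.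

Lemma count_ge_shift k m u : (0 < m)%N ->
  count_ge m (map (shift_letter k) u) = count_ge (m + k) u.
Proof. by move=> m0; rewrite /count_ge count_map; apply: eq_count => l /=; rewrite /shift_letter; lia. Qed.

Lemma count_mem_shift k m u : (0 < m)%N ->
  count_mem m (map (shift_letter k) u) = count_mem (m + k)%N u.
Proof.
move=> m0; rewrite count_map; apply: eq_count => l /=; rewrite /shift_letter.
by apply/eqP/eqP; lia.
Qed.

(** The two families play the same role in [adm_pair], although the two words do not in [Fbot]. *)
Lemma lppVC (R : realFieldType) n k (c e : 'I_n -> R) : lppV k c e = lppV k e c.
Proof.
have le f g : lppV k f g <= @lppV R n k g f.
  apply: lppV_le; first exact: bigmax_ge_id.
  by move=> A B /adm_pairC AB; rewrite addrC; exact: lppV_ge.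
by apply/eqP; rewrite eq_le !le.
Qed.

Lemma lambdaE (R : realType) (mu : probability (R * R)%type R) k x y :
  lambda mu k x y = lis mu k x y - lis mu k.-1 x y.
Proof.
by rewrite /lambda (proj1 (LIS_fin mu k x y)) (proj1 (LIS_fin mu k.-1 x y)).
Qed.

Lemma count_mem_between j u : (0 < j)%N ->
  (count (fun l => 0 < l <= j)%N u = count (fun l => 0 < l <= j.-1)%N u + count_mem j u)%N.
Proof.
case: j => // j _; elim: u => //= l u ->.
by case: (ltngtP l j.+1); case: (posnP l); case: (leqP l j) => /=; lia.
Qed.

Lemma count_ge_split k u : count_ge k u = (count_mem k u + count_ge k.+1 u)%N.
Proof. by rewrite /count_ge; elim: u => //= l u ->; case: (ltngtP k l) => /=; lia. Qed.

Lemma near_linear_shift (R : realFieldType) n k (f : nat -> R) (lam : nat -> nat -> R)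
    (N d eta : R) (Mg : nat) (L : nat -> nat) (u : seq nat) :
  (0 < k)%N -> 0 <= N -> 0 <= d -> 0 <= eta ->
  (0 < Mg)%N -> L 0%N = 0%N -> L Mg = size u ->
  (forall i, i < Mg -> L i <= L i.+1)%N ->
  (forall j, (k <= j < k + n)%N -> 0 <= f j / Mg%:R <= eta) ->
  (forall j i, (k <= j < k + n)%N -> (i <= Mg)%N ->
    `|(count_mem j (take (L i) u))%:R - N * lam j i| <= 4 * (N * eta) /\
    `|lam j i - i%:R / Mg%:R * f j| <= d) ->
  near_linear (fun i : 'I_n => f (k + i)%N) N (4 * (N * (d + 4 * eta)))
    (map (shift_letter k.-1) u).
Proof.
move=> k0 N0 d0 eta0 M0 L0 LM Lmono fM lin.
have kj (j : 'I_n) : (k <= k + j < k + n)%N by rewrite leq_addr ltn_add2l ltn_ord.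
apply: (@near_linear_grid _ _ _ _ _ Mg L) => //.
- by rewrite size_map.
- by rewrite mulr_ge0 // addr_ge0 // mulr_ge0.
- move=> j; have /andP[f0 f1] := fM _ (kj j); rewrite -mulrA mulr_ge0 //=.
  by apply: ler_wpM2l => //; lra.
- move=> j i iM; have [h1 h2] := lin _ _ (kj j) iM.
  rewrite -map_take count_mem_shift // (_ : (j.+1 + k.-1 = k + j)%N); last by lia.
  have := ler_wpM2l N0 h2; rewrite -{1}(ger0_norm N0) -normrM.
  move: h1; rewrite !ler_norml => /andP[h1 h1'] /andP[h2a h2b].
  move: h2a h2b; rewrite mulrBr mulrA (mulrAC N) => h2a h2b.
  by rewrite mulrDr mulrCA; apply/andP; split; lra.
Qed.

Section Local.
Variables (R : realType) (mu : probability (R * R)%type R) (r : nat).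
Hypotheses (r0 : (0 < r)%N) (full : LIS r mu = 1%E).

Lemma count_mem_lambda (n eta : R) (u : seq nat) j (x y : R) :
  (0 < j)%N ->
  (forall k, (k <= j)%N -> `|(count (fun l => 0 < l <= k)%N u)%:R - n * lis mu k x y| <= n * eta) ->
  `|(count_mem j u)%:R - n * lambda mu j x y| <= 2 * (n * eta).
Proof.
move=> j0 h; have := h j (leqnn j); have := h j.-1 (leq_pred j).
rewrite lambdaE (count_mem_between u j0) natrD mulrBr !ler_norml => /andP[? ?] /andP[? ?].
by apply/andP; split; lra.
Qed.

(** On a sample, adding columns or rows to the region can only add letters [j] to the word of its
    right edge. *)
Lemma lambda_mono j (x y x' y' : R) : (0 < j <= r)%N -> x' <= x -> y' <= y -> x <= 1 -> y <= 1 ->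
  lambda mu j x' y' <= lambda mu j x y.
Proof.
move=> /andP[j0 jr] xx yy x1 y1; apply/ler_addgt0Pr => e e0.
have eta0 : 0 < e / 4 by rewrite divr_gt0.
have xs1 z : z \in [:: x; x'] -> z <= 1.
  by rewrite !inE => /orP[/eqP->|/eqP->] //; exact: le_trans x1.
have ys1 z : z \in [:: y; y'] -> z <= 1.
  by rewrite !inE => /orP[/eqP->|/eqP->] //; exact: le_trans y1.
have [n [T [Y [[n0 _ uT] hT hY hc _]]]] := discretize r0 full eta0 xs1 ys1.
have h1 := count_mem_lambda j0 (fun k kj => hc x y k (mem_head _ _) (mem_head _ _) (leq_trans kj jr)).
have xin : x' \in [:: x; x'] by rewrite !inE eqxx orbT.
have yin : y' \in [:: y; y'] by rewrite !inE eqxx orbT.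
have h2 := count_mem_lambda j0 (fun k kj => hc x' y' k xin yin (leq_trans kj jr)).
have [t1 e1] := hT _ _ xx.
have le : (count_mem j (edge (Y y') (T x')) <= count_mem j (edge (Y y) (T x)))%N.
  rewrite e1 count_edge -?e1 //; apply: leq_trans (leq_addl _ _).
  rewrite -[in leqRHS](cat_take_drop (Y y - Y y') (edge (Y y) (T x'))) count_cat.
  by rewrite drop_edge ?leq_subr // subKn ?hY // leq_addl.
rewrite -(ler_pM2l n0) mulrDr.
move: le h1 h2; rewrite -(ler_nat R) !ler_norml => le /andP[? ?] /andP[? ?].
have : n * e = 4 * (n * (e / 4)) by field.
by lra.
Qed.

Definition stab (m : nat) : R := 2 * (1 + 2 * m%:R) * (m * m).+1%:R + 2 + 2 * m%:R.

Lemma stab_ge0 m : 0 <= stab m.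
Proof. by rewrite /stab !addr_ge0 // !mulr_ge0 // addr_ge0 // mulr_ge0. Qed.

(** Only the values of the [lambda j] on the top and right edges of the rectangle between the two
    corners enter: if they are linear up to [d] there, the increment to the opposite corner is known
    up to a multiple of [d]. The function [b] comes first because the right edge carries the word on
    which the top letters act. *)
Lemma lambda_increment k (x y X Y : R) (a b : nat -> R) (d : R) :
  (0 < k <= r)%N -> 0 <= X -> 0 <= Y -> x <= 1 -> y <= 1 ->
  (forall j, (1 <= j <= r)%N -> 0 <= a j /\ forall th : R, 0 <= th <= 1 ->
     `|lambda mu j x y - lambda mu j (x - th * X) y - th * a j| <= d) ->
  (forall j, (1 <= j <= r)%N -> 0 <= b j /\ forall th : R, 0 <= th <= 1 ->
     `|lambda mu j x y - lambda mu j x (y - th * Y) - th * b j| <= d) ->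
  `|lambda mu k x y - lambda mu k (x - X) (y - Y) -
    (lppV 1 (fun i : 'I_(r - k).+1 => b (k + i)%N) (fun i => a (k + i)%N) -
     lppV 2 (fun i : 'I_(r - k).+1 => b (k + i)%N) (fun i => a (k + i)%N))| <=
    8 * stab (r - k).+1 * d.
Proof.
move=> /andP[k0 kr] X0 Y0 x1 y1 ha hb.
set c := (fun i : 'I__ => b (k + i)%N); set e := (fun i : 'I__ => a (k + i)%N).
pose m := (r - k).+1; have mr : (k + m = r.+1)%N by rewrite /m; lia.
have d0 : 0 <= d.
  have r1 : (1 <= r <= r)%N by rewrite r0 leqnn.
  have [_ /(_ 0)] := ha r r1; rewrite lexx ler01 => /(_ isT).
  exact: le_trans (normr_ge0 _).
have C0 := stab_ge0 m; set C := stab m in C0 *.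
apply/ler_addgt0Pr => e0 e00.
(* The final error is [8 * C * d] plus [34 * C * eta] from the two maxima and [4 * eta] from the
   counts of letters [k] at the two corners. *)
pose eta : R := e0 / (4 + 34 * C).
have K0 : 0 < 4 + 34 * C by lra.
have eta0 : 0 < eta by rewrite divr_gt0.
pose S := \sum_(j < r) (a j.+1 + b j.+1).
have aS j : (1 <= j <= r)%N -> a j <= S /\ b j <= S.
  case: j => // j jr; have jr' : (j < r)%N by [].
  rewrite /S (bigD1 (Ordinal jr')) //=.
  have : 0 <= \sum_(i < r | i != Ordinal jr') (a i.+1 + b i.+1).
    by apply: sumr_ge0 => i _; rewrite addr_ge0 //; [apply: (ha _ _).1 | apply: (hb _ _).1]; rewrite /= ltn_ord.
  by have := (ha _ jr).1; have := (hb _ jr).1; lra.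
have S0 : 0 <= S.
  by apply: sumr_ge0 => i _; rewrite addr_ge0 //; [apply: (ha _ _).1 | apply: (hb _ _).1]; rewrite /= ltn_ord.
(* With [Mg] steps, each of the linear functions varies by at most [eta] over one step. *)
pose Mg := (Num.truncn (S / eta)).+1.
have M0 : 0 < Mg%:R :> R by rewrite ltr0n.
have SM : S / Mg%:R <= eta.
  have Se : 0 <= S / eta by rewrite divr_ge0 // ltW.
  have /andP[_ h] := truncn_itv Se.
  by rewrite ler_pdivrMr // mulrC -ler_pdivrMr // ltW.
pose xi (i : nat) : R := x - i%:R / Mg%:R * X.
pose yi (i : nat) : R := y - i%:R / Mg%:R * Y.
have frac i : 0 <= i%:R / Mg%:R :> R by rewrite divr_ge0.
have fle i : (i <= Mg)%N -> i%:R / Mg%:R <= 1 :> R.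
  by move=> iM; rewrite ler_pdivrMr // mul1r ler_nat.
have frac1 i : (i <= Mg)%N -> 0 <= (i%:R / Mg%:R : R) <= 1.
  by move=> iM; apply/andP; split; [exact: frac | exact: fle].
have xi0 : xi 0%N = x by rewrite /xi !mul0r subr0.
have yi0 : yi 0%N = y by rewrite /yi !mul0r subr0.
have xiM : xi Mg = x - X by rewrite /xi divff ?gt_eqF // mul1r.
have yiM : yi Mg = y - Y by rewrite /yi divff ?gt_eqF // mul1r.
have xi_anti i j : (i <= j)%N -> xi j <= xi i.
  by move=> ij; rewrite lerD2l lerN2 ler_wpM2r // ler_pM2r ?invr_gt0 // ler_nat.
have yi_anti i j : (i <= j)%N -> yi j <= yi i.
  by move=> ij; rewrite lerD2l lerN2 ler_wpM2r // ler_pM2r ?invr_gt0 // ler_nat.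
pose xs := [seq xi i | i <- iota 0 Mg.+1]; pose ys := [seq yi i | i <- iota 0 Mg.+1].
have xs1 z : z \in xs -> z <= 1.
  by move=> /mapP[i _ ->]; apply: le_trans x1; rewrite -xi0; exact: xi_anti.
have ys1 z : z \in ys -> z <= 1.
  by move=> /mapP[i _ ->]; apply: le_trans y1; rewrite -yi0; exact: yi_anti.
have xin i : (i <= Mg)%N -> xi i \in xs by move=> iM; apply: map_f; rewrite mem_iota.
have yin i : (i <= Mg)%N -> yi i \in ys by move=> iM; apply: map_f; rewrite mem_iota.
have [n [T [H [[n0 n1 uT] hT hH hc hr]]]] := discretize r0 full eta0 xs1 ys1.
have n00 := ltW n0.
have cm i i' j : (i <= Mg)%N -> (i' <= Mg)%N -> (1 <= j <= r)%N ->
    `|(count_mem j (edge (H (yi i')) (T (xi i))))%:R - n * lambda mu j (xi i) (yi i')| <=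
    2 * (n * eta).
  move=> iM iM' /andP[j0 jr]; apply: count_mem_lambda => // k' kj.
  by apply: hc; [exact: xin | exact: yin | exact: leq_trans jr].
(* Numbers of columns between [xi i] and [x], and of rows between [yi i] and [y]: they are lengths
   of prefixes of the words [w] and [v]. *)
pose L i := (size (T x) - size (T (xi i)))%N.
pose K i := (H y - H (yi i))%N.
pose w := take (L Mg) (top_letters (H y) (T x)).
pose v := take (K Mg) (edge (H y) (T x)).
have Tx i : exists t, T x = t ++ T (xi i) /\ size t = L i.
  have xix : xi i <= x by rewrite -[leRHS]xi0 xi_anti.
  have [t et] := hT _ _ xix; exists t; split=> //.
  by rewrite /L et size_cat addnK.
have Lmono i j : (i <= j)%N -> (L i <= L j)%N.
  move=> ij; rewrite /L; have [t et] := hT _ _ (xi_anti _ _ ij).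
  by rewrite leq_sub2l // et size_cat leq_addl.
have Kmono i j : (i <= j)%N -> (K i <= K j)%N.
  by move=> ij; rewrite leq_sub2l // hH // yi_anti.
have jk j : (k <= j < k + m)%N -> (1 <= j <= r)%N.
  by rewrite mr ltnS => /andP[h1 ->]; rewrite (leq_trans k0 h1).
have D0 : 0 <= 4 * (n * (d + 4 * eta)).
  by rewrite mulr_ge0 // mulr_ge0 // addr_ge0 // mulr_ge0 // ltW.
have small f : (forall j, (1 <= j <= r)%N -> 0 <= f j /\ f j <= S) ->
    forall j, (k <= j < k + m)%N -> 0 <= f j / Mg%:R <= eta.
  move=> hf j /jk /hf [f0 f1]; rewrite divr_ge0 //=.
  by apply: le_trans SM; rewrite ler_pM2r ?invr_gt0.
have combine (p q : nat) (s l l' : R) : s = p%:R - q%:R ->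
    `|p%:R - n * l| <= 2 * (n * eta) -> `|q%:R - n * l'| <= 2 * (n * eta) ->
    `|s - n * (l - l')| <= 4 * (n * eta).
  move=> ->; rewrite mulrBr !ler_norml => /andP[? ?] /andP[? ?].
  by apply/andP; split; lra.
have nw : near_linear e n (4 * (n * (d + 4 * eta))) (map (shift_letter k.-1) w).
  apply: (@near_linear_shift _ _ k a (fun j i => lambda mu j x y - lambda mu j (xi i) y)
    n d eta Mg L) => //; first exact: ltW.
  - by rewrite /L xi0 subnn.
  - by rewrite size_takel // size_top_letters leq_subr.
  - by move=> i _; exact: Lmono.
  - by apply: small => j jr; split; [exact: (ha j jr).1 | exact: (aS j jr).1].
  - move=> j i /jk jr iM; split; last first.
      by rewrite -/(xi i); exact: (ha j jr).2 (frac1 _ iM).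
    apply: (combine (count_mem j (edge (H y) (T x))) (count_mem j (edge (H y) (T (xi i))))).
    + rewrite /w take_takel ?Lmono //; have [t [et st]] := Tx i.
      have j0 : (0 < j)%N by case/andP: jr.
      have := @count_edge j (H y) t (T (xi i)) j0; rewrite -et st => ->; last exact: uT.
      by rewrite natrD addrK.
    + by have := cm 0%N 0%N j (leq0n _) (leq0n _) jr; rewrite xi0 yi0.
    + by have := cm i 0%N j iM (leq0n _) jr; rewrite yi0.
have nv : near_linear c n (4 * (n * (d + 4 * eta))) (map (shift_letter k.-1) v).
  apply: (@near_linear_shift _ _ k b (fun j i => lambda mu j x y - lambda mu j x (yi i))
    n d eta Mg K) => //; first exact: ltW.
  - by rewrite /K yi0 subnn.
  - by rewrite size_takel // size_edge leq_subr.
  - by move=> i _; exact: Kmono.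
  - by apply: small => j jr; split; [exact: (hb j jr).1 | exact: (aS j jr).2].
  - move=> j i /jk jr iM; split; last first.
      by rewrite -/(yi i); exact: (hb j jr).2 (frac1 _ iM).
    apply: (combine (count_mem j (edge (H y) (T x))) (count_mem j (edge (H (yi i)) (T x)))).
    + rewrite /v take_takel ?Kmono //.
      rewrite -[in RHS](cat_take_drop (K i) (edge (H y) (T x))) count_cat.
      rewrite drop_edge ?leq_subr // /K subKn; last by rewrite hH // -[leRHS]yi0 yi_anti.
      by rewrite natrD addrK.
    + by have := cm 0%N 0%N j (leq0n _) (leq0n _) jr; rewrite xi0 yi0.
    + by have := cm 0%N i j (leq0n _) iM jr; rewrite xi0.
have [t [et st]] := Tx Mg.
have growth k' : (0 < k')%N -> count_ge k' (edge (H y) (T x)) =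
    (count_ge k' (edge (H (yi Mg)) (T (xi Mg))) + (count_ge k' w + count_ge k' (Fbot v w)))%N.
  move=> k'0; have := @count_ge_growth k' (H y) (H (yi Mg)) t (T (xi Mg)) k'0.
  by rewrite -et st; apply; [rewrite hH // -[leRHS]yi0 yi_anti | exact: uT].
have rbig : (count_ge m.+1 (map (shift_letter k.-1) v) <= count_ge r.+1 (edge (H y) (T x)))%N /\
            (count_ge m.+1 (map (shift_letter k.-1) w) <= count_ge r.+1 (edge (H y) (T x)))%N.
  have e1 u : count_ge m.+1 (map (shift_letter k.-1) u) = count_ge r.+1 u.
    by rewrite count_ge_shift //; rewrite addSnnS prednK // addnC mr.
  rewrite !e1; split; last by rewrite [leqRHS]growth // addnCA leq_addr.
  by rewrite -[in leqRHS](cat_take_drop (K Mg) (edge (H y) (T x))) /count_ge count_cat leq_addr.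
have hr' : (count_ge r.+1 (edge (H y) (T x)))%:R <= 4 * (n * (d + 4 * eta)).
  have := hr x y; rewrite -{1}xi0 -{1}yi0 => /(_ (xin _ (leq0n _)) (yin _ (leq0n _))) h.
  apply: le_trans h _; have := mulr_ge0 n00 d0; have := mulr_ge0 n00 (ltW eta0).
  by rewrite mulrDr; lra.
have hv : (count_ge m.+1 (map (shift_letter k.-1) v))%:R <= 4 * (n * (d + 4 * eta)).
  by apply: le_trans hr'; rewrite ler_nat; exact: rbig.1.
have hw : (count_ge m.+1 (map (shift_letter k.-1) w))%:R <= 4 * (n * (d + 4 * eta)).
  by apply: le_trans hr'; rewrite ler_nat; exact: rbig.2.
have V1 := @near_linear_count R m 1 c e n _ _ _ n00 D0 isT nv nw hv hw.
have V2 := @near_linear_count R m 2 c e n _ _ _ n00 D0 isT nv nw hv hw.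
(* After the shift, 1 and 2 stand for [k] and [k.+1]; the difference of the two cases isolates the
   letter [k]. *)
have eV i : (0 < i)%N -> ((count_ge i (map (shift_letter k.-1) w) +
     count_ge i (Fbot (map (shift_letter k.-1) v) (map (shift_letter k.-1) w)))%N)%:R =
     (count_ge (i + k.-1) (edge (H y) (T x)))%:R -
     (count_ge (i + k.-1) (edge (H (yi Mg)) (T (xi Mg))))%:R :> R.
  move=> i0; rewrite Fbot_shift !count_ge_shift // [in RHS]growth; last by rewrite ltn_addr.
  by rewrite [in RHS]natrD addrAC subrr add0r.
move: V1 V2; rewrite !eV // -/(stab m) -/C.
have -> : (1 + k.-1 = k)%N by rewrite add1n prednK.
have -> : (2 + k.-1 = k.+1)%N by rewrite addSn add1n prednK.
have := count_ge_split k (edge (H y) (T x)).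
have := count_ge_split k (edge (H (yi Mg)) (T (xi Mg))).
have kr' : (1 <= k <= r)%N by rewrite k0.
have := cm 0%N 0%N k (leq0n _) (leq0n _) kr'; rewrite xi0 yi0.
have := cm Mg Mg k (leqnn _) (leqnn _) kr'; rewrite xiM yiM.
set c1 := count_mem k _; set c2 := count_mem k _.
set l1 := lambda mu k x y; set l2 := lambda mu k (x - X) (y - Y).
move=> hc1 hc2 -> -> V1 V2.
rewrite -(ler_pM2l n0) -{1}(ger0_norm n00) -normrM.
(* Here [1 <= n * eta] absorbs the additive 1 of [near_linear_count]. *)
have CD : C * (1 + 4 * (n * (d + 4 * eta))) <= n * (C * (4 * d + 17 * eta)).
  by rewrite [leRHS]mulrCA; apply: ler_wpM2l => //; rewrite !mulrDr; lra.
have key : n * (8 * C * d + e0) = 2 * (n * (C * (4 * d + 17 * eta))) + 4 * (n * eta).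
  rewrite /eta; field; rewrite gt_eqF //.
rewrite key; move: V1 V2 hc1 hc2; rewrite !natrD !mulrBr !ler_norml.
move=> /andP[? ?] /andP[? ?] /andP[? ?] /andP[? ?].
by apply/andP; split; lra.
Qed.

End Local.

(** The limits become a bound that is uniform over the finitely many [j] and over a whole interval
    of [h], including [h = 0], since [lambda_increment] tests every point of an edge. *)
Lemma left_linear_approx (R : realType) (r : nat) (g : nat -> R -> R) (l : nat -> R) (delta : R) :
  0 < delta -> (forall j, g j 0 = 0) ->
  (forall j, (1 <= j <= r)%N -> g j h / h @[h --> 0^'+] --> l j) ->
  exists2 h0, 0 < h0 & forall j h, (1 <= j <= r)%N -> 0 <= h <= h0 ->
    `|g j h - h * l j| <= delta * h.
Proof.
move=> delta0 g0 gl.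
pose P (j : nat) (d : R) := (1 <= j <= r)%N -> forall h, 0 <= h <= d ->
    `|g j h - h * l j| <= delta * h.
have hP j : exists2 d, 0 < d & forall d', d' <= d -> P j d'.
  case: (boolP (1 <= j <= r)%N) => [jr|nj]; last by exists 1 => // d' _; rewrite /P (negbTE nj).
  have /cvgrPdist_le /(_ _ delta0) := gl j jr.
  case=> d /= d0 hd; exists (d / 2); first by rewrite divr_gt0.
  move=> d' dd _ h /andP[h0 hd'].
  move: h0; rewrite le_eqVlt => /orP[/eqP <-|h0].
    by rewrite g0 mul0r subrr normr0 mulr0.
  have := hd h; rewrite /= sub0r normrN gtr0_norm // => /(_ _ h0) hh.
  have hlt : h < d by apply: le_lt_trans hd' _; apply: le_lt_trans dd _; lra.
  have -> : g j h - h * l j = (g j h / h - l j) * h.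
    by rewrite mulrBl divfK ?gt_eqF // (mulrC h).
  by rewrite normrM (gtr0_norm h0) ler_pM2r // distrC hh.
have [h0 h00 hh] := common_delta (iota 1 r) hP.
exists h0 => // j h jr hh0; apply: (Forall_mem (hh h0 (lexx _)) _ jr h hh0).
by rewrite mem_iota add1n ltnS.
Qed.

Lemma left_derivative_ge0 (R : realType) (g : R -> R) (l : R) :
  g 0 = 0 -> (forall h, 0 <= h -> 0 <= g h) -> g h / h @[h --> 0^'+] --> l -> 0 <= l.
Proof.
move=> g0 gge gl; apply/ler_addgt0Pr => e e0.
have [||h0 h00 /(_ 1%N h0)] := @left_linear_approx R 1 (fun=> g) (fun=> l) e e0.
- by [].
- by [].
rewrite (ltW h00) lexx => /(_ isT isT); rewrite ler_norml => /andP[_ h].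
have := gge _ (ltW h00) => h'.
by rewrite -(ler_pM2l h00) mulr0 mulrDr; lra.
Qed.

Unset Implicit Arguments.

Theorem theorem2p10 (R : realType) (mu : probability (R * R)%type R) (r : nat)
    (x y : R) (alpha beta : nat -> R) (s t : R) :
  is_permuton mu ->
  (0 < r)%N ->
  LIS r mu = 1%E ->
  0 < x <= 1 ->
  0 < y <= 1 ->
  (forall k, (1 <= k <= r)%N -> is_left_dx (lambda mu k) x y (alpha k)) ->
  (forall k, (1 <= k <= r)%N -> is_left_dy (lambda mu k) x y (beta k)) ->
  0 <= s ->
  0 <= t ->
  forall k, (1 <= k <= r)%N ->
    (lambda mu k x y - lambda mu k (x - t * e) (y - s * e)) / e
      @[e --> 0^'+] -->
    phi (\row_(j < (r - k).+1) (t * alpha (k + j)%N))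
        (\row_(j < (r - k).+1) (s * beta (k + j)%N)).
Proof.
move=> _ r0 full /andP[_ x1] /andP[_ y1] dx dy s0 t0 k kr.
pose gx j h : R := lambda mu j x y - lambda mu j (x - h) y.
pose gy j h : R := lambda mu j x y - lambda mu j x (y - h).
have gx0 j : gx j 0 = 0 by rewrite /gx subr0 subrr.
have gy0 j : gy j 0 = 0 by rewrite /gy subr0 subrr.
have alpha0 j : (1 <= j <= r)%N -> 0 <= alpha j.
  move=> jr; apply: (@left_derivative_ge0 R (gx j)) => //; last exact: dx.
  by move=> h h0; rewrite subr_ge0 (lambda_mono r0 full jr) // gerBl.
have beta0 j : (1 <= j <= r)%N -> 0 <= beta j.
  move=> jr; apply: (@left_derivative_ge0 R (gy j)) => //; last exact: dy.
  by move=> h h0; rewrite subr_ge0 (lambda_mono r0 full jr) // gerBl.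
have kj (j : 'I_(r - k).+1) : (1 <= k + j <= r)%N.
  case/andP: kr => k0 kr; rewrite (leq_trans k0 (leq_addr _ _)) /=.
  by rewrite -[leqRHS](subnKC kr) leq_add2l -ltnS.
rewrite phiE; first last.
- by move=> j; rewrite mxE mulr_ge0 // beta0.
- by move=> j; rewrite mxE mulr_ge0 // alpha0.
apply/cvgrPdist_le => eps eps0.
pose D := 8 * stab R (r - k).+1 * (1 + t + s).
have st0 : 0 < 1 + t + s by rewrite -addrA ltr_pwDl // addr_ge0.
have D0 : 0 <= D by rewrite mulr_ge0 ?mulr_ge0 ?stab_ge0 // ltW.
(* The error given by [lambda_increment] will be [D * delta * e], which is at most [eps * e]. *)
pose delta := eps / (D + 1).
have D1 : 0 < D + 1 by rewrite ltr_wpDl.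
have delta0 : 0 < delta by rewrite divr_gt0.
have [hx hx0 appx] := @left_linear_approx R r gx alpha delta delta0 gx0 dx.
have [hy hy0 appy] := @left_linear_approx R r gy beta delta delta0 gy0 dy.
pose h0 := Num.min hx hy / (1 + t + s).
have hh0 : 0 < h0 by rewrite divr_gt0 // lt_min hx0.
near=> e.
have e0 : 0 < e by [].
have eh : e * (1 + t + s) <= Num.min hx hy.
  by rewrite -ler_pdivlMr //; near: e; exact: nbhs_right_le.
move: eh; rewrite le_min => /andP[ehx ehy].
have te0 : 0 <= t * e by rewrite mulr_ge0 // ltW.
have se0 : 0 <= s * e by rewrite mulr_ge0 // ltW.
have e00 := ltW e0.
have dom (u th h : R) : 0 <= u -> u <= 1 + t + s -> 0 <= th <= 1 -> e * (1 + t + s) <= h ->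
    0 <= th * (u * e) <= h /\ delta * (th * (u * e)) <= delta * (1 + t + s) * e.
  move=> u0 ut /andP[th0 th1] eh.
  have h1 : th * (u * e) <= (1 + t + s) * e.
    apply: le_trans (_ : u * e <= _); last by rewrite ler_wpM2r.
    by rewrite ler_piMl // mulr_ge0.
  rewrite mulr_ge0 ?mulr_ge0 //=; split; first by apply: le_trans h1 _; rewrite mulrC.
  by rewrite -mulrA ler_wpM2l // ltW.
have main := @lambda_increment R mu r r0 full k x y (t * e) (s * e)
  (fun j => e * (t * alpha j)) (fun j => e * (s * beta j)) (delta * (1 + t + s) * e)
  kr te0 se0 x1 y1.
have {}main := main _ _.
have phE : phi_ext (\row_(j < (r - k).+1) (t * alpha (k + j)%N), \row_(j < (r - k).+1) (s * beta (k + j)%N)) * e =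
  lppV 1 (fun i : 'I_(r - k).+1 => e * (s * beta (k + i)%N)) (fun i => e * (t * alpha (k + i)%N)) -
  lppV 2 (fun i : 'I_(r - k).+1 => e * (s * beta (k + i)%N)) (fun i => e * (t * alpha (k + i)%N)).
  (* In [phi] the word acted upon has the frequencies [t * alpha]; in the increment it is the right
     edge, with the frequencies [s * beta]. The symmetry of [lppV] reconciles the two orders. *)
  rewrite !lppVZ // /phi_ext /= mulrC mulrBr; congr (_ * _ - _ * _); rewrite lppVC.
    by congr lppV; apply: funext => j; rewrite mxE.
  by congr lppV; apply: funext => j; rewrite mxE.
rewrite distrC -(ler_pM2r e0) -[X in _ * X <= _](gtr0_norm e0) -normrM mulrBl divfK ?gt_eqF // phE.
apply: le_trans (main _ _) _.
- move=> j jr; split; first by rewrite !mulr_ge0 // alpha0.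
  move=> th th01.
  have tle : t <= 1 + t + s by lra.
  have [d1 d2] := dom t th hx t0 tle th01 ehx.
  have := appx j _ jr d1; rewrite /gx => h; apply: le_trans d2; apply: le_trans h.
  by rewrite le_eqVlt; apply/orP; left; apply/eqP; congr `|_ - _|; ring.
- move=> j jr; split; first by rewrite !mulr_ge0 // beta0.
  move=> th th01.
  have sle : s <= 1 + t + s by lra.
  have [d1 d2] := dom s th hy s0 sle th01 ehy.
  have := appy j _ jr d1; rewrite /gy => h; apply: le_trans d2; apply: le_trans h.
  by rewrite le_eqVlt; apply/orP; left; apply/eqP; congr `|_ - _|; ring.
have -> : 8 * stab R (r - k).+1 * (delta * (1 + t + s) * e) = D * delta * e.
  by rewrite /D; ring.
rewrite ler_pM2r // /delta mulrCA ger_pMr // ler_pdivrMr // mul1r lerDl.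
Unshelve. all: by end_near.
Qed.
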